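(* Let $R$ be a domain that is essentially of finite type over a field, and let $\mathcal I=\{I_n\}_{n\geqslant 0}$ be an $\mathbb{R}$-divisorial filtration of ideals of $R$. Then the divisorial analytic spread of $\mathcal I$ satisfies $\mathrm{d}\ell(\mathcal I)<\infty$; that is, there exists $t\in\mathbb{R}$ such that $\mu(I_n)=O(n^{t-1})$ as $n\to\infty$.
   Context: A ring is essentially of finite type over a field $\Bbbk$ if it is a localization $W^{-1}R_0$ of a finitely generated commutative $\Bbbk$-algebra $R_0$ at a multiplicatively closed subset $W\subseteq R_0$. The ring $R$ is not assumed to be local. For an $R$-module $M$, $\mu(M)$ denotes the smallest cardinality of a generating set of $M$. Let $v$ be a valuation of the quotient field $\operatorname{Quot}(R)$ of $R$, with valuation ring $(V_v,\mathfrak m_v,\Bbbk_v)$ (maximal ideal $\mathfrak m_v$, residue field $\Bbbk_v$), and assume $R\subseteq V_v$. Let $\mathfrak p=\mathfrak m_v\cap R$ be the center of $v$ on $R$, and let $\Bbbk(\mathfrak p)=R_{\mathfrak p}/\mathfrak pR_{\mathfrak p}$. One says that $v$ is a divisorial valuation of $R$ if $\operatorname{trdeg}_{\Bbbk(\mathfrak p)}(\Bbbk_v)=\operatorname{ht}(\mathfrak p)-1$. The valuations below take values in $\mathbb{R}\cup\{\infty\}$, with $v(0)=\infty$. A filtration is a sequence of ideals $\mathcal I=\{I_n\}_{n\geqslant 0}$ of $R$ with $I_0=R$, $I_nI_m\subseteq I_{n+m}$ for all $n,m\geqslant 0$, and $I_{n+1}\subseteq I_n$ for all $n\geqslant 0$.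 A filtration is $\mathbb{R}$-divisorial if there exist divisorial valuations $v_1,\dots,v_s$ of $R$ and positive real numbers $\lambda_1,\dots,\lambda_s$ such that, for every $n\geqslant 0$, $$I_n=\bigcap_{i=1}^s I(v_i)_{n\lambda_i},\qquad\text{where, for }\alpha\in\mathbb{R}_{\geqslant 0},\quad I(v_i)_\alpha=\{f\in R\mid v_i(f)\geqslant\alpha\}.$$ The divisorial analytic spread of an $\mathbb{R}$-divisorial filtration is $$\mathrm{d}\ell(\mathcal I)=\inf\bigl\{t\in\mathbb{R}\mid \mu(I_n)=O(n^{t-1})\bigr\},$$ with $\inf\varnothing=+\infty$. *)

(* Defs.v *)
(* MathComp with MathComp-Analysis.  The real numbers are an arbitrary
   [realType] [Rr], and the value infinity of a valuation is [+oo : \bar Rr].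
   Subsets of a ring are boolean predicates, which, in the presence of the
   classical axioms, is no restriction. *)
From HB Require Import structures.
From mathcomp Require Import all_boot all_order all_algebra.
From mathcomp Require Import generic_quotient ring_quotient fraction.
From mathcomp Require Import all_classical all_reals.
From mathcomp Require Import ereal topology normedtype sequences exp.
(* Not imported: the notations of mpoly clash with those of the analysis
   library. *)
From mathcomp Require mpoly.

Set Implicit Arguments.
Unset Strict Implicit.
Unset Printing Implicit Defensive.

Import Order.TTheory GRing.Theory Num.Theory.

Local Open Scope classical_set_scope.
Local Open Scope ring_scope.
Local Open Scope quotient_scope.

Notation "x %:F" := (@FracField.tofrac _ x).

Definition finitely_generated_algebra (k : fieldType) (A : comAlgType k) :=
  exists s : seq A, forall S : {pred A},
    GRing.subalg_closed S -> {subset s <= S} -> forall x, x \in S.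

(* [phi] exhibits [B] as the ring of fractions of [A] with denominators in [W],
   up to a unique isomorphism of [A]-algebras. *)
Definition is_localization (A : comNzRingType) (B : comUnitRingType)
    (W : {pred A}) (phi : {rmorphism A -> B}) :=
  [/\ forall w, w \in W -> phi w \is a GRing.unit,
      forall b, exists a w, w \in W /\ b = phi a / phi w &
      forall a, phi a = 0 -> exists w, w \in W /\ w * a = 0].

Definition essentially_of_finite_type (k : fieldType) (R : comUnitRingType) :=
  exists (R0 : comAlgType k) (W : {pred R0}) (phi : {rmorphism R0 -> R}),
    [/\ finitely_generated_algebra R0, mulr_closed W & is_localization W phi].

Section ResidueInverse.
Context (A : comNzRingType) (m : idealr A).
Hypothesis m_local : forall x : A, x \notin m -> exists y, y * x = 1.

Let inv (x : {ideal_quot m}) : {ideal_quot m} :=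
  if pselect (exists y, y * x = 1) is left e then projT1 (cid e) else 0.

Lemma residue_mulVf : exists inv : {ideal_quot m} -> {ideal_quot m},
  (forall x, x != 0 -> inv x * x = 1) /\ inv 0 = 0.
Proof.
exists inv; split=> [x x0|]; rewrite /inv; case: pselect => [e|ne] /=.
- exact: (projT2 (cid e)).
- have xm : repr x \notin m.
    apply: contra x0 => xm; rewrite -[x]reprK -(rmorph0 (\pi_{ideal_quot m})).
    by rewrite -Quotient.idealrBE subr0.
  have [y yx] := m_local xm; case: ne; exists (\pi y).
  by rewrite -[x]reprK -rmorphM yx rmorph1.
- by have [y /eqP] := e; rewrite mulr0 eq_sym oner_eq0.
- by [].
Qed.

Definition residue_inv := projT1 (cid residue_mulVf).

Lemma residue_invP :
  (forall x, x != 0 -> residue_inv x * x = 1) /\ residue_inv 0 = 0.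
Proof. by rewrite /residue_inv; case: cid. Qed.

End ResidueInverse.

(* The local ring [R_p] of a domain, as a subring of its field of fractions. *)
Section LocalRing.
Context (R : idomainType) (p : prime_idealr R).

Definition loc_pred : {pred {fraction R}} :=
  [pred x | `[< exists a b, b \notin p /\ x = a%:F / b%:F >]].

Let denom_neq0 (b : R) : b \notin p -> b%:F != 0.
Proof. by apply: contra; rewrite tofrac_eq0 => /eqP ->; exact: idealr0. Qed.

Let denomM (b c : R) : b \notin p -> c \notin p -> b * c \notin p.
Proof. by move=> bp cp; rewrite prime_idealrM negb_or bp. Qed.

Fact loc_subring : subring_closed loc_pred.
Proof.
split=> [|x y|x y].
- apply/asboolP; exists 1, 1; split; first by rewrite idealr1.
  by rewrite rmorph1 divr1.
- move=> /asboolP[a [b [bp ->]]] /asboolP[c [d [dp ->]]]; apply/asboolP.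
  exists (a * d - c * b), (b * d); split; first exact: denomM.
  by rewrite rmorphB !rmorphM /= -[- (_ / _)]mulNr addf_div ?denom_neq0// mulNr.
- move=> /asboolP[a [b [bp ->]]] /asboolP[c [d [dp ->]]]; apply/asboolP.
  exists (a * c), (b * d); split; first exact: denomM.
  by rewrite !rmorphM /= mulf_div.
Qed.
HB.instance Definition _ :=
  GRing.isSubringClosed.Build {fraction R} loc_pred loc_subring.

Record loc := Loc { loc_val : {fraction R}; _ : loc_val \in loc_pred }.
HB.instance Definition _ := [isSub for loc_val].
HB.instance Definition _ := [Choice of loc by <:].
HB.instance Definition _ := [SubChoice_isSubComNzRing of loc by <:].

(* The ideal [p R_p]. *)
Definition loc_max : {pred loc} :=
  [pred x | `[< exists a b, [/\ a \in p, b \notin p & val x = a%:F / b%:F] >]].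

Fact loc_max_idealr : idealr_closed loc_max.
Proof.
split=> [||x u v].
- apply/asboolP; exists 0, 1; split; first exact: idealr0.
    by rewrite idealr1.
  by rewrite rmorph0 mul0r.
- apply/asboolP => -[a [b [ap bp e]]].
  have {}e : 1 = a%:F / b%:F by [].
  have /eqP : a%:F = b%:F by rewrite -[RHS]mul1r e divfK ?denom_neq0.
  by rewrite tofrac_eq => /eqP ab; rewrite -ab ap in bp.
- move: (valP x) => /asboolP[a [b [bp xE]]].
  move=> /asboolP[c [d [cp dp uE]]] /asboolP[e [f [ep fp vE]]]; apply/asboolP.
  exists ((a * c) * f + e * (b * d)), (b * d * f); split.
  + by apply: rpredD; rewrite mulrC; do 2?apply: idealMr.
  + by rewrite !denomM.
  + rewrite /= xE uE vE mulf_div -!rmorphM /=.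
    by rewrite addf_div ?denom_neq0 ?denomM// -!rmorphM /= -rmorphD.
Qed.
HB.instance Definition _ := isIdealr.Build loc loc_max loc_max_idealr.

Fact loc_local (x : loc) : x \notin loc_max -> exists y, y * x = 1.
Proof.
move: (valP x) => /asboolP[a [b [bp xE]]] xm.
have ap : a \notin p.
  by apply: contra xm => ap; apply/asboolP; exists a, b.
have yP : b%:F / a%:F \in loc_pred by apply/asboolP; exists b, a.
exists (Loc yP); apply: val_inj => /=.
by rewrite xE mulf_div [b%:F * _]mulrC divff// mulf_neq0// denom_neq0.
Qed.

(* The residue field [R_p / p R_p]. *)
Definition kappa := {ideal_quot loc_max}.
HB.instance Definition _ := GRing.ComNzRing.on kappa.
HB.instance Definition _ := GRing.ComNzRing_isField.Build kappa
  (residue_invP loc_local).1 (residue_invP loc_local).2.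

End LocalRing.

Arguments loc_max {R} p _.

Record valuation (Rr : realType) (K : fieldType) := Valuation {
  val_fun :> K -> \bar Rr;
  val_eqyP : forall x, val_fun x = +oo%E <-> x = 0;
  val_neqNy : forall x, val_fun x != -oo%E;
  valM : forall x y, val_fun (x * y) = (val_fun x + val_fun y)%E;
  valD : forall x y, (Order.min (val_fun x) (val_fun y) <= val_fun (x + y))%E
}.

Section ValuationRing.
Context (Rr : realType) (K : fieldType) (v : valuation Rr K).

Lemma val0 : v 0 = +oo%E. Proof. exact/val_eqyP. Qed.

Lemma val_fin x : x != 0 -> v x \is a fin_num.
Proof.
move=> x0; rewrite fin_numE val_neqNy /=.
by apply: contra x0 => /eqP /val_eqyP ->.
Qed.

Lemma val1 : v 1 = 0%E.
Proof.
have := valM v 1 1; rewrite mulr1.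
have /fineK <- := val_fin (oner_neq0 K).
by rewrite -EFinD => -[] /eqP; rewrite addrC -subr_eq subrr eq_sym => /eqP ->.
Qed.

Lemma valN1 : v (-1) = 0%E.
Proof.
have := valM v (-1) (-1); rewrite mulrNN mulr1 val1.
have /fineK <- : v (-1) \is a fin_num by rewrite val_fin// oppr_eq0 oner_eq0.
rewrite -EFinD => -[] /esym/eqP; rewrite -mulr2n mulrn_eq0 /= => /eqP ->.
by [].
Qed.

Lemma valN x : v (- x) = v x.
Proof. by rewrite -mulN1r valM valN1 add0e. Qed.

Definition vring_pred : {pred K} := [pred x | (0 <= v x)%E].

Fact vring_subring : subring_closed vring_pred.
Proof.
split=> [|x y|x y]; rewrite !inE /=.
- by rewrite val1.
- move=> vx vy; apply: le_trans (valD v x (- y)).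
  by rewrite le_min vx valN.
- by rewrite valM; exact: adde_ge0.
Qed.
HB.instance Definition _ := GRing.isSubringClosed.Build K vring_pred vring_subring.

Record vring := VRing { vring_val : K; _ : vring_val \in vring_pred }.
HB.instance Definition _ := [isSub for vring_val].
HB.instance Definition _ := [Choice of vring by <:].
HB.instance Definition _ := [SubChoice_isSubComNzRing of vring by <:].

Definition vring_max : {pred vring} := [pred x | (0 < v (val x))%E].

Fact vring_max_idealr : idealr_closed vring_max.
Proof.
split=> [||a x y]; rewrite !inE /=.
- by rewrite val0.
- by rewrite val1 ltxx.
- move=> vx vy; apply: lt_le_trans (valD v _ _).
  rewrite lt_min vy valM andbT.
  have va : (0 <= v (val a))%E := valP a.
  exact: lt_le_trans vx (leeDr _ va).
Qed.
HB.instance Definition _ := isIdealr.Build vring vring_max vring_max_idealr.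

Fact vring_local (x : vring) : x \notin vring_max -> exists y, y * x = 1.
Proof.
rewrite !inE /= -leNgt => x_le0.
have vx : v (val x) = 0%E by apply/le_anti; rewrite x_le0; exact: (valP x).
have x0 : val x != 0 by apply/eqP => x0; rewrite x0 val0 in vx.
have yP : (val x)^-1 \in vring_pred.
  by have := valM v (val x)^-1 (val x); rewrite mulVf// vx adde0 val1 inE /= => <-.
by exists (VRing yP); apply: val_inj; rewrite /= mulVf.
Qed.

Definition vresidue := {ideal_quot vring_max}.
HB.instance Definition _ := GRing.ComNzRing.on vresidue.
HB.instance Definition _ := GRing.ComNzRing_isField.Build vresidue
  (residue_invP vring_local).1 (residue_invP vring_local).2.

End ValuationRing.

Arguments vring_max {Rr K} v _.

(* Valuations of the field of fractions of [R] whose ring contains [R]. *)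
Record valuation_on (Rr : realType) (R : idomainType) := ValuationOn {
  val_of :> valuation Rr {fraction R};
  val_of_ge0 : forall f : R, (0 <= val_of f%:F)%E
}.

Section Center.
Context (Rr : realType) (R : idomainType) (v : valuation_on Rr R).

Definition center : {pred R} := [pred f | (0 < v f%:F)%E].

Fact center_idealr : idealr_closed center.
Proof.
split=> [||a x y]; rewrite !inE /=.
- by rewrite rmorph0 val0.
- by rewrite rmorph1 val1 ltxx.
- move=> vx vy; rewrite rmorphD rmorphM; apply: lt_le_trans (valD v _ _).
  rewrite lt_min vy valM andbT.
  exact: lt_le_trans vx (leeDr _ (val_of_ge0 v a)).
Qed.
HB.instance Definition _ := isIdealr.Build R center center_idealr.

Fact center_prime : prime_idealr_closed center.
Proof.
move=> a b; rewrite !inE /= rmorphM valM; apply: contraTT.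
rewrite negb_or -!leNgt => /andP[]; exact: adde_le0.
Qed.
HB.instance Definition _ := isPrimeIdealrClosed.Build R center center_prime.

Let loc_sub_vring (x : loc center) : val x \in vring_pred v.
Proof.
move: (valP x) => /asboolP[a [b [bp ->]]].
have vb : v b%:F = 0%E.
  by apply/le_anti; rewrite val_of_ge0 andbT leNgt.
have b0 : b%:F != 0 by apply/eqP => b0; rewrite b0 val0 in vb.
have := valM v (a%:F / b%:F) b%:F; rewrite divfK// vb adde0 inE /= => <-.
exact: val_of_ge0.
Qed.

Definition loc_to_vring (x : loc center) : vring v := VRing (loc_sub_vring x).

(* Independent of the chosen representative, see [residue_mapE]. *)
Definition residue_map (x : kappa center) : vresidue v :=
  \pi_(vresidue v) (loc_to_vring (repr x)).

Lemma residue_mapE (x : loc center) :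
  residue_map (\pi_(kappa center) x) = \pi_(vresidue v) (loc_to_vring x).
Proof.
apply/eqP; rewrite -Quotient.idealrBE.
have : repr (\pi_(kappa center) x) - x \in loc_max center.
  by rewrite Quotient.idealrBE reprK.
move=> /asboolP[a [b [ap bp /= e]]]; rewrite inE /= e.
have vb : v b%:F = 0%E.
  by apply/le_anti; rewrite val_of_ge0 andbT leNgt.
have b0 : b%:F != 0 by apply/eqP => b0; rewrite b0 val0 in vb.
by have := valM v (a%:F / b%:F) b%:F; rewrite divfK// vb adde0 => <-.
Qed.

Fact residue_map_zmod : zmod_morphism residue_map.
Proof.
move=> x y; rewrite -[x]reprK -[y]reprK -rmorphB !residue_mapE -rmorphB.
by congr (\pi _); apply: val_inj.
Qed.

Fact residue_map_monoid : monoid_morphism residue_map.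
Proof.
split=> [|x y].
  rewrite -(rmorph1 \pi_(kappa center)) residue_mapE -(rmorph1 \pi_(vresidue v)).
  by congr (\pi _); apply: val_inj.
rewrite -[x]reprK -[y]reprK -rmorphM !residue_mapE -rmorphM.
by congr (\pi _); apply: val_inj.
Qed.
HB.instance Definition _ := GRing.isZmodMorphism.Build
  (kappa center) (vresidue v) residue_map residue_map_zmod.
HB.instance Definition _ := GRing.isMonoidMorphism.Build
  (kappa center) (vresidue v) residue_map residue_map_monoid.

End Center.

Arguments residue_map {Rr R} v _.

Section Dimensions.
Context (Rr : realType).

Definition algebraically_independent (F E : fieldType) (f : {rmorphism F -> E})
    (n : nat) (x : 'I_n -> E) :=
  injective (mpoly.mmap f x : mpoly.mpoly n F -> E).

(* Largest size of an algebraically independent family; all infinite degrees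
   are [+oo]. *)
Definition trdeg (F E : fieldType) (f : {rmorphism F -> E}) : \bar Rr :=
  ereal_sup [set n%:R%:E | n in
    [set n | exists x : 'I_n -> E, algebraically_independent f x]].

Definition height (R : idomainType) (p : prime_idealr R) : \bar Rr :=
  ereal_sup [set n%:R%:E | n in
    [set n | exists c : nat -> prime_idealr R, c n =i p /\
      forall i, (i < n)%N ->
        {subset c i <= c i.+1} /\ ~ {subset c i.+1 <= c i}]].

Definition divisorial (R : idomainType) (v : valuation_on Rr R) :=
  trdeg (residue_map v) = (height (center v) - 1)%E.

Definition filtration (R : idomainType) (I : nat -> {pred R}) :=
  [/\ forall n, GRing.submod_closed (I n : {pred R^o}),
      forall f, f \in I 0%N,
      forall n m f g, f \in I n -> g \in I m -> f * g \in I (n + m)%N &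
      forall n, {subset I n.+1 <= I n}].

Definition val_ideal (R : idomainType) (v : valuation_on Rr R) (a : Rr)
    : {pred R} :=
  [pred f | (a%:E <= v f%:F)%E].

Definition R_divisorial (R : idomainType) (I : nat -> {pred R}) :=
  exists (s : nat) (v : 'I_s -> valuation_on Rr R) (lambda : 'I_s -> Rr),
    [/\ (0 < s)%N, forall i, divisorial (v i), forall i, 0 < lambda i &
        forall n f, f \in I n <-> forall i, f \in val_ideal (v i) (n%:R * lambda i)].

Definition generates (R : nzRingType) (M : lmodType R) (N : {pred M})
    (n : nat) (g : 'I_n -> M) :=
  forall x, x \in N <-> exists c : 'I_n -> R, x = \sum_i c i *: g i.

(* The value is [+oo] if the submodule [N] is not finitely generated. *)
Definition mu (R : nzRingType) (M : lmodType R) (N : {pred M}) : \bar Rr :=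
  ereal_inf [set n%:R%:E | n in [set n | exists g : 'I_n -> M, generates N g]].

(* The bound is only required for large [n], because [powR] gives [0] for
   [0 `^ a] when [a != 0]. *)
Definition mu_bigO (R : idomainType) (I : nat -> {pred R}) (t : Rr) :=
  exists C : Rr, \forall n \near \oo,
    (mu (I n : {pred R^o}) <= (C * n%:R `^ (t - 1))%:E)%E.

Definition divisorial_analytic_spread (R : idomainType) (I : nat -> {pred R})
    : \bar Rr :=
  ereal_inf [set t%:E | t in [set t | mu_bigO I t]].

End Dimensions.

(* Main.v *)
(* Write [R] as a localization of the image of a polynomial ring [P] over [k], and fix a divisorial
   valuation [v].  By the dimension formula the residue field of [v] has transcendence degree one
   less than the fraction field [K] of [R].  Hence [v] is a valuation of a function field of one
   variable, its ring is a localization of a finitely generated [R]-algebra [S], and there are [u]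
   and [h] in [S], with [v h = 0 < v u], such that [v f > 0] implies that [h f] lies in [u S].
   Filtering [S] by word length in its generators, Hilbert's basis theorem for the Rees algebra
   shows that one division by [u] raises the word length by at most a constant [c].  Iterating,
   for [f] in [R] and [m] minimal with [a <= m (v u)], one has [v f >= a] if and only if
   [h ^ m f] is in [u ^ m] times the words of length [c m].  After clearing denominators, [I_n] is
   therefore a colon ideal whose data have degree linear in [n].  Hermann's bound for syzygies,
   which for a fixed number of variables is polynomial in the degrees and independent of the
   number of columns, shows that [I_n] is generated by polynomials of degree polynomial in [n],
   and there are only polynomially many monomials of such a degree. *)
From HB Require Import structures.
From mathcomp Require Import all_boot all_order all_algebra.
From mathcomp Require Import generic_quotient ring_quotient fraction perm.
From mathcomp Require Import zify ring lra.
From mathcomp Require Import all_classical all_reals.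
From mathcomp Require Import ereal topology normedtype sequences exp.
From mathcomp Require mpoly.
Require Import Defs.

Set Implicit Arguments.
Unset Strict Implicit.
Unset Printing Implicit Defensive.

Import Order.TTheory GRing.Theory Num.Theory.

Local Open Scope ring_scope.
Local Open Scope quotient_scope.

(** * Iterated polynomial rings *)

(** The graded ring of the $I_n$ need not be finitely generated: for the order at the origin of
    $k[x]$ and an irrational weight $\lambda$, $I_n$ is generated by $x^{\lceil n\lambda\rceil}$.
    Finite generation is therefore sought for one valuation ring at a time, and $I_n$ is reached by
    degree estimates whose constants do not depend on $n$. Divisoriality relates a residue degree to
    a height; the height is bounded below by a chain of primes under the center, each step of which
    costs one algebraically independent element. The field [k] is arbitrary. Since it may be finite,
    variables are changed by Nagata's substitution and not by a linear one; since extensions may be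
    inseparable, finiteness of the integral closure comes from degrees at infinity and not from a
    trace. Transcendence degrees and degrees of field extensions are both controlled by counting
    monomials. *)

(* [iterpoly A n] is the iterated polynomial ring [A[X_0]...[X_(n-1)]], with outermost variable [X_(n-1)]. *)
Fixpoint iterpoly (A : idomainType) n : idomainType :=
  if n is m.+1 then {poly (iterpoly A m)} : idomainType else A.

Fixpoint iterpolyC (A : idomainType) n : {rmorphism A -> iterpoly A n} :=
  if n is m.+1 then (polyC \o iterpolyC A m : {rmorphism A -> iterpoly A m.+1})
  else (idfun : {rmorphism A -> iterpoly A 0}).

(** Variables are numbered by naturals, so that their numbers do not change when [n] grows; an index
    [i >= n] gives the junk value 0. *)
Fixpoint iterpolyX (A : idomainType) n i : iterpoly A n :=
  if n is m.+1 then (if i == m then 'X else (iterpolyX A m i)%:P : {poly iterpoly A m}) else 0.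

Section Eval.
Context (A : idomainType) (B : comNzRingType).

Lemma horner_comm (C D : comNzRingType) (f : C -> D) (u : D) : commr_rmorph f u.
Proof. by move=> x; apply: mulrC. Qed.

Fixpoint ev (f : {rmorphism A -> B}) (x : nat -> B) n : {rmorphism iterpoly A n -> B} :=
  if n is m.+1 then
    (horner_morph (horner_comm (ev f x m) (x m)) : {rmorphism iterpoly A m.+1 -> B})
  else (f : {rmorphism iterpoly A 0 -> B}).

Context (f : {rmorphism A -> B}) (x : nat -> B).

Lemma evC n a : ev f x n (iterpolyC A n a) = f a.
Proof. by elim: n => //= n IH; rewrite horner_morphC. Qed.

Lemma ev_polyC n (p : iterpoly A n) : ev f x n.+1 (p%:P : {poly iterpoly A n}) = ev f x n p.
Proof. exact: horner_morphC. Qed.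

Lemma ev_polyX n : ev f x n.+1 ('X : {poly iterpoly A n}) = x n.
Proof. exact: horner_morphX. Qed.

Lemma evX n i : (i < n)%N -> ev f x n (iterpolyX A n i) = x i.
Proof.
elim: n => // n IH; rewrite ltnS leq_eqVlt [iterpolyX _ _ _]/=.
by case: eqP => [->|_ /= /IH <-]; [rewrite ev_polyX | rewrite ev_polyC].
Qed.

Lemma evS n (p : iterpoly A n.+1) d : (size (p : {poly iterpoly A n}) <= d)%N ->
  ev f x n.+1 p = \sum_(i < d) ev f x n (p : {poly iterpoly A n})`_i * x n ^+ i.
Proof.
move=> sp; rewrite /= /horner_morph (@horner_coef_wide _ d); last first.
  by rewrite (leq_trans _ sp)// size_poly.
by apply: eq_bigr => i _; rewrite coef_map.
Qed.

End Eval.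

Section EvalTheory.
Context (A : idomainType).

Lemma poly_sumE (D : comNzRingType) (p : {poly D}) d : (size p <= d)%N ->
  p = \sum_(i < d) (p`_i)%:P * 'X^i.
Proof.
move=> sp; transitivity (\poly_(i < d) p`_i).
  by apply/polyP => i; rewrite coef_poly; case: ltnP => // ?; rewrite nth_default ?(leq_trans sp).
by rewrite poly_def; apply: eq_bigr => i _; rewrite mul_polyC.
Qed.

Lemma ip_ind_morph (B : comNzRingType) n (g h : {rmorphism iterpoly A n -> B}) :
  (forall a, g (iterpolyC A n a) = h (iterpolyC A n a)) ->
  (forall i, (i < n)%N -> g (iterpolyX A n i) = h (iterpolyX A n i)) -> g =1 h.
Proof.
elim: n g h => [|n IH] g h gC gX; first exact: gC.
have gP (q : iterpoly A n) : g (q%:P : {poly iterpoly A n}) = h (q%:P : {poly iterpoly A n}).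
  pose g' := (g \o @polyC (iterpoly A n) : {rmorphism _ -> _}).
  pose h' := (h \o @polyC (iterpoly A n) : {rmorphism _ -> _}).
  apply: (IH g' h') => [a|i lt_in]; rewrite /g' /h' /=; first exact: gC.
  by have := gX i (ltnW lt_in); rewrite /= (ltn_eqF lt_in).
move=> p; rewrite (poly_sumE (leqnn (size (p : {poly iterpoly A n})))) !rmorph_sum.
apply: eq_bigr => i _; rewrite !rmorphM !rmorphXn gP; congr (_ * _ ^+ _).
by have := gX n (leqnn _); rewrite /= eqxx.
Qed.

Lemma ev_comp (B C : comNzRingType) (f : {rmorphism A -> B}) x n
    (g : {rmorphism B -> C}) (h : {rmorphism A -> C}) (y : nat -> C) p :
  (forall a, g (f a) = h a) -> (forall i, (i < n)%N -> g (x i) = y i) ->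
  g (ev f x n p) = ev h y n p.
Proof.
move=> fh xy; pose l := (g \o ev f x n : {rmorphism _ -> _}).
apply: (@ip_ind_morph _ n l (ev h y n) _ _ p) => [a|i lt_in].
  by rewrite /l /= !evC.
by rewrite /l /= !evX// xy.
Qed.

Lemma eq_ev (B : comNzRingType) (f : {rmorphism A -> B}) x y n p :
  (forall i, (i < n)%N -> x i = y i) -> ev f x n p = ev f y n p.
Proof.
by move=> xy; apply: (@ev_comp _ _ f x n idfun f y) => //= i /xy.
Qed.

Lemma ev_id n p : ev (iterpolyC A n) (iterpolyX A n) n p = p.
Proof.
apply: (@ip_ind_morph _ n (ev _ _ n) idfun) => [a|i lt_in] /=.
  exact: evC.
exact: evX.
Qed.

End EvalTheory.

(* Algebraic independence of [x 0, ..., x (n-1)] modulo the set [q]. *)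
Definition indep (A : idomainType) (B : comNzRingType) (f : {rmorphism A -> B})
  (q : B -> Prop) (x : nat -> B) n := forall p, q (ev f x n p) -> p = 0.

Lemma indep_le A B f q x n m : (m <= n)%N -> @indep A B f q x n -> indep f q x m.
Proof.
elim: n => [|n IH]; first by rewrite leqn0 => /eqP->.
rewrite leq_eqVlt => /orP[/eqP->//|le_mn H]; apply: (IH le_mn) => p qp.
by apply/eqP; rewrite -polyC_eq0; apply/eqP/H; rewrite ev_polyC.
Qed.

(* [dle D p]: the degree of [p] in each variable separately is at most [D]. *)
Fixpoint dle (A : idomainType) n D : iterpoly A n -> Prop :=
  if n is m.+1 then fun p : {poly iterpoly A m} =>
    (size p <= D.+1)%N /\ forall i, dle D p`_i
  else fun _ => True.

Section BoxDegree.
Context (A : idomainType).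

Lemma dle0 n D : @dle A n D 0.
Proof. by elim: n => //= n IH; split=> [|i]; rewrite ?size_poly0 ?coef0. Qed.

Lemma dle_le n D E p : (D <= E)%N -> @dle A n D p -> dle E p.
Proof.
move=> le; elim: n p => //= n IH p [sp cp]; split; first exact: leq_trans sp _.
by move=> i; apply/IH/cp.
Qed.

Lemma dleD n D p q : @dle A n D p -> dle D q -> dle D (p + q).
Proof.
elim: n p q => //= n IH p q [sp cp] [sq cq]; split=> [|i].
  by rewrite (leq_trans (size_polyD _ _))// geq_max sp.
by rewrite coefD; apply: IH.
Qed.

Lemma dleN n D p : @dle A n D p -> dle D (- p).
Proof.
elim: n p => //= n IH p [sp cp]; split=> [|i]; first by rewrite size_polyN.
by rewrite coefN; apply: IH.
Qed.

Lemma dle_sum n D (I : Type) (r : seq I) (P : pred I) F :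
  (forall i, P i -> @dle A n D (F i)) -> dle D (\sum_(i <- r | P i) F i).
Proof. by move=> H; apply: big_ind => //; [apply: dle0 | apply: dleD]. Qed.

Lemma dleM n D E p q : @dle A n D p -> dle E q -> dle (D + E) (p * q).
Proof.
elim: n p q => //= n IH p q [sp cp] [sq cq]; split=> [|i].
  rewrite (leq_trans (size_polyMleq _ _))//.
  by rewrite -subn1 leq_subLR add1n -addnS -addSn (leq_trans (leq_add sp sq)) // addnS.
by rewrite coefM; apply: dle_sum => j _; apply: IH.
Qed.

Lemma dleC n D a : dle D (iterpolyC A n a).
Proof.
elim: n => //= n IH; split=> [|i].
  by rewrite (leq_trans (size_polyC_leq1 _)).
by rewrite coefC; case: ifP => // _; apply: dle0.
Qed.

Lemma dle_polyC n D (p : iterpoly A n) : dle D p -> @dle A n.+1 D (p%:P : {poly iterpoly A n}).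
Proof.
move=> dp /=; split=> [|i]; first by rewrite (leq_trans (size_polyC_leq1 _)).
by rewrite coefC; case: ifP => // _; apply: dle0.
Qed.

Lemma dle1 n D : @dle A n D 1.
Proof. by rewrite -(rmorph1 (iterpolyC A n)); apply: dleC. Qed.

Lemma dle_polyXn n D i : (i <= D)%N -> @dle A n.+1 D ('X^i : {poly iterpoly A n}).
Proof.
move=> le /=; split=> [|j]; first by rewrite size_polyXn.
by rewrite coefXn; case: (_ == _); [apply: dle1|apply: dle0].
Qed.

Lemma dleX n i : dle 1 (iterpolyX A n i).
Proof.
elim: n => //= n IH; split=> [|j].
  by case: eqP => _; rewrite ?size_polyX// (leq_trans (size_polyC_leq1 _)).
case: eqP => _; first by rewrite coefX; case: (_ == _); [apply: dle1|apply: dle0].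
by rewrite coefC; case: ifP => // _; apply: dle0.
Qed.

Lemma dle_prod n D (I : Type) (r : seq I) (P : pred I) F :
  (forall i, P i -> @dle A n D (F i)) -> dle (size r * D) (\prod_(i <- r | P i) F i).
Proof.
move=> H; elim: r => [|i r IH]; first by rewrite big_nil; apply: dle1.
rewrite big_cons mulSn; case: ifP => Pi; first exact: dleM (H _ Pi) IH.
by apply: dle_le IH; apply: leq_addl.
Qed.

Lemma dle_exp n D p i : @dle A n D p -> dle (i * D) (p ^+ i).
Proof.
move=> dp; elim: i => [|i IH]; first exact: dle1.
by rewrite exprS mulSn; apply: dleM.
Qed.

Lemma dle_exists n p : exists D, @dle A n D p.
Proof.
elim: n p => [|n IH] p; first by exists 0%N.
have [d Hd] := choice (fun i => IH (p : {poly iterpoly A n})`_i).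
pose D := (size (p : {poly iterpoly A n}) + \sum_(i < size (p : {poly iterpoly A n})) d i)%N.
exists D; split=> [|i]; first by rewrite ltnW// ltnS leq_addr.
case: (ltnP i (size (p : {poly iterpoly A n}))) => [lt|ge]; last first.
  by rewrite nth_default//; apply: dle0.
apply: dle_le (Hd i).
by rewrite /D (bigD1 (Ordinal lt)) //= addnCA leq_addr.
Qed.

Lemma dle_exists_fin n (I : finType) (F : I -> iterpoly A n) : exists D, forall i, dle D (F i).
Proof.
have [d Hd] := choice (fun i => dle_exists (F i)).
by exists (\max_i d i)%N => i; apply: dle_le (Hd i); apply: leq_bigmax.
Qed.

Lemma dle_exists_seq n (s : seq (iterpoly A n)) : exists D, forall p, p \in s -> dle D p.
Proof.
have [D HD] := dle_exists_fin (fun i : 'I_(size s) => s`_i).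
exists D => p ps; have lt : (index p s < size s)%N by rewrite index_mem.
by have := HD (Ordinal lt); rewrite /= nth_index.
Qed.

Lemma dle_ev n m D E (f : {rmorphism A -> iterpoly A m}) x p :
  (forall a, dle 0 (f a)) -> (forall i, (i < n)%N -> dle E (x i)) -> dle D p ->
  dle (n * (D * E)) (ev f x n p).
Proof.
move=> f0 xE; elim: n p xE => [|n IH] p xE; first by move=> _; apply: dle_le (f0 _).
move=> [sp cp]; rewrite (evS f x sp); apply: dle_sum => i _.
rewrite mulSn addnC; apply: dleM.
  by apply: IH (cp i) => j /ltnW; apply: xE.
apply: dle_le (dle_exp _ (xE n (leqnn _))).
by rewrite leq_mul2r -ltnS ltn_ord orbT.
Qed.

End BoxDegree.

(** * The Nagata automorphism *)

Section Nagata.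
Context (k : fieldType) (n e : nat).
Hypothesis e_gt0 : (0 < e)%N.

(** Up to the constant [c] this is monicity in the last variable, which makes Euclidean division by
    [p] possible over [iterpoly k n]. *)
Definition lead_const (p : {poly iterpoly k n}) :=
  exists c : k, c != 0 /\ lead_coef p = iterpolyC k n c.

Let xs i : {poly iterpoly k n} := (iterpolyX k n i)%:P + 'X^(e ^ i.+1).
Let f0 : {rmorphism k -> {poly iterpoly k n}} := (polyC \o iterpolyC k n : {rmorphism _ -> _}).

Lemma xs_monic i : xs i \is monic /\ size (xs i) = (e ^ i.+1).+1.
Proof.
have sz : (size (iterpolyX k n i)%:P < size ('X^(e ^ i.+1) : {poly iterpoly k n}))%N.
  by rewrite size_polyXn ltnS (leq_trans (size_polyC_leq1 _))// expn_gt0 e_gt0.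
split; last by rewrite /xs addrC size_polyDl// size_polyXn.
by rewrite monicE /xs lead_coefDr// lead_coefXn.
Qed.

Lemma xs_exp i j : xs i ^+ j \is monic /\ size (xs i ^+ j) = (j * e ^ i.+1).+1.
Proof.
have [xm sx] := xs_monic i; have xjm : xs i ^+ j \is monic by apply: monic_exp.
split=> //; have := size_exp (xs i) j; rewrite sx /= mulnC => <-.
by rewrite prednK// size_poly_gt0 monic_neq0.
Qed.

(** Exponents below [e] act as digits in base [e]: they can be read off from the [T]-degree of the
    image of a monomial, so the top degrees of distinct monomials do not cancel. The lowest digit is
    0, since variable [i] is sent to degree [e ^ i.+1]; it is reserved for the exponent of [T]
    itself. *)
Lemma nagata_core m Q : Q != 0 -> @dle k m e.-1 Q ->
  lead_const (ev f0 xs m Q) /\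
  exists a, size (ev f0 xs m Q) = (a * e).+1 /\ (a * e < e ^ m.+1)%N.
Proof.
elim: m Q => [|m IH] Q Q0 dQ.
  have -> : ev f0 xs 0 Q = (iterpolyC k n Q)%:P by [].
  split; first by exists Q; rewrite lead_coefC.
  by exists 0%N; rewrite size_polyC fmorph_eq0 Q0 mul0n expn_gt0 e_gt0.
have [sQ cQ] := dQ; rewrite prednK// in sQ.
have sQ0 : (0 < size (Q : {poly iterpoly k m}))%N by rewrite size_poly_gt0.
case sE : (size (Q : {poly iterpoly k m})) sQ0 => [//|s] _.
rewrite sE in sQ.
rewrite (evS f0 xs (eq_leq sE)) big_ord_recr /=.
set L := (X in _ + X); set r := (X in X + _).
have Qs0 : (Q : {poly iterpoly k m})`_s != 0.
  by have := Q0; rewrite -lead_coef_eq0 lead_coefE sE.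
have [[c [c0 lc]] [a [sa ale]]] := IH _ Qs0 (cQ s).
have sL : size L = (a * e + s * e ^ m.+1).+1.
  have [xm sx] := xs_exp m s.
  by rewrite /L size_Mmonic -?size_poly_gt0 ?sa// sx addnS.
have lL : lead_coef L = iterpolyC k n c.
  by rewrite /L lead_coef_Mmonic ?(xs_exp m s).1.
have sr : (size r < size L)%N.
  rewrite sL ltnS; apply: (leq_trans (size_sum _ _ _)); apply/bigmax_leqP => i _.
  have [->|q0] := eqVneq (Q : {poly iterpoly k m})`_i 0.
    by rewrite rmorph0 mul0r size_poly0.
  have [_ [a' [sa' ale']]] := IH _ q0 (cQ i).
  have [xm sx] := xs_exp m i.
  rewrite size_Mmonic -?size_poly_gt0 ?sa'// sx addnS /=.
  have : (i * e ^ m.+1 + e ^ m.+1 <= s * e ^ m.+1)%N by rewrite addnC -mulSn leq_mul2r ltn_ord orbT.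
  lia.
split; first by exists c; rewrite lead_coefDr.
exists (a + s * e ^ m)%N; rewrite addrC size_polyDl// sL; split.
  by rewrite mulnDl expnS; congr (_ + _).+1; rewrite mulnCA mulnC mulnAC -mulnA; lia.
rewrite mulnDl -mulnA -expnSr.
have : (s * e ^ m.+1 + e ^ m.+1 <= e ^ m.+2)%N.
  by rewrite addnC -mulSn (expnS e m.+1) leq_mul2r sQ orbT.
lia.
Qed.

End Nagata.

Section NagataAut.
Context (k : fieldType) (n e : nat).

(* The automorphism [X_i |-> X_i + (-1)^b T^(e^(i+1))] for [i < n], where [T = X_n] is fixed.
   Its powers of [e] make the [T]-degrees of the images of distinct monomials distinct. *)
Definition nagx (b : bool) i : iterpoly k n.+1 :=
  if i == n then 'X : {poly iterpoly k n}
  else (iterpolyX k n i)%:P + (-1) ^+ b * 'X^(e ^ i.+1) : {poly iterpoly k n}.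

Definition nagata (b : bool) : {rmorphism iterpoly k n.+1 -> iterpoly k n.+1} :=
  ev (iterpolyC k n.+1) (nagx b) n.+1.

Lemma nagataK b p : nagata (~~ b) (nagata b p) = p.
Proof.
rewrite -[RHS]ev_id; apply: ev_comp => [a|i lt_in]; first exact: evC.
have evT : nagata (~~ b) ('X : {poly iterpoly k n}) = ('X : {poly iterpoly k n}).
  by rewrite /nagata ev_polyX /nagx eqxx.
rewrite /nagx /=; have [_|neq] := eqVneq i n; first exact: evT.
have lt : (i < n)%N by rewrite ltn_neqAle neq.
rewrite rmorphD rmorphM !rmorphXn rmorphN1 evT.
have -> : nagata (~~ b) ((iterpolyX k n i)%:P : {poly iterpoly k n}) = nagx (~~ b) i.
  by rewrite /nagata ev_polyC evX.
by rewrite /nagx (negPf neq) -addrA -mulrDl; case: b {evT}; rewrite /= ?expr0 ?expr1 ?subrr ?addNr mul0r addr0.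
Qed.

Lemma dle_nagata b D (p : iterpoly k n.+1) : dle D p ->
  dle (n.+1 * (D * (e ^ n + 1))) (nagata b p).
Proof.
apply: dle_ev => [a|i]; first exact: dleC.
rewrite ltnS leq_eqVlt /nagx => /orP[/eqP->|lt].
  by rewrite eqxx -['X]expr1; apply: dle_polyXn; rewrite addn1.
rewrite (ltn_eqF lt); apply: dleD.
  by apply: (dle_le _ (dle_polyC (dleX _ _ _))); rewrite addn1.
have -> : (e ^ n + 1 = 0 + (e ^ n + 1))%N by [].
apply: dleM; last first.
  apply: dle_polyXn; case: e => [|e']; first by rewrite exp0n.
  by rewrite (leq_trans (leq_pexp2l _ lt))// leq_addr.
case: b; rewrite ?expr0 ?expr1; last exact: dle1.
by apply: dleN; apply: dle1.
Qed.

(** The coefficient of [T^i] contributes a degree congruent to [i] modulo [e]. The nonzero summands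
    with [i < e] thus have distinct degrees, and the largest one supplies the leading
    coefficient. *)
Lemma nagata_lead (p : iterpoly k n.+1) : (0 < e)%N -> p != 0 -> dle e.-1 p ->
  lead_const (nagata false p).
Proof.
move=> e_gt0 p0 [sp cp]; rewrite prednK// in sp.
pose f0 : {rmorphism k -> {poly iterpoly k n}} := (polyC \o iterpolyC k n : {rmorphism _ -> _}).
pose xs i : {poly iterpoly k n} := (iterpolyX k n i)%:P + 'X^(e ^ i.+1).
have E : nagata false p = \sum_(i < e) ev f0 xs n (p : {poly iterpoly k n})`_i * 'X^i.
  rewrite /nagata (evS _ _ sp); apply: eq_bigr => i _.
  congr (_ * _); last by rewrite /nagx eqxx.
  transitivity (ev f0 (nagx false) n (p : {poly iterpoly k n})`_i); first exact: (ev_comp (g := idfun)).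
  by apply: eq_ev => j lt; rewrite /nagx (ltn_eqF lt) expr0 mul1r.
pose F (i : 'I_e) := ev f0 xs n (p : {poly iterpoly k n})`_i * 'X^i.
have F0 (i : 'I_e) : (p : {poly iterpoly k n})`_i = 0 -> F i = 0.
  by rewrite /F => ->; rewrite rmorph0 mul0r.
have F1 (i : 'I_e) : (p : {poly iterpoly k n})`_i != 0 -> lead_const (F i) /\
    exists a, size (F i) = (a * e + i).+1.
  move=> q0; have [[c [c0 lc]] [a [sa _]]] := nagata_core n e_gt0 q0 (cp i).
  split; first by exists c; rewrite /F lead_coef_Mmonic ?monicXn.
  exists a; rewrite /F size_Mmonic ?monicXn// -?size_poly_gt0 ?sa//.
  by rewrite size_polyXn addnS /= .
have [i0 i0P] : exists i : 'I_e, (p : {poly iterpoly k n})`_i != 0.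
  apply: contrapT => /forallNP H; case/eqP: p0; apply/polyP => i.
  rewrite coef0; case: (ltnP i e) => [lt|ge]; last by rewrite nth_default// (leq_trans sp).
  by apply/eqP; apply/negP => /negP; apply: (H (Ordinal lt)).
pose j := [arg max_(i > i0 | (p : {poly iterpoly k n})`_i != 0) size (F i)].
have [jP jmax] : (p : {poly iterpoly k n})`_j != 0 /\
    forall i : 'I_e, (p : {poly iterpoly k n})`_i != 0 -> (size (F i) <= size (F j))%N.
  by rewrite /j; case: arg_maxnP.
have [[c [c0 lc]] [a sa]] := F1 _ jP.
have lt i : i != j -> (size (F i) < size (F j))%N.
  move=> ij; have [q0|q0] := eqVneq (p : {poly iterpoly k n})`_i 0.
    by rewrite F0// size_poly0 sa.
  rewrite ltn_neqAle jmax// andbT; apply: contraNneq ij.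
  have [_ [a' ->]] := F1 _ q0; rewrite sa => -[] /(congr1 (modn^~ e)).
  by rewrite !modnMDl !modn_small// => ji; apply/eqP/val_inj.
exists c; split=> //; rewrite E (bigD1 j) //= lead_coefDl//.
rewrite (leq_ltn_trans (size_sum _ _ _))//.
have : (0 < size (F j))%N by rewrite sa.
move: (size (F j)) lt => N lt N0.
by rewrite -(prednK N0) ltnS; apply/bigmax_leqP => i ij; rewrite -ltnS prednK// lt.
Qed.

End NagataAut.

(** * Effective syzygies *)

(** Inductive rather than by finite sums, so that generating sets may be infinite and no indexing
    has to be carried along. *)
Inductive lspan (A : nzRingType) (V : lmodType A) (X : V -> Prop) : V -> Prop :=
| lspan0 : lspan X 0
| lspanS c x y of X x & lspan X y : lspan X (c *: x + y).

Section Lspan.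
Context (A : nzRingType) (V : lmodType A).
Implicit Types (X Y : V -> Prop).

Lemma lspan_in X x : X x -> lspan X x.
Proof. by move=> Xx; have := lspanS 1 Xx (lspan0 X); rewrite scale1r addr0. Qed.

Lemma lspanD X x y : lspan X x -> lspan X y -> lspan X (x + y).
Proof.
by elim=> [|c u w Xu _ IH] Ly; rewrite ?add0r// -addrA; apply: lspanS (IH Ly).
Qed.

Lemma lspanZ X c x : lspan X x -> lspan X (c *: x).
Proof.
elim=> [|d u w Xu _ IH]; first by rewrite scaler0; apply: lspan0.
by rewrite scalerDr scalerA; apply: lspanS.
Qed.

Lemma lspanN X x : lspan X x -> lspan X (- x).
Proof. by move=> ?; rewrite -scaleN1r; apply: lspanZ. Qed.

Lemma lspan_sum X (I : Type) (r : seq I) (P : pred I) F :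
  (forall i, P i -> lspan X (F i)) -> lspan X (\sum_(i <- r | P i) F i).
Proof. by move=> H; apply: big_ind => //; [apply: lspan0 | apply: lspanD]. Qed.

Lemma lspan_min X Y : Y 0 -> (forall c x y, X x -> Y y -> Y (c *: x + y)) ->
  forall x, lspan X x -> Y x.
Proof. by move=> Y0 YS x; elim=> // c u w Xu _ Yw; apply: YS. Qed.

Lemma lspan_trans X Y x : (forall x, X x -> lspan Y x) -> lspan X x -> lspan Y x.
Proof.
move=> XY; apply: lspan_min => [|c u w /XY Lu Lw]; first exact: lspan0.
by apply/lspanD/Lw/lspanZ.
Qed.

Lemma lspanP X x : lspan X x ->
  exists r (c : 'I_r -> A) (g : 'I_r -> V),
    (forall i, X (g i)) /\ x = \sum_i c i *: g i.
Proof.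
elim=> [|c u w Xu _ [r [d [g [Xg ->]]]]].
  by exists 0%N, (fun _ => 0), (fun _ => 0); split; [case | rewrite big_ord0].
exists r.+1, (fun i => if unlift ord0 i is Some j then d j else c),
  (fun i => if unlift ord0 i is Some j then g j else u); split.
  by move=> i; case: (unlift _ _).
by rewrite big_ord_recl unlift_none; congr (_ + _); apply: eq_bigr => i _; rewrite liftK.
Qed.

End Lspan.

(** Semilinearity along [f] is needed because syzygies are transported both from [n] to [n.+1]
    variables and along the Nagata automorphism. *)
Lemma lspan_map (A B : nzRingType) (V : lmodType A) (W : lmodType B)
  (f : {rmorphism A -> B}) (L : {additive V -> W}) X Y x :
  (forall c x, L (c *: x) = f c *: L x) -> (forall x, X x -> Y (L x)) ->
  lspan X x -> lspan Y (L x).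
Proof.
move=> LZ XY; elim=> [|c u w Xu _ IH]; first by rewrite raddf0; apply: lspan0.
by rewrite raddfD /= LZ; apply: lspanS => //; apply: XY.
Qed.

(** The rows [f] form a basis of the row space over the fraction field, so the remaining rows vanish
    wherever these do. The bound on [p] is by the number of rows, since nothing is to depend on the
    number of columns. *)
Lemma rank_minor (A : idomainType) s r (M : 'M[A]_(s, r)) :
  exists p (f : 'I_p -> 'I_s) (g : 'I_p -> 'I_r),
  [/\ (p <= s)%N, \det (mxsub f g M) != 0 &
      forall q (y : 'M_(r, q)), rowsub f M *m y = 0 -> M *m y = 0].
Proof.
pose tf := @FracField.tofrac A; pose MF := map_mx tf M.
pose f := maxrankfun MF; pose M1 := rowsub f MF.
have fullM1 : row_full M1^T by rewrite /row_full mxrank_tr; exact: (maxrowsub_free MF).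
pose g := fullrankfun fullM1.
exists (\rank MF), f, g; split; first exact: rank_leq_row.
  suff : \det (map_mx tf (mxsub f g M)) != 0 by rewrite det_map_mx tofrac_eq0.
  have -> : map_mx tf (mxsub f g M) = (rowsub g M1^T)^T.
    by apply/matrixP => i j; rewrite !mxE.
  by rewrite det_tr -unitfE -unitmxE fullrowsub_unit.
move=> q y Hy.
have H1 : M1 *m map_mx tf y = 0.
  have -> : M1 = map_mx tf (rowsub f M) by apply/matrixP => i j; rewrite !mxE.
  by rewrite -map_mxM Hy map_mx0.
have /submxP[Z ZE] : (MF <= M1)%MS by rewrite /M1 eq_maxrowsub.
have : map_mx tf (M *m y) = 0 by rewrite map_mxM -/MF ZE -mulmxA H1 mulmx0.
move=> /matrixP H; apply/matrixP => i j; have /eqP := H i j.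
by rewrite [X in X == _]mxE [X in _ == X]mxE tofrac_eq0 => /eqP ->; rewrite mxE.
Qed.

Lemma dle_det (A : idomainType) n m D (M : 'M[iterpoly A n]_m) :
  (forall i j, dle D (M i j)) -> dle (m * D) (\det M).
Proof.
move=> HM; apply: dle_sum => s _; rewrite -[(m * D)%N]add0n; apply: dleM.
  by case: (odd_perm s); rewrite ?expr1 ?expr0; [apply/dleN/dle1|apply: dle1].
have := @dle_prod A n D 'I_m (index_enum _) xpredT (fun i => M i (s i)) (fun i _ => HM i (s i)).
rewrite -(card_uniqP (index_enum_uniq _)) (@eq_card _ _ 'I_m) ?card_ord// => i.
exact: mem_index_enum.
Qed.

Lemma dle_adj (A : idomainType) n m D (M : 'M[iterpoly A n]_m) i j :
  (forall i j, dle D (M i j)) -> dle (m * D) ((\adj M) i j).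
Proof.
move=> HM; rewrite mxE /cofactor -[(m * D)%N]add0n; apply: dleM.
  by rewrite -signr_odd; case: (odd _); rewrite ?expr1 ?expr0; [apply/dleN/dle1|apply: dle1].
apply: (@dle_le _ _ (m.-1 * D)); first by rewrite leq_mul2r leq_pred orbT.
by apply: dle_det => i' j'; rewrite !mxE.
Qed.

Lemma dle_mulmx (A : idomainType) n D E p q r (M : 'M[iterpoly A n]_(p, q)) (N : 'M_(q, r)) :
  (forall i j, dle D (M i j)) -> (forall i j, dle E (N i j)) ->
  forall i j, dle (D + E) ((M *m N) i j).
Proof. by move=> HM HN i j; rewrite mxE; apply: dle_sum => l _; apply: dleM. Qed.

Definition syz (A : idomainType) n s r (M : 'M[iterpoly A n]_(s, r)) D (z : 'cV_r) :=
  M *m z = 0 /\ forall j, dle D (z j 0).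

(** A single [a] bounds the degrees and the number of rows, while [r] is unrestricted; [2 <= a] lets
    constants and sums be absorbed into powers of [a]. *)
Definition hermann_bound (k : fieldType) n E :=
  forall a s r (M : 'M[iterpoly k n]_(s, r)) y, (2 <= a)%N -> (s <= a)%N ->
    (forall i j, dle a (M i j)) -> M *m y = 0 -> lspan (syz M (a ^ E)) y.

Lemma size_mulmx (A : idomainType) p q r d e (M : 'M[{poly A}]_(p, q)) (N : 'M[{poly A}]_(q, r)) :
  (forall i j, size (M i j) <= d.+1)%N -> (forall i j, size (N i j) <= e)%N ->
  forall i j, (size ((M *m N) i j) <= d + e)%N.
Proof.
move=> HM HN i j; rewrite mxE (leq_trans (size_sum _ _ _))//; apply/bigmax_leqP => l _.
rewrite (leq_trans (size_polyMleq _ _))//.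
by rewrite -subn1 leq_subLR add1n -addSn leq_add.
Qed.

Lemma lead_const_div (k : fieldType) n (d p : {poly iterpoly k n}) : lead_const d ->
  exists q r, p = d * q + r /\ (size r < size d)%N.
Proof.
move=> [c [c0 lc]]; have u : lead_coef d \is a GRing.unit.
  by rewrite lc rmorph_unit// unitfE.
exists (p %/ d), (p %% d); rewrite mulrC -(Pdiv.IdomainUnit.divp_eq u).
by rewrite ltn_modp -lead_coef_eq0 lc fmorph_eq0.
Qed.

(** Expanding in powers of the last variable turns a syzygy of size at most [d] in it into a syzygy
    in one variable fewer, of a matrix with [s * (d + a) <= d ^ 3] rows. The number of columns is
    multiplied by [d], which is harmless. *)
Lemma hermann_expand (k : fieldType) n E a d s r (M : 'M[iterpoly k n.+1]_(s, r)) (y : 'cV_r) :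
  hermann_bound k n E -> (2 <= a)%N -> (a <= d)%N -> (s <= a)%N ->
  (forall i j, dle a (M i j)) -> M *m y = 0 ->
  (forall j, size (y j 0%R : {poly iterpoly k n}) <= d)%N ->
  lspan (syz M (d + (d ^ 3) ^ E)) y.
Proof.
move=> IH a2 ad sa dM My sy.
pose I := ('I_s * 'I_(d + a))%type; pose J := ('I_r * 'I_d)%type.
(* Row [(i, t)] is the coefficient of degree [t] in equation [i], column [(j, l)] the coefficient of
   degree [l] in unknown [j]; subtraction being truncated, [l <= t] is tested. *)
pose m0 (i : I) (j : J) : iterpoly k n :=
  if (j.2 <= i.2)%N then (M i.1 j.1 : {poly iterpoly k n})`_(i.2 - j.2) else 0.
pose M' : 'M[iterpoly k n]_(#|{: I}|, #|{: J}|) := \matrix_(i, j) m0 (enum_val i) (enum_val j).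
pose L (z : 'cV[iterpoly k n]_(#|{: J}|)) : 'cV[iterpoly k n.+1]_r :=
  \col_j \sum_(l < d) (z (enum_rank (j, l)) 0)%:P * 'X^l.
have Ladd : additive L.
  move=> u v; apply/matrixP => i j; rewrite !mxE -sumrB; apply: eq_bigr => l _.
  by rewrite !mxE -mulrBl -polyCB.
pose LL := GRing.isZmodMorphism.Build _ _ L Ladd.
pose La : {additive 'cV[iterpoly k n]_(#|{: J}|) -> 'cV[iterpoly k n.+1]_r} := HB.pack L LL.
have coefL z j l : ((L z j 0 : {poly iterpoly k n})`_l) =
   if insub l is Some l' then z (enum_rank (j, l' : 'I_d)) 0 else 0.
  rewrite mxE coef_sum; case: insubP => [l' _ <-|].
    rewrite (bigD1 l') //= coefCM coefXn eqxx mulr1 big1 ?addr0// => l2 ne.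
    by rewrite coefCM coefXn eq_sym (inj_eq val_inj) (negPf ne) mulr0.
  move=> ge; rewrite big1// => l2 _; rewrite coefCM coefXn.
  by case: eqP => [e|_]; rewrite ?mulr0//; move: ge; rewrite e ltn_ord.
have sizeL z j : (size (L z j 0%R : {poly iterpoly k n}) <= d)%N.
  rewrite mxE (leq_trans (size_sum _ _ _))//; apply/bigmax_leqP => l _.
  rewrite mul_polyC (leq_trans (size_scale_leq _ _))// size_polyXn; exact: ltn_ord.
have key (z : 'cV[iterpoly k n]_(#|{: J}|)) : M' *m z = 0 <-> M *m L z = 0.
  have E1 i t : ((M *m L z) i 0 : {poly iterpoly k n})`_t =
      \sum_j \sum_(l < d | (l <= t)%N) (M i j : {poly iterpoly k n})`_(t - l) * z (enum_rank (j, l)) 0.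
    rewrite mxE coef_sum; apply: eq_bigr => j _.
    rewrite mxE mulr_sumr coef_sum [RHS]big_mkcond /=; apply: eq_bigr => l _.
    rewrite mulrA coefMXn mulrC coefCM mulrC.
    by rewrite ltnNge; case: (l <= t)%N.
  have E2 (i : I) : (M' *m z) (enum_rank i) 0 = ((M *m L z) i.1 0 : {poly iterpoly k n})`_i.2.
    rewrite E1 mxE (reindex enum_rank) /=; last first.
      by exists enum_val => x _; [apply: enum_rankK|apply: enum_valK].
    rewrite pair_big_dep /= big_mkcond [RHS]big_mkcond /=; apply: eq_bigr => -[j l] _ /=.
    by rewrite mxE !enum_rankK /m0 /=; case: ifP; rewrite ?mul0r.
  split=> /matrixP H; apply/matrixP => i j; rewrite (ord1 j) [RHS]mxE.
    apply/polyP => t; rewrite coef0; case: (ltnP t (d + a)) => [lt|ge].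
      by rewrite -(E2 (i, Ordinal lt)) H mxE.
    rewrite nth_default// (leq_trans _ ge)// addnC.
    by apply: size_mulmx => i' j'; [have [] := dM i' j'|rewrite (ord1 j')].
  rewrite -[i]enum_valK E2 H; have -> : (0 : 'cV[iterpoly k n.+1]_s) (enum_val i).1 0 = 0 by rewrite mxE.
  exact: (coef0 (iterpoly k n)).
pose y' : 'cV[iterpoly k n]_(#|{: J}|) := \col_(j < #|{: J}|) (y (enum_val j : J).1 0 : {poly iterpoly k n})`_((enum_val j : J).2).
have Ly : L y' = y.
  apply/matrixP => j i; rewrite (ord1 i); apply/polyP => l; rewrite coefL.
  case: insubP => [l' _ <-|]; first by rewrite mxE enum_rankK.
  by rewrite -leqNgt => ge; rewrite nth_default// (leq_trans _ ge).
have sI : (#|{: I}| <= d ^ 3)%N.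
  rewrite card_prod !card_ord (@leq_trans (d * (d + d)))//.
    by rewrite leq_mul ?leq_add2l// (leq_trans sa).
  have d2 : (2 <= d)%N by apply: leq_trans ad.
  by rewrite addnn -mul2n !expnS expn0 muln1 leq_mul2l leq_mul2r d2 !orbT.
have d2 : (2 <= d ^ 3)%N.
  by rewrite (leq_trans (leq_trans a2 ad))// -{1}(expn1 d) leq_pexp2l// (leq_trans _ (leq_trans a2 ad)).
have dM' i j : dle (d ^ 3) (M' i j).
  rewrite mxE /m0; case: ifP => _; last exact: dle0.
  have [_ /(_ (_ - _)%N) cM] := dM (enum_val i).1 (enum_val j).1.
  apply: (dle_le _ (cM _ _)); rewrite (leq_trans ad)// -{1}(expn1 d) leq_pexp2l//.
  by rewrite (leq_trans _ (leq_trans a2 ad)).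
have My' : M' *m y' = 0 by apply/key; rewrite Ly.
have := IH _ _ _ M' y' d2 sI dM' My'.
rewrite -Ly; apply: (@lspan_map _ _ _ _ (@polyC (iterpoly k n)) La) => [c z|z [Mz dz]].
  apply/matrixP => j l; rewrite !mxE mulr_sumr; apply: eq_bigr => l' _.
  by rewrite mxE polyCM mulrA.
split; first exact/key.
move=> j; split=> [|l]; first by rewrite (leq_trans (sizeL _ _))// leqW// leq_addr.
rewrite coefL; case: insubP => [l' _ _|_]; last exact: dle0.
by apply: dle_le (dz _); apply: leq_addl.
Qed.

(* The columns of [C] are Cramer syzygies.  Dividing the entries of [y] by the monic minor [D],
   one is left with a syzygy whose degree in the last variable is bounded. *)
Lemma hermann_monic (k : fieldType) n E a s r (M : 'M[iterpoly k n.+1]_(s, r)) (y : 'cV_r)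
    p (f : 'I_p -> 'I_s) (g : 'I_p -> 'I_r) :
  hermann_bound k n E -> (2 <= a)%N -> (s <= a)%N -> (p <= s)%N ->
  (forall i j, dle a (M i j)) -> M *m y = 0 ->
  lead_const (\det (mxsub f g M)) ->
  (forall q (y : 'M_(r, q)), rowsub f M *m y = 0 -> M *m y = 0) ->
  lspan (syz M (a ^ (12 * E + 5))) y.
Proof.
move=> IH a2 sa ps dM My lcD rankM.
set D := \det _ in lcD.
pose Mf := rowsub f M; pose G : 'M[iterpoly k n.+1]_(r, p) := colsub g 1%:M.
pose N := mxsub f g M.
have MfG : Mf *m G = N.
  apply/matrixP => i j; rewrite !mxE (bigD1 (g j)) //= !mxE eqxx mulr1 big1 ?addr0// => l ne.
  by rewrite !mxE (negPf ne) mulr0.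
pose C := D%:M - G *m (\adj N *m Mf).
have MfC : Mf *m C = 0.
  rewrite mulmxBr mulmxA MfG mulmxA mul_mx_adj -/D mul_mx_scalar mul_scalar_mx.
  by rewrite subrr.
have pa : (p * a <= a ^ 2)%N by rewrite expnS expn1 leq_mul2r (leq_trans ps sa) orbT.
have dN i j : dle a (N i j) by rewrite mxE; apply: dM.
have dMf i j : dle a (Mf i j) by rewrite mxE; apply: dM.
have dD : dle (p * a) D by apply: dle_det.
have dadj i j : dle (p * a) ((\adj N) i j) by apply: dle_adj.
have dG i j : dle 0 (G i j).
  by rewrite !mxE; case: (_ == _); [apply: dle1 | apply: dle0].
have a3 : (p * a + a <= a ^ 3)%N.
  have -> : (a ^ 3 = a ^ 2 * a)%N by rewrite -expnSr.
  rewrite (leq_trans (leq_add pa (leqnn a)))//.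
  have : (a <= a ^ 2)%N by rewrite -{1}(expn1 a) leq_pexp2l// (leq_trans _ a2).
  by nia.
have dC i j : dle (a ^ 3) (C i j).
  rewrite mxE; apply: dleD.
    apply: (@dle_le _ _ (p * a)); first by rewrite (leq_trans _ a3)// leq_addr.
    by rewrite mxE; case: (_ == _); rewrite ?mulr1n ?mulr0n//; apply: dle0.
  rewrite mxE; apply: dleN; apply: (dle_le a3).
  rewrite -[(p * a + a)%N]add0n.
  by apply: dle_mulmx => // i' j'; apply: dle_mulmx.
have divD j : exists qr : {poly iterpoly k n} * {poly iterpoly k n},
    y j 0 = D * qr.1 + qr.2 /\ (size qr.2 < size (D : {poly iterpoly k n}))%N.
  by have [q [r0 [e sr]]] := lead_const_div (y j 0) lcD; exists (q, r0).
have [qr Hqr] := choice divD.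
pose q : 'cV[iterpoly k n.+1]_r := \col_j (qr j).1.
pose rr : 'cV[iterpoly k n.+1]_r := \col_j (qr j).2.
have yE : y = D *: q + rr.
  by apply/matrixP => i j; rewrite (ord1 j) !mxE; have [] := Hqr i.
(* Splitting off the Cramer syzygy [C *m q] instead of [D *: q] changes the remainder only in the
   [p] selected coordinates, by [w]. *)
pose w := \adj N *m (Mf *m q).
pose y' := rr + G *m w.
have yCq : y = C *m q + y'.
  rewrite /y' /w mulmxBl mul_scalar_mx yE -!mulmxA addrA addrAC addrNK.
  by rewrite addrC.
have MC : M *m C = 0 by apply: rankM.
have My' : M *m y' = 0.
  by have := My; rewrite yCq mulmxDr mulmxA MC mul0mx add0r.
have Mfy' : Mf *m y' = 0.
  have -> : Mf *m y' = rowsub f (M *m y').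
    by apply/matrixP => i j; rewrite !mxE; apply: eq_bigr => l _; rewrite !mxE.
  by rewrite My'; apply/matrixP => i j; rewrite !mxE.
(* The quotient [q] has no degree bound, but the syzygy relation expresses [D *: w] through the
   remainders [rr] alone. Degrees in the last variable add in a domain, so [w] is bounded there. *)
have Dw : D *: w = - (\adj N *m Mf *m rr).
  have : \adj N *m (Mf *m y') = 0 by rewrite Mfy' mulmx0.
  rewrite /y' mulmxDr (mulmxA Mf G) MfG mulmxDr !mulmxA mul_adj_mx -/D mul_scalar_mx.
  by move/eqP; rewrite addrC addr_eq0 => /eqP <-; rewrite /w -!scalemxAl mulmxA.
have D0 : D != 0.
  by have [c [c0 lc]] := lcD; rewrite -lead_coef_eq0 lc fmorph_eq0.
pose B := (p * a + a + (p * a).+1)%N.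
have sw i : (size (w i 0%R : {poly iterpoly k n}) <= B)%N.
  have [->|w0] := eqVneq (w i 0) 0; first by rewrite size_poly0.
  have : (size ((D * w i 0)%R : {poly iterpoly k n}) <= B)%N.
    have -> : D * w i 0 = (D *: w) i 0 by rewrite [RHS]mxE.
    rewrite Dw mxE size_polyN.
    apply: (@size_mulmx _ _ _ _ (p * a + a) (p * a).+1 (\adj N *m Mf) rr) => i' j'.
      by have [] := dle_mulmx dadj dMf i' j'.
    by rewrite mxE ltnW// (leq_trans (Hqr i').2)//; have [] := dD.
  apply: leq_trans; rewrite size_mul// -subn1 leq_subRL ?addn_gt0 ?size_poly_gt0 ?D0//.
  by rewrite leq_add2r size_poly_gt0.
have sy' j : (size (y' j 0%R : {poly iterpoly k n}) <= a ^ 4)%N.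
  apply: (@leq_trans B); last first.
    have -> : (a ^ 4 = a ^ 2 * a ^ 2)%N by rewrite -expnD.
    rewrite /B; have : (a * 2 <= a ^ 2)%N by rewrite expnS expn1 leq_mul2l a2 orbT.
    by nia.
  rewrite mxE (leq_trans (size_polyD _ _))// geq_max; apply/andP; split.
    rewrite mxE ltnW// (leq_trans (Hqr j).2)// /B (leq_trans dD.1)// leq_addl//.
  rewrite -[B]add0n.
  by apply: (@size_mulmx _ _ _ _ 0 B G w) => [i' j'|i' j']; [have [] := dG i' j'|rewrite (ord1 j')].
have a4 : (a <= a ^ 4)%N by rewrite -{1}(expn1 a) leq_pexp2l// (leq_trans _ a2).
have ple e e' : (e <= e')%N -> (a ^ e <= a ^ e')%N by move=> ?; rewrite leq_pexp2l// (leq_trans _ a2).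
rewrite yCq; apply: lspanD.
  have -> : C *m q = \sum_j q j 0 *: col j C.
    apply/matrixP => i j; rewrite (ord1 j) mxE summxE; apply: eq_bigr => l _.
    by rewrite !mxE mulrC.
  apply: lspan_sum => j _; apply/lspanZ/lspan_in; split.
    have -> : M *m col j C = col j (M *m C).
      by apply/matrixP => i j'; rewrite !mxE; apply: eq_bigr => l _; rewrite mxE.
    by rewrite MC; apply/matrixP => i i'; rewrite !mxE.
  by move=> i; rewrite mxE; apply: dle_le (dC i j); apply: ple; lia.
apply: lspan_trans (hermann_expand IH a2 a4 sa dM My' sy') => z [Mz dz].
apply: lspan_in; split=> // j; apply: dle_le (dz j).
(* Both summands [a ^ 4] and [a ^ (12 * E)] are at most [a ^ (12 * E + 4)], and one more factor
   [a >= 2] absorbs their sum. *)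
have -> : (((a ^ 4) ^ 3) ^ E = a ^ (12 * E))%N by rewrite -!expnM; congr (_ ^ _)%N; lia.
have : (a ^ 4 <= a ^ (12 * E + 4))%N by apply: ple; lia.
have : (a ^ (12 * E) <= a ^ (12 * E + 4))%N by apply: ple; lia.
have -> : (a ^ (12 * E + 5) = a * a ^ (12 * E + 4))%N by rewrite -expnS; congr (_ ^ _)%N; lia.
by nia.
Qed.

(* Hermann's bound: for a fixed number of variables, the syzygies of a matrix with any number
   of columns are generated in degree polynomial in the degrees of the entries and the number
   of rows. *)
Theorem hermann (k : fieldType) n : exists E, hermann_bound k n E.
Proof.
elim: n => [|n [E IH]].
  by exists 0%N => a s r M y _ _ _ My; apply: lspan_in.
(* A Nagata substitution multiplies degrees by at most [a ^ b], from [n.+1 <= a ^ n.+1] and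
   [e ^ n + 1 <= a ^ (3 * n + 1)]. This is paid once before [hermann_monic], which is applied with
   [a ^ b.+1], and once after it. *)
pose b := (4 * n + 2)%N; pose E1 := (12 * E + 5)%N.
exists (b.+1 * E1 + b)%N => a s r M y a2 sa dM My.
have ple e e' : (e <= e')%N -> (a ^ e <= a ^ e')%N by move=> ?; rewrite leq_pexp2l// (leq_trans _ a2).
have [p [f [g [ps D0 rankM]]]] := rank_minor M.
(* [nagata_lead] needs the degree of the minor, at most [p * a <= a ^ 2], to be at most [e.-1]. *)
pose e := (a ^ 2 + 1)%N; have e_gt0 : (0 < e)%N by rewrite /e addn1.
pose nag b := nagata k n e b.
pose M1 := map_mx (nag false) M; pose y1 := map_mx (nag false) y.
have pa : (p * a <= a ^ 2)%N by rewrite expnS expn1 leq_mul2r (leq_trans ps sa) orbT.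
have nn : (n.+1 <= a ^ n.+1)%N.
  apply: (@leq_trans (2 ^ n.+1)); first by rewrite ltnW// ltn_expl.
  by rewrite leq_exp2r.
have ee : (e ^ n + 1 <= a ^ (3 * n + 1))%N.
  have : (e ^ n <= a ^ (3 * n))%N.
    rewrite expnM; case: (n) => // n'; rewrite leq_exp2r// /e.
    have -> : (a ^ 3 = a * a ^ 2)%N by rewrite -expnS.
    have : (1 <= a ^ 2)%N by rewrite expn_gt0 (leq_trans _ a2).
    by nia.
  have : (1 <= a ^ (3 * n))%N by rewrite expn_gt0 (leq_trans _ a2).
  by rewrite [(3 * n + 1)%N]addn1 expnS; nia.
have bound b' D (q : iterpoly k n.+1) : dle D q -> dle (D * a ^ b) (nag b' q).
  move=> dq; apply: dle_le (dle_nagata e b' dq).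
  rewrite mulnCA leq_mul2l; apply/orP; right.
  have -> : (a ^ b = a ^ n.+1 * a ^ (3 * n + 1))%N by rewrite -expnD /b; congr (_ ^ _)%N; lia.
  by rewrite leq_mul.
have nagK b' q : nag (~~ b') (nag b' q) = q by apply: nagataK.
have b_gt0 : (0 < b)%N by rewrite /b addn2.
pose a1 := (a ^ b * a)%N.
have aa1 : (a <= a1)%N by rewrite /a1 leq_pmull// expn_gt0 (leq_trans _ a2).
have a1E : a1 = (a ^ b.+1)%N by rewrite /a1 expnSr.
have M1y1 : M1 *m y1 = 0 by rewrite -map_mxM My map_mx0.
have dM1 i j : dle a1 (M1 i j) by rewrite mxE /a1 mulnC; apply: bound.
have detM1 : \det (mxsub f g M1) = nag false (\det (mxsub f g M)).
  by rewrite -det_map_mx; congr (\det _); apply/matrixP => i j; rewrite !mxE.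
have lc : lead_const (\det (mxsub f g M1)).
  rewrite detM1; apply: nagata_lead => //.
  have -> : e.-1 = (a ^ 2)%N by rewrite /e addn1.
  by apply: (dle_le pa); apply: dle_det => i j; rewrite mxE.
have nagM b' q1 q2 q3 (X : 'M[iterpoly k n.+1]_(q1, q2)) (Y : 'M[iterpoly k n.+1]_(q2, q3)) :
    map_mx (nag b') (X *m Y) = map_mx (nag b') X *m map_mx (nag b') Y by rewrite map_mxM.
have nagMK b' q1 q2 (X : 'M[iterpoly k n.+1]_(q1, q2)) :
    map_mx (nag (~~ b')) (map_mx (nag b') X) = X.
  by apply/matrixP => i j; rewrite !mxE nagK.
have rankM1 q (z : 'M_(r, q)) : rowsub f M1 *m z = 0 -> M1 *m z = 0.
  move=> H; rewrite -[z](nagMK true) -nagM rankM ?map_mx0//.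
  have -> : rowsub f M = map_mx (nag true) (rowsub f M1).
    by apply/matrixP => i j; rewrite !mxE (nagK false).
  by rewrite -nagM H map_mx0.
have := hermann_monic IH (leq_trans a2 aa1) (leq_trans sa aa1) ps dM1 M1y1 lc rankM1.
rewrite -[X in _ -> lspan _ X](nagMK false).
apply: (@lspan_map _ _ _ _ (nag true) (map_mx (nag true))) => [c z|z [Mz dz]].
  by apply/matrixP => i j; rewrite !mxE; exact: (rmorphM (nag true)).
split.
  by rewrite -[M](nagMK false) -nagM Mz map_mx0.
move=> j; rewrite mxE expnD [(a ^ (b.+1 * E1))%N]expnM -a1E.
exact: bound.
Qed.

(** * Noetherian rings and prime ideals *)

(** An expression of [F *: al] by [r] elements of [C] is a syzygy of the matrix with columns [al]
    and these elements, and first coordinates of syzygies lie in the colon. There is no control on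
    [r], so a bound independent of the number of columns is essential. *)
Theorem hermann_colon (k : fieldType) n : exists E,
  forall a s (al : 'cV[iterpoly k n]_s) (C : 'cV[iterpoly k n]_s -> Prop) F,
    (2 <= a)%N -> (s <= a)%N -> (forall i, dle a (al i 0)) ->
    (forall c, C c -> forall i, dle a (c i 0)) -> lspan C (F *: al) ->
    lspan (V := (iterpoly k n)^o) (fun G => dle (a ^ E) G /\ lspan C (G *: al)) F.
Proof.
have [E HE] := hermann k n; exists E => a s al C F a2 sa dal dC /lspanP[r [c [g [Cg FE]]]].
pose M : 'M[iterpoly k n]_(s, r.+1) :=
  \matrix_(i, j) if unlift ord0 j is Some l then g l i 0 else al i 0.
pose y : 'cV[iterpoly k n]_(r.+1) := \col_j if unlift ord0 j is Some l then - c l else F.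
have ME (z : 'cV[iterpoly k n]_(r.+1)) :
    M *m z = z 0 0 *: al + \sum_(l < r) z (lift ord0 l) 0 *: g l.
  apply/matrixP => i j; rewrite (ord1 j) !mxE big_ord_recl !mxE unlift_none mulrC summxE.
  by congr (_ + _); apply: eq_bigr => l _; rewrite !mxE liftK mulrC.
have My : M *m y = 0.
  rewrite ME mxE unlift_none FE -big_split /= big1// => l _.
  by rewrite mxE liftK scaleNr subrr.
have dM i j : dle a (M i j) by rewrite mxE; case: unliftP => [l _|_] //; apply: dC.
pose L (z : 'cV[iterpoly k n]_(r.+1)) : (iterpoly k n)^o := z 0 0.
have Ladd : additive L by move=> u v; rewrite /L !mxE.
pose LL := GRing.isZmodMorphism.Build _ _ L Ladd.
pose La : {additive 'cV[iterpoly k n]_(r.+1) -> (iterpoly k n)^o} := HB.pack L LL.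
have -> : F = La y by rewrite /La /= /L mxE unlift_none.
apply: (@lspan_map _ _ _ _ (idfun : {rmorphism iterpoly k n -> iterpoly k n}) La) (HE _ _ _ M y a2 sa dM My) => [d z|z [Mz dz]].
  by rewrite /La /= /L mxE.
split; first exact: dz.
have /eqP := Mz; rewrite ME addr_eq0 => /eqP ->.
by apply/lspanN/lspan_sum => l _; apply/lspanZ/lspan_in.
Qed.

Definition is_ideal (A : comNzRingType) (I : A -> Prop) :=
  [/\ I 0, forall x y, I x -> I y -> I (x + y) & forall a x, I x -> I (a * x)].

Definition is_prime (A : comNzRingType) (I : A -> Prop) :=
  [/\ is_ideal I, ~ I 1 & forall x y, I (x * y) -> I x \/ I y].

Definition ispan (A : nzRingType) (X : A -> Prop) : A -> Prop := lspan (V := A^o) X.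

Definition noeth (A : comNzRingType) := forall I : A -> Prop, is_ideal I ->
  exists s : seq A, (forall x, x \in s -> I x) /\
    forall x, I x -> ispan (fun y => y \in s) x.

Section Ideals.
Context (A : comNzRingType).
Implicit Types (I X : A -> Prop).

Lemma idealB I x y : is_ideal I -> I x -> I y -> I (x - y).
Proof. by move=> [_ ID IM] Ix Iy; apply: ID => //; rewrite -mulN1r; apply: IM. Qed.

Lemma ideal_sum I (J : Type) (r : seq J) (P : pred J) F : is_ideal I ->
  (forall i, P i -> I (F i)) -> I (\sum_(i <- r | P i) F i).
Proof. by move=> [I0 ID _] H; apply: big_ind. Qed.

Lemma ispan_ideal X : is_ideal (ispan X).
Proof.
split; [exact: lspan0 | move=> x y; exact: lspanD | move=> a x; exact: lspanZ].
Qed.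

Lemma ispan_sub I X x : is_ideal I -> (forall x, X x -> I x) -> ispan X x -> I x.
Proof.
move=> [I0 ID IM] XI; apply: lspan_min => // c u w /XI Iu Iw.
by apply: ID => //; apply: IM.
Qed.

Lemma prime_exp I x n : is_prime I -> I (x ^+ n) -> I x.
Proof. by move=> [_ I1 IM]; elim: n => [/I1//|n IH]; rewrite exprS => /IM[//|/IH]. Qed.

(** The ascending chain condition: generators of the ideal of all terms involve only finitely many
    of the terms. *)
Lemma noeth_chain (s : nat -> A) : noeth A ->
  exists m (c : 'I_m -> A), s m = \sum_i c i * s i.
Proof.
move=> nA; have [l [lI lS]] := nA _ (ispan_ideal (fun x => exists n, x = s n)).
have [m Hm] : exists m, forall x, x \in l -> ispan (fun x => exists2 n, (n < m)%N & x = s n) x.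
  elim: l lI {lS} => [|x l IH] lI; first by exists 0%N.
  have [y yl|m Hm] := IH; first by apply: lI; rewrite inE yl orbT.
  have [m' Hm'] : exists m, ispan (fun x => exists2 n, (n < m)%N & x = s n) x.
    have : ispan (fun x => exists n, x = s n) x by apply: lI; rewrite inE eqxx.
    elim=> [|c u w [n un] _ [m' IHw]]; first by exists 0%N; apply: lspan0.
    exists (maxn n.+1 m'); apply: lspanS; first by exists n => //; rewrite leq_max leqnn.
    apply: lspan_trans IHw => y [j lt ->]; apply: lspan_in.
    by exists j => //; rewrite leq_max lt orbT.
  exists (maxn m m') => y; rewrite inE => /orP[/eqP->|/Hm].
    apply: lspan_trans Hm' => z [j lt ->]; apply: lspan_in; exists j => //.
    by rewrite leq_max lt orbT.
  by apply: lspan_trans => z [j lt ->]; apply: lspan_in; exists j => //; rewrite leq_max lt.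
have : ispan (fun x => exists2 n, (n < m)%N & x = s n) (s m).
  by apply: (@lspan_trans A A^o (fun y => y \in l) _ _ Hm); apply: lS; apply: lspan_in; exists m.
move=> H; exists m; elim: H => [|c u w [n lt ->] _ [d ->]].
  by exists (fun _ => 0); rewrite big1// => i _; rewrite mul0r.
exists (fun i => (if i == Ordinal lt then c else 0) + d i).
under [RHS]eq_bigr do rewrite mulrDl.
rewrite big_split /=; congr (_ + _); rewrite (bigD1 (Ordinal lt)) //= eqxx big1 ?addr0//.
by move=> i ne; rewrite (negPf ne) mul0r.
Qed.

End Ideals.

Lemma noeth_field (k : fieldType) : noeth k.
Proof.
move=> I [I0 ID IM]; have [[x [Ix x0]]|no] := pselect (exists x, I x /\ x != 0).
  exists [:: 1]; split=> [y|y _].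
    by rewrite inE => /eqP->; rewrite -(mulVf x0); apply: IM.
  have := @lspan_in _ k^o (fun y => y \in [:: 1]) 1 (mem_head _ _).
  by move/(lspanZ y); rewrite /GRing.scale /= mulr1.
exists [::]; split=> // x Ix; have [->|x0] := eqVneq x 0; first exact: lspan0.
by case: no; exists x.
Qed.

(** The coefficient ideals increase with the degree and are stationary from some [D] on; generators
    of degree up to [D], shifted by powers of ['X], then cancel the top coefficient of any element
    of [I]. *)
Lemma hilbert_basis (A : comNzRingType) : noeth A -> noeth {poly A}.
Proof.
move=> nA I Iid; have [I0 ID IM] := Iid.
(* [J d] is the ideal of coefficients of degree [d] of the elements of [I] of degree at most [d]. *)
pose J d (a : A) := exists f : {poly A}, [/\ I f, (size f <= d.+1)%N & f`_d = a].
have Jid d : is_ideal (J d).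
  split=> [|a b [f [If sf fa]] [g [Ig sg gb]]|a b [f [If sf fb]]].
  - by exists 0; rewrite size_poly0 coef0.
  - exists (f + g); split; [exact: ID| |by rewrite coefD fa gb].
    by rewrite (leq_trans (size_polyD _ _))// geq_max sf.
  - exists (a%:P * f); split; [exact: IM| |by rewrite coefCM fb].
    by rewrite mul_polyC (leq_trans (size_scale_leq _ _)).
have Jup d e a : (d <= e)%N -> J d a -> J e a.
  move=> le [f [If sf fa]]; exists ('X^(e - d) * f); split; first exact: IM.
    rewrite (leq_trans (size_polyMleq _ _))// size_polyXn addSn /=.
    by rewrite -(subnK le) addnK -addnS leq_add2l.
  by rewrite coefXnM ltnNge leq_subr /= subKn.
pose Ji a := exists d, J d a.
have Jiid : is_ideal Ji.
  split; first by exists 0%N; have [] := Jid 0%N.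
    move=> a b [d Ja] [e Jb]; exists (maxn d e); have [_ JD _] := Jid (maxn d e).
    by apply: JD; [apply: Jup Ja; apply: leq_maxl | apply: Jup Jb; apply: leq_maxr].
  by move=> a b [d Jb]; exists d; have [_ _ JM] := Jid d; apply: JM.
have [s [sJ sS]] := nA _ Jiid.
have [D HD] : exists D, forall a, a \in s -> J D a.
  elim: s sJ {sS} => [|a s IH] sJ; first by exists 0%N.
  have [b bs|D HD] := IH; first by apply: sJ; rewrite inE bs orbT.
  have [e Je] := sJ a (mem_head _ _); exists (maxn D e) => b.
  rewrite inE => /orP[/eqP->|/HD].
    by move: Je; apply: Jup; apply: leq_maxr.
  by apply: Jup; apply: leq_maxl.
have gens d : exists l : seq {poly A}, (forall f, f \in l -> I f) /\
    forall a, J d a -> exists g, [/\ ispan (fun y => y \in l) g, (size g <= d.+1)%N & g`_d = a].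
  have [sd [sdJ sdS]] := nA _ (Jid d).
  have [l [lI lP]] : exists l : seq {poly A}, (forall f, f \in l -> I f) /\
      forall a, a \in sd -> exists g, [/\ g \in l, (size g <= d.+1)%N & g`_d = a].
    elim: sd sdJ {sdS} => [|a sd IH] sdJ; first by exists [::].
    have [b bs|l [lI lP]] := IH; first by apply: sdJ; rewrite inE bs orbT.
    have [f [If sf fa]] := sdJ a (mem_head _ _); exists (f :: l); split.
      by move=> g; rewrite inE => /orP[/eqP->|/lI].
    move=> b; rewrite inE => /orP[/eqP->|/lP[g [gl sg gb]]].
      by exists f; rewrite mem_head.
    by exists g; rewrite inE gl orbT.
  exists l; split=> // a /sdS; elim=> [|c u w us _ [g [gs sg gw]]].
    by exists 0; rewrite size_poly0 coef0; split=> //; apply: lspan0.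
  have [h [hl sh hu]] := lP _ us.
  exists (c%:P * h + g); split; first exact: lspanS.
    rewrite (leq_trans (size_polyD _ _))// geq_max sg mul_polyC.
    by rewrite (leq_trans (size_scale_leq _ _)).
  by rewrite coefD coefCM hu gw.
have [l lP] := choice gens.
exists (flatten [seq l d | d <- iota 0 D.+1]); split.
  by move=> f /flattenP[_ /mapP[d _ ->]]; have [H _] := lP d; apply: H.
set X := (fun y : {poly A} => _).
have inX d g : (d <= D)%N -> ispan (fun y => y \in l d) g -> ispan X g.
  move=> dD; apply: lspan_trans => y yl; apply: lspan_in.
  by apply/flattenP; exists (l d) => //; apply/map_f; rewrite mem_iota add0n ltnS.
have JD a : Ji a -> J D a.
  move=> /sS; apply: (@ispan_sub _ (J D)) => //; exact: Jid.
move=> f; move: {2}(size f) (leqnn (size f)) => m; elim: m f => [|m IH] f sf If.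
  by move: sf; rewrite leqn0 size_poly_eq0 => /eqP->; apply: lspan0.
have step g : ispan X g -> (size g <= m.+1)%N -> g`_m = f`_m -> ispan X f.
  move=> Xg sg gf; rewrite -(subrK g f); apply: lspanD => //.
  apply: IH; last first.
    apply: idealB => //; apply: (ispan_sub Iid _ Xg) => y /flattenP[_ /mapP[d _ ->]].
    by have [H _] := lP d; apply: H.
  rewrite leqNgt; apply/negP => lt.
  have sm : size (f - g) = m.+1.
    apply/eqP; rewrite eqn_leq lt andbT (leq_trans (size_polyD _ _))//.
    by rewrite geq_max sf size_polyN.
  have : lead_coef (f - g) = 0 by rewrite lead_coefE sm /= coefB gf subrr.
  by move/eqP; rewrite lead_coef_eq0 -size_poly_eq0 sm.
have Jf : J m f`_m by exists f.
case: (leqP m D) => [mD|Dm].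
  by have [_ /(_ _ Jf)[g [/(inX _ _ mD) Xg sg gf]]] := lP m; apply: (step g).
have [_ /(_ f`_m)[|g [/(inX _ _ (leqnn D)) Xg sg gf]]] := lP D.
  by apply: JD; exists m.
apply: (step ('X^(m - D) * g)).
- by have [_ _ XM] := ispan_ideal X; apply: XM.
- rewrite (leq_trans (size_polyMleq _ _))// size_polyXn addSn /=.
  by rewrite -(subnK (ltnW Dm)) addnK -addnS leq_add2l.
- by rewrite coefXnM ltnNge leq_subr /= subKn// ltnW.
Qed.

Lemma noeth_ip (A : idomainType) n : noeth A -> noeth (iterpoly A n).
Proof. by move=> nA; elim: n => //= n; apply: hilbert_basis. Qed.

(** By Zorn's lemma there is an ideal that contains [I0] and is maximal among those disjoint from
    the multiplicative set [M]; such an ideal is prime. *)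
Lemma exists_prime (A : comNzRingType) (I0 M : A -> Prop) : is_ideal I0 ->
  M 1 -> (forall x y, M x -> M y -> M (x * y)) -> (forall x, I0 x -> ~ M x) ->
  exists q, [/\ is_prime q, forall x, I0 x -> q x & forall x, q x -> ~ M x].
Proof.
move=> I0id M1 MM I0M.
(* [I0] enters through the span and not through [S], so that [S] ranges over all sets and the empty
   chain is covered by [I0M]. *)
pose P (S : set A) := forall x, ispan (fun y => S y \/ I0 y) x -> ~ M x.
have [F FP Ftot|S [PS Smax]] := @Zorn_bigcup A P.
  move=> x Hx Mx.
  have [[U FU]|noU] := pselect (exists U, F U); last first.
    case: (I0M x) => //; apply: (ispan_sub I0id _ Hx) => y [[U FU]|//].
    by case: noU; exists U.
  have [V FV HV] : exists2 V, F V & ispan (fun y => V y \/ I0 y) x.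
    elim: Hx {Mx} => [|c u w Hu _ [V FV HV]]; first by exists U => //; apply: lspan0.
    case: Hu => [[W FW Wu]|I0u]; last by exists V => //; apply: lspanS => //; right.
    have [VW|WV] := Ftot _ _ FV FW.
      exists W => //; apply: lspanS; first by left.
      by apply: lspan_trans HV => y [/VW|] ?; apply: lspan_in; [left|right].
    by exists V => //; apply: lspanS => //; left; apply: WV.
  exact: (FP _ FV x).
pose q := ispan (fun y => S y \/ I0 y).
have qid : is_ideal q by apply: ispan_ideal.
have Sq x : S x -> q x by move=> ?; apply: lspan_in; left.
have ext x : ~ q x -> exists y z, [/\ q y, M z & exists a, z = y + a * x].
  move=> nqx; apply: contrapT => H.
  pose B : set A := fun y => exists a, q (y - a * x).
  apply: (Smax B); first split.
  - by move=> y /Sq Sy; exists 0; rewrite mul0r subr0.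
  - move=> BS; case: nqx; apply/Sq/BS; exists 1.
    by rewrite mul1r subrr; case: qid.
  move=> z Hz Mz; apply: H.
  have [a qa] : exists a, q (z - a * x).
    elim: Hz {Mz} => [|c u w Hu _ [a qa]]; first by exists 0; rewrite mul0r subr0; case: qid.
    have [b qb] : exists b, q (u - b * x).
      by case: Hu => // I0u; exists 0; rewrite mul0r subr0; apply: lspan_in; right.
    exists (c * b + a); have [_ qD qM] := qid.
    have -> : c *: (u : A^o) + w - (c * b + a) * x = c * (u - b * x) + (w - a * x).
      by rewrite /GRing.scale /=; ring.
    by apply: qD => //; apply: qM.
  by exists (z - a * x), z; split=> //; exists a; rewrite subrK.
exists q; split=> //; last by move=> x I0x; apply: lspan_in; right.
split=> //; first by move=> q1; apply: (PS 1).
move=> x y qxy; apply: contrapT => /not_orP[/ext[u [z [qu Mz [a zE]]]] /ext[u' [z' [qu' Mz' [a' z'E]]]]].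
have [_ qD qM] := qid.
apply: (PS (z * z')); last exact: MM.
have -> : z * z' = (u' + a' * y) * u + (a * x * u' + (a * a') * (x * y)).
  by rewrite zE z'E; ring.
by rewrite -/(q _); apply: (qD); [apply: qM|apply: qD; apply: qM].
Qed.

(** * Monomials and linear dependence *)

Lemma frac_rep (A : idomainType) (x : {fraction A}) :
  exists a b, b != 0 /\ x * FracField.tofrac b = FracField.tofrac a.
Proof.
elim/quotW: x => r; exists r.1, r.2; split; first exact: denom_ratioP.
unlock FracField.tofrac; rewrite -[LHS]FracField.pi_mul.
apply/eqmodP; rewrite /= FracField.equivfE /FracField.mulf.
have r2 := denom_ratioP r.
by rewrite !numden_Ratio ?mulr1 ?mulf_neq0 ?oner_eq0 //= mulrC.
Qed.

Lemma clear_denom (A : idomainType) (K : fieldType) (f : A -> K) (I : finType) (x : I -> K) :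
  f 0 = 0 -> f 1 = 1 -> {morph f : a b / a * b} ->
  (forall i, exists a b, f b != 0 /\ x i * f b = f a) ->
  exists d a, f d != 0 /\ forall i, x i * f d = f (a i).
Proof.
move=> f0 f1 fM rep.
suff [d [a [d0 H]]] : exists d (a : I -> A), f d != 0 /\ forall i, i \in enum I -> x i * f d = f (a i).
  by exists d, a; split=> // i; apply: H; rewrite mem_enum.
elim: (enum I) => [|j s [d [a [d0 H]]]].
  by exists 1, (fun _ => 0); rewrite f1 oner_neq0.
have [aj [b [b0 E]]] := rep j.
exists (d * b), (fun i => if i == j then aj * d else a i * b); split.
  by rewrite fM mulf_neq0.
move=> i; rewrite inE; case: eqP => [->|_ /= /H Hi].
  by rewrite !fM mulrCA mulrC E.
by rewrite !fM mulrA Hi.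
Qed.

Lemma lin_dep (A : idomainType) (I J : finType) (M : I -> J -> A) : (#|J| < #|I|)%N ->
  exists c : I -> A, (exists i, c i != 0) /\ forall j, \sum_i c i * M i j = 0.
Proof.
move=> lt; pose tf := @FracField.tofrac A.
pose MF := \matrix_(i < #|I|, j < #|J|) tf (M (enum_val i) (enum_val j)).
have : kermx MF != 0.
  by rewrite kermx_eq0 /row_free neq_ltn (leq_ltn_trans (rank_leq_col _) lt).
move/rowV0Pn => [v /sub_kermxP vM v0].
have [||||d [a [d0 Ha]]] := @clear_denom A {fraction A} tf I (fun i => v 0 (enum_rank i)).
- exact: rmorph0. - exact: rmorph1. - exact: rmorphM.
- by move=> i; have [a [b [b0 E]]] := frac_rep (v 0 (enum_rank i)); exists a, b; rewrite tofrac_eq0.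
exists a; split.
  move/rV0Pn: v0 => [j vj]; exists (enum_val j); rewrite -tofrac_eq0 -/tf -/(tf _) -Ha enum_valK.
  by rewrite mulf_neq0.
move=> j; apply/eqP; rewrite -tofrac_eq0 rmorph_sum /=.
have /matrixP/(_ 0 (enum_rank j)) := vM; rewrite !mxE => H.
apply/eqP; transitivity (0 * tf d); last exact: mul0r.
rewrite -[in RHS]H mulr_suml.
rewrite [RHS](reindex enum_rank) /=; last first.
  by exists enum_val => x _; [apply: enum_rankK|apply: enum_valK].
apply: eq_bigr => i _; rewrite [LHS]rmorphM /= -/tf -/(tf _) -Ha mxE !enum_rankK.
by rewrite mulrAC.
Qed.

Fixpoint mon (A : idomainType) n (be : nat -> nat) : iterpoly A n :=
  if n is m.+1 then (mon A m be)%:P * 'X^(be m) : {poly iterpoly A m} else 1.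

Fixpoint cf (A : idomainType) n (be : nat -> nat) : iterpoly A n -> A :=
  if n is m.+1 then fun p : {poly iterpoly A m} => cf be p`_(be m) else id.

Section Monomials.
Context (A : idomainType).

Lemma ev_mon (B : comNzRingType) (f : {rmorphism A -> B}) x n be :
  ev f x n (mon A n be) = \prod_(i < n) x i ^+ be i.
Proof.
elim: n => [|n IH]; first by rewrite big_ord0 rmorph1.
by rewrite [mon _ _ _]/= rmorphM rmorphXn ev_polyX ev_polyC IH big_ord_recr.
Qed.

Lemma cf0 n be : cf be (0 : iterpoly A n) = 0.
Proof. by elim: n => //= n IH; rewrite coef0 IH. Qed.

Lemma cfD n be (p q : iterpoly A n) : cf be (p + q) = cf be p + cf be q.
Proof. by elim: n p q => //= n IH p q; rewrite coefD IH. Qed.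

Lemma cf_sum n be (I : Type) (r : seq I) (P : pred I) (F : I -> iterpoly A n) :
  cf be (\sum_(i <- r | P i) F i) = \sum_(i <- r | P i) cf be (F i).
Proof. by apply: (big_morph (cf be)); [apply: cfD|apply: cf0]. Qed.

Lemma cf_mon n be be' a : cf be' (iterpolyC A n a * mon A n be) =
  if [forall i : 'I_n, be i == be' i] then a else 0.
Proof.
elim: n => [|n IH] /=; first by rewrite mulr1; case: forallP => // -[] [].
rewrite mulrA -polyCM coefMXn coefC.
case: (ltngtP (be' n) (be n)) => [lt|gt|e].
- rewrite cf0; case: forallP => // /(_ ord_max) /eqP e; move: lt.
  by rewrite /= in e; rewrite e ltnn.
- rewrite subn_eq0 leqNgt gt /= cf0; case: forallP => // /(_ ord_max) /eqP e; move: gt.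
  by rewrite /= in e; rewrite e ltnn.
rewrite e subnn eqxx IH; do 2![case: forallP => //] => H1 H2.
  case: H1 => i; have [lt|ge] := ltnP i n; first by have := H2 (Ordinal lt).
  by have -> : (i : nat) = n; [apply/eqP; rewrite eqn_leq ge -ltnS ltn_ord | rewrite e].
by case: H2 => i; have := H1 (widen_ord (leqnSn n) i).
Qed.

Definition ext n D (h : {ffun 'I_n -> 'I_D.+1}) (i : nat) : nat :=
  if insub i is Some j then h j else 0%N.

Lemma ext_ord n D h (i : 'I_n) : @ext n D h i = h i.
Proof. by rewrite /ext insubT ?ltn_ord//= => H; congr (nat_of_ord (h _)); apply: val_inj. Qed.

Lemma mon_indep n D (z : {ffun 'I_n -> 'I_D.+1} -> A) :
  \sum_h iterpolyC A n (z h) * mon A n (ext h) = 0 -> forall h, z h = 0.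
Proof.
move=> H h; have := congr1 (cf (ext h)) H.
rewrite cf_sum cf0 (bigD1 h) //= cf_mon ifT; last by apply/forallP => i.
rewrite big1 ?addr0// => h' ne; rewrite cf_mon ifF//.
apply: contraNF ne => /forallP E; apply/eqP/ffunP => i; apply: val_inj.
by have /eqP := E i; rewrite !ext_ord.
Qed.

Lemma dle_ind n D (Q : iterpoly A n -> Prop) : Q 0 -> (forall p q, Q p -> Q q -> Q (p + q)) ->
  (forall a be, (forall i, (i < n)%N -> (be i <= D)%N) -> Q (iterpolyC A n a * mon A n be)) ->
  forall p, dle D p -> Q p.
Proof.
elim: n Q => [|n IH] Q Q0 QD QM p.
  by move=> _; have := QM p (fun _ => 0%N); rewrite /= mulr1; apply.
move=> [sp cp]; rewrite (poly_sumE sp); apply: big_ind => // i _.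
apply: (IH (fun q => Q ((q%:P * 'X^i : {poly iterpoly A n}) : iterpoly A n.+1))) (cp i).
- by rewrite polyC0 mul0r.
- by move=> q r Qq Qr; rewrite polyCD mulrDl; apply: QD.
move=> a be bD.
pose be' j := if j == n then i : nat else be j.
have eq_mon m : (m <= n)%N -> mon A m be' = mon A m be.
  elim: m => //= m IHm lt; rewrite IHm 1?ltnW// /be'.
  by rewrite (ltn_eqF lt).
have -> : (iterpolyC A n a * mon A n be)%:P * 'X^i = iterpolyC A n.+1 a * mon A n.+1 be' :> {poly iterpoly A n}.
  by rewrite /= /be' eqxx -/be' eq_mon// polyCM mulrA.
apply: QM => j; rewrite ltnS leq_eqVlt /be'; case: eqP => [_ _|_ /= lt]; last exact: bD.
by rewrite -ltnS.
Qed.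

Lemma dle_span n D p : @dle A n D p ->
  exists c : {ffun 'I_n -> 'I_D.+1} -> A, p = \sum_h iterpolyC A n (c h) * mon A n (ext h).
Proof.
move: p; apply: (@dle_ind n D) => [|p q [c ->] [c' ->]|a be bD].
- by exists (fun _ => 0); rewrite big1// => h _; rewrite rmorph0 mul0r.
- exists (fun h => c h + c' h); rewrite -big_split; apply: eq_bigr => h _.
  by rewrite rmorphD mulrDl.
pose h0 : {ffun 'I_n -> 'I_D.+1} := [ffun i : 'I_n => inord (be i)].
have e : mon A n (ext h0) = mon A n be.
  have : forall i, (i < n)%N -> ext h0 i = be i.
    by move=> i lt; rewrite (ext_ord h0 (Ordinal lt)) ffunE inordK// ltnS bD.
  move: (ext h0) => be'; elim: (n) => //= m IH H; rewrite H// IH// => i lt.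
  by apply: H; apply: ltnW.
exists (fun h => if h == h0 then a else 0).
rewrite (bigD1 h0) //= eqxx e big1 ?addr0// => h /negPf ->.
by rewrite rmorph0 mul0r.
Qed.

Lemma mon_basis n D : #|{ffun 'I_n -> 'I_D.+1}| = (D.+1 ^ n)%N.
Proof. by rewrite card_ffun !card_ord. Qed.

End Monomials.

(** * Noether normalization and growth *)

Section Normalization.
Context (k : fieldType).

(** Noether normalization of the image of [g], with the parameters [y] and the module generators [b]
    lifted to [iterpoly k N]. *)
Definition normalizes N (E : comNzRingType) (g : {rmorphism iterpoly k N -> E})
    d (y : nat -> iterpoly k N) (J : finType) (b : J -> iterpoly k N) :=
  indep (iterpolyC k N) (fun p => g p = 0) y d /\
  forall p, exists a : J -> iterpoly k d, g p = \sum_j g (ev (iterpolyC k N) y d (a j) * b j).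

(** A nonzero [F] in the kernel becomes monic up to a constant in the last variable after a Nagata
    substitution. Division by it leaves finitely many powers of that variable as module generators
    over a ring in one variable fewer. *)
Theorem noether_normalization N (E : comNzRingType) (g : {rmorphism iterpoly k N -> E}) :
  exists d y (J : finType) (b : J -> iterpoly k N), normalizes g d y b.
Proof.
elim: N E g => [|N IH] E g.
  exists 0%N, (fun _ => 0), unit, (fun _ => 1); split.
    move=> p /= /eqP; apply: contraTeq => p0; apply/negP => /eqP gp.
    by have := oner_neq0 E; rewrite -(rmorph1 g) -(mulfV p0) rmorphM gp mul0r eqxx.
  by move=> p; exists (fun _ => p); rewrite (big_pred1 tt) ?mulr1//; case.
have [inj|ninj] := pselect (forall p, g p = 0 -> p = 0).
  exists N.+1, (iterpolyX k N.+1), unit, (fun _ => 1); split=> [p|p].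
    by rewrite ev_id; apply: inj.
  by exists (fun _ => p); rewrite (big_pred1 tt) ?ev_id ?mulr1//; case.
have [F [gF F0]] : exists F, g F = 0 /\ F != 0.
  by move/existsNP: ninj => [F /not_implyP[gF /eqP F0]]; exists F.
have [D dF] := dle_exists F.
pose sg := nagata k N D.+1.
have lc : lead_const (sg false F) by apply: nagata_lead.
pose g' := (g \o sg true : {rmorphism iterpoly k N.+1 -> E}).
pose ta := (sg true \o @polyC (iterpoly k N) : {rmorphism iterpoly k N -> iterpoly k N.+1}).
have [d [y [J [b [yi yb]]]]] := IH E (g \o ta : {rmorphism _ -> _}).
have taev a : ta (ev (iterpolyC k N) y d a) = ev (iterpolyC k N.+1) (ta \o y) d a.
  by apply: ev_comp => // c; rewrite /ta /= /sg /nagata (evC _ _ N.+1).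
pose de := size (sg false F : {poly iterpoly k N}).
exists d, (ta \o y), (J * 'I_de)%type, (fun ji : J * 'I_de => ta (b ji.1) * sg true ('X^(ji.2) : {poly iterpoly k N})).
split=> [p|p]; first by rewrite -taev; apply: yi.
have [q [r [pE sr]]] := lead_const_div (sg false p : {poly iterpoly k N}) lc.
have [a Ha] := choice (fun i => yb (r`_i)).
exists (fun ji : J * 'I_de => a (ji.2 : 'I_de) ji.1).
have -> : g p = g' r.
  have -> : g p = g' (sg false p) by rewrite /g' /= (nagataK D.+1 false).
  by rewrite pE rmorphD rmorphM /g' /= (nagataK D.+1 false) gF mul0r add0r.
rewrite (poly_sumE (ltnW sr)) rmorph_sum.
rewrite -(pair_big xpredT xpredT (fun j i => g (ev (iterpolyC k N.+1) (ta \o y) d (a (i : 'I__) j) *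
    (ta (b j) * sg true ('X^i : {poly iterpoly k N}))))) exchange_big /=.
apply: eq_bigr => i _; rewrite !rmorphM.
have -> : g (sg true ((r`_i)%:P : {poly iterpoly k N})) = \sum_j g (ta (ev (iterpolyC k N) y d (a i j) * b j)) by rewrite -Ha.
rewrite mulr_suml; apply: eq_bigr => j _.
by rewrite rmorphM taev !rmorphM mulrA.
Qed.

(* Counting monomials: those of box degree at most [s] in [u], times the [bs i], lie, up to a
   common denominator, in the span of the [b j] over the polynomials in [y] of degree linear
   in [s]. *)
Section Growth.
Context (N : nat) (K : fieldType) (g : {rmorphism iterpoly k N -> K}).
Context (d : nat) (y : nat -> iterpoly k N) (J : finType) (b : J -> iterpoly k N).
Hypothesis nn : normalizes g d y b.
Let ka : {rmorphism k -> K} := (g \o iterpolyC k N : {rmorphism k -> K}).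

Let Gr D x := exists al : J -> iterpoly k d, (forall l, dle D (al l)) /\
  x = \sum_l g (ev (iterpolyC k N) y d (al l) * b l).

Let Gr_any (I : finType) (p : I -> iterpoly k N) : exists D, forall i, Gr D (g (p i)).
Proof.
have [a Ha] := choice (fun i => nn.2 (p i)).
have [D HD] := dle_exists_fin (fun ij : I * J => a ij.1 ij.2).
by exists D => i; exists (a i); split=> // j; apply: (HD (i, j)).
Qed.

Let Gr_sum D (I : Type) (r : seq I) F : (forall i, Gr D (F i)) -> Gr D (\sum_(i <- r) F i).
Proof.
move=> H; apply: big_ind => [|u v [a [da ->]] [a' [da' ->]]|//].
  by exists (fun _ => 0); split=> [l|]; [apply: dle0|rewrite big1// => l _; rewrite rmorph0 mul0r rmorph0].
exists (fun l => a l + a' l); split=> [l|]; first exact: dleD.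
by rewrite -big_split; apply: eq_bigr => l _; rewrite rmorphD mulrDl rmorphD.
Qed.

Let Gr_mul D c p x : (forall j, Gr c (g (p * b j))) -> Gr D x -> Gr (D + c) (g p * x).
Proof.
move=> Hp [al [dal ->]]; rewrite mulr_sumr; apply: Gr_sum => l.
have [be [dbe e]] := Hp l.
exists (fun l' => al l * be l'); split=> [l'|]; first exact: dleM.
rewrite -rmorphM mulrCA rmorphM e mulr_sumr; apply: eq_bigr => l' _.
by rewrite -[LHS]rmorphM (rmorphM (ev _ _ _)) mulrA.
Qed.

(** The order of the constants matters: [cu] depends on [u] alone, [cb] also on [bs]. Multiplication
    by a numerator or by the denominator of the [u i] raises the degree in [y] by at most [cu],
    whereas the [bs i] cost [cb] only once. *)
Lemma growth m (u : nat -> K) :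
  (forall i, (i < m)%N -> exists a w, g w != 0 /\ u i * g w = g a) ->
  exists cu, forall n (bs : 'I_n -> K),
  (forall i, exists a w, g w != 0 /\ bs i * g w = g a) ->
  (forall Q : 'I_n -> iterpoly k m, \sum_i ev ka u m (Q i) * bs i = 0 -> forall i, Q i = 0) ->
  exists cb, forall s, (n * s.+1 ^ m <= #|J| * (cu * (m * s) + cb).+1 ^ d)%N.
Proof.
move=> Hu.
have [w [a [w0 Ha]]] := @clear_denom (iterpoly k N) K g 'I_m (fun i => u i)
  (rmorph0 _) (rmorph1 _) (rmorphM _) (fun i => Hu _ (ltn_ord i)).
pose el (oi : option 'I_m) := if oi is Some i then a i else w.
have [cu Hcu] := Gr_any (fun oj : option 'I_m * J => el oj.1 * b oj.2).
have Gr_pow o j E x : Gr E x -> Gr (E + cu * j) (g (el o) ^+ j * x).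
  move=> Gx; elim: j => [|j IH]; first by rewrite muln0 addn0 mul1r.
  rewrite exprS -mulrA mulnS addnCA addnC; apply: Gr_mul IH => l.
  exact: (Hcu (o, l)).
exists cu => n bs Hbs ind.
have [w' [a' [w'0 Ha']]] := @clear_denom (iterpoly k N) K g 'I_n bs
  (rmorph0 _) (rmorph1 _) (rmorphM _) Hbs.
have [cb Hcb] := Gr_any a'.
exists cb => s; rewrite leqNgt; apply/negP => lt.
pose D := (cu * (m * s) + cb)%N; rewrite -/D in lt.
(* A monomial of box degree [s] in [m] variables has at most [m * s] factors, each with denominator
   [w]; spare factors [w] pad it, so that all products obey the same degree bound. *)
pose W := g w ^+ (m * s) * g w'.
have W0 : W != 0 by rewrite mulf_neq0 ?expf_neq0.
pose H := {ffun 'I_m -> 'I_s.+1}.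
pose X (hi : H * 'I_n) := W * (ev ka u m (mon k m (ext hi.1)) * bs hi.2).
have GrX hi : Gr D (X hi).
  have -> : X hi = \prod_(t < m) (g (a t) ^+ hi.1 t * g w ^+ (s - hi.1 t)) * g (a' hi.2).
    have Ew : g w ^+ (m * s) = \prod_(t < m) g w ^+ s by rewrite prodr_const card_ord -exprM mulnC.
    rewrite /X /W ev_mon -Ha' Ew mulrACA; congr (_ * _); last by rewrite mulrC.
    rewrite -big_split /=; apply: eq_bigr => t _; rewrite ext_ord -Ha exprMn -mulrA -exprD.
    by rewrite subnKC -1?ltnS// mulrC.
  have : forall r : seq 'I_m, Gr (cb + cu * (size r * s))
      (\prod_(t <- r) (g (a t) ^+ hi.1 t * g w ^+ (s - hi.1 t)) * g (a' hi.2)).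
    elim=> [|t r IH]; first by rewrite big_nil mul1r muln0 addn0.
    rewrite big_cons -!mulrA.
    have -> : (cb + cu * (size (t :: r) * s) =
        cb + cu * (size r * s) + cu * (s - hi.1 t) + cu * hi.1 t)%N.
      rewrite -!addnA -!mulnDr; congr (_ + _ * _)%N.
      by rewrite subnK -1?ltnS//= mulSn addnC.
    by apply: (Gr_pow (Some t)); apply: (Gr_pow None).
  move=> /(_ (index_enum _)); rewrite /D addnC.
  rewrite -(card_uniqP (index_enum_uniq _)) (@eq_card _ _ 'I_m) ?card_ord// => i.
  exact: mem_index_enum.
have [al Hal] := choice GrX.
have [c Hc] := choice (fun hil : (H * 'I_n) * J => dle_span ((Hal hil.1).1 hil.2)).
pose H' := {ffun 'I_d -> 'I_D.+1}.
have ltc : (#|{: J * H'}| < #|{: H * 'I_n}|)%N.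
  by rewrite !card_prod !card_ffun !card_ord [X in (_ < X)%N]mulnC.
(* There would be more products than available coordinates, hence a nontrivial relation over [k],
   which independence excludes. *)
have [z [[hi0 z0] Hz]] := lin_dep (fun hi (lh : J * H') => c (hi, lh.1) lh.2) ltc.
pose Q i := \sum_h iterpolyC k m (z (h, i)) * mon k m (ext h).
suff Q0 i : Q i = 0 by move: z0; case: hi0 => h i; rewrite (mon_indep (Q0 i)) eqxx.
apply: ind; apply: (mulfI W0); rewrite mulr0.
transitivity (\sum_hi ka (z hi) * X hi).
  transitivity (\sum_i \sum_h ka (z (h, i)) * X (h, i)).
    rewrite mulr_sumr; apply: eq_bigr => i' _.
    rewrite /Q rmorph_sum mulr_suml mulr_sumr; apply: eq_bigr => h _.
    by rewrite rmorphM evC /X; ring.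
  by rewrite exchange_big pair_bigA /=; apply: eq_bigr => -[].
transitivity (\sum_l g (ev (iterpolyC k N) y d (\sum_hi iterpolyC k d (z hi) * al hi l) * b l)).
  under eq_bigr do rewrite (Hal _).2 mulr_sumr.
  rewrite exchange_big; apply: eq_bigr => l _.
  rewrite rmorph_sum mulr_suml rmorph_sum; apply: eq_bigr => hi _.
  by rewrite (rmorphM (ev _ _ _)) evC -mulrA [RHS]rmorphM.
rewrite big1// => l _.
have -> : \sum_hi iterpolyC k d (z hi) * al hi l =
    \sum_h' iterpolyC k d (\sum_hi z hi * c (hi, l) h') * mon k d (ext h').
  under [RHS]eq_bigr do rewrite rmorph_sum mulr_suml.
  rewrite exchange_big; apply: eq_bigr => hi _.
  rewrite (Hc (hi, l)) mulr_sumr; apply: eq_bigr => h' _.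
  by rewrite mulrA rmorphM.
rewrite big1 ?rmorph0 ?mul0r ?rmorph0// => h' _.
by have /= -> := Hz (l, h'); rewrite rmorph0 mul0r.
Qed.

End Growth.
End Normalization.

(** * Residue fields *)

Section PackPrime.
Context (R : idomainType) (q : R -> Prop) (qP : is_prime q).
Definition prime_set : {pred R} := [pred x | `[< q x >]].

Fact prime_set_idealr : idealr_closed prime_set.
Proof.
have [[q0 qD qM] q1 _] := qP; split=> [||a x y].
- exact/asboolP.
- by apply/negP => /asboolP.
- by move=> /asboolP qx /asboolP qy; apply/asboolP/qD => //; apply: qM.
Qed.
HB.instance Definition _ := isIdealr.Build R prime_set prime_set_idealr.

Fact prime_set_prime : prime_idealr_closed prime_set.
Proof.
by have [_ _ qM] := qP; move=> x y /asboolP/qM [] ?; apply/orP; [left|right]; apply/asboolP.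
Qed.
HB.instance Definition _ := isPrimeIdealrClosed.Build R prime_set prime_set_prime.

Lemma pack_prime : exists p : prime_idealr R, forall x, x \in p <-> q x.
Proof. by exists prime_set => x; split=> [/asboolP|/asboolP]. Qed.

End PackPrime.

Section ResidueField.
Context (R : idomainType) (p : prime_idealr R).

Fact frac_in_loc (x : R) : x%:F \in loc_pred p.
Proof. by apply/asboolP; exists x, 1; split; [rewrite idealr1 | rewrite rmorph1 divr1]. Qed.

Definition to_loc (x : R) : loc p := Loc (frac_in_loc x).

Fact to_loc_zmod : zmod_morphism to_loc.
Proof. by move=> x y; apply: val_inj; rewrite /= rmorphB. Qed.
Fact to_loc_monoid : monoid_morphism to_loc.
Proof. by split=> [|x y]; apply: val_inj; rewrite /= ?rmorph1 ?rmorphM. Qed.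
HB.instance Definition _ := GRing.isZmodMorphism.Build R (loc p) to_loc to_loc_zmod.
HB.instance Definition _ := GRing.isMonoidMorphism.Build R (loc p) to_loc to_loc_monoid.

Definition to_kappa : {rmorphism R -> kappa p} :=
  (\pi_(kappa p) \o to_loc : {rmorphism R -> kappa p}).

Lemma to_kappa_eq0 x : to_kappa x = 0 <-> x \in p.
Proof.
have E : (to_kappa x = 0) <-> (to_loc x \in loc_max p).
  rewrite /to_kappa /= -(rmorph0 \pi_(kappa p)); split=> [/eqP|H].
    by rewrite -Quotient.idealrBE subr0.
  by apply/eqP; rewrite -Quotient.idealrBE subr0.
rewrite E; split=> [/asboolP[a [b [ap bp /= e]]]|xp].
  have b0 : b%:F != 0 by rewrite tofrac_eq0; apply: contraNneq bp => ->; exact: idealr0.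
  have xb : x * b = a.
    by apply/eqP; rewrite -tofrac_eq rmorphM; apply/eqP; rewrite /= e divfK.
  by have := ap; rewrite -xb prime_idealrM (negPf bp) orbF.
by apply/asboolP; exists x, 1; rewrite idealr1 rmorph1 divr1.
Qed.

End ResidueField.

Lemma prime_residue_field (R : idomainType) (q : R -> Prop) : is_prime q ->
  exists (E : fieldType) (g : {rmorphism R -> E}), forall x, g x = 0 <-> q x.
Proof.
move=> /pack_prime[p pq]; exists (kappa p), (to_kappa p) => x.
by rewrite to_kappa_eq0.
Qed.

(** * Chains of prime ideals *)

Lemma leq_expn2r a b e : (a <= b -> a ^ e <= b ^ e)%N.
Proof. by case: e => // e ab; rewrite leq_exp2r. Qed.

(** * Transcendence degree and rank by counting monomials *)

Section GrowthBounds.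
Context (k : fieldType) (N : nat) (K : fieldType) (g : {rmorphism iterpoly k N -> K}).
Context (d : nat) (y : nat -> iterpoly k N) (J : finType) (b : J -> iterpoly k N).
Hypothesis nn : normalizes g d y b.
Let ka : {rmorphism k -> K} := (g \o iterpolyC k N : {rmorphism k -> K}).

(** With [d.+1] independent elements and [bs = 1], [growth] would bound [s.+1 ^ d.+1] by a constant
    times [s.+1 ^ d]. *)
Lemma indep_size_le m (u : nat -> K) :
  (forall i, (i < m)%N -> exists a w, g w != 0 /\ u i * g w = g a) ->
  indep ka (fun x => x = 0) u m -> (m <= d)%N.
Proof.
move=> Hu ind; rewrite leqNgt; apply/negP => dm.
have [|cu Hcu] := @growth k N K g d y J b nn d.+1 u.
  by move=> i lt; apply: Hu; apply: leq_trans lt dm.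
have [_||cb Hcb] := Hcu 1%N (fun _ => 1).
- by exists 1, 1; rewrite rmorph1 oner_neq0 mul1r.
- move=> Q; rewrite big_ord1 mulr1 => H i; rewrite (ord1 i).
  exact: (indep_le dm ind).
pose c := (cu * d.+1 + cb.+1)%N; pose s := (#|J| * c ^ d)%N.
(* As [(cu * (d.+1 * s) + cb).+1 <= c * s.+1], the inequality would give [s.+1 <= #|J| * c ^ d], and
   the right side is [s]. *)
have := Hcb s; rewrite mul1n leqNgt => /negP; apply.
rewrite expnS; apply: (@leq_ltn_trans (#|J| * (c * s.+1) ^ d)).
  rewrite leq_mul2l leq_expn2r ?orbT// /c -addnS mulnDl mulnA.
  by apply: leq_add; [rewrite leq_mul2l leqnSn orbT | rewrite leq_pmulr].
by rewrite expnMn mulnA ltn_pmul2r ?expn_gt0// -/s.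
Qed.

(** Both sides of [growth] now have order [s ^ d]. At [s = cb] a factor [cb.+1 ^ d] cancels, and the
    resulting bound on [n] does not depend on [bs]. *)
Lemma jindep_bounded (u : nat -> K) :
  (forall i, (i < d)%N -> exists a w, g w != 0 /\ u i * g w = g a) ->
  exists B, forall n (bs : 'I_n -> K),
    (forall i, exists a w, g w != 0 /\ bs i * g w = g a) ->
    (forall Q : 'I_n -> iterpoly k d, \sum_i ev ka u d (Q i) * bs i = 0 -> forall i, Q i = 0) ->
    (n <= B)%N.
Proof.
move=> Hu; have [cu Hcu] := growth nn Hu.
exists (#|J| * (cu * d).+1 ^ d)%N => n bs Hbs ind.
have [cb Hcb] := Hcu n bs Hbs ind.
have := Hcb cb; rewrite -(@leq_pmul2r (cb.+1 ^ d) n); last by rewrite expn_gt0.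
move=> H; apply: (leq_trans H); rewrite -mulnA -expnMn leq_mul2l leq_expn2r ?orbT//; nia.
Qed.

End GrowthBounds.

Lemma lead_const_exp (k : fieldType) n (p : {poly iterpoly k n}) i :
  lead_const p -> lead_const (p ^+ i).
Proof.
move=> [c [c0 lc]]; exists (c ^+ i); rewrite expf_neq0//; split=> //.
by rewrite lead_coef_exp lc rmorphXn.
Qed.

(** Divide [ga] by [D] with remainder. Multiplication by [al], constant in the last variable, does
    not raise the degree of the remainder there, so a nonzero remainder could not yield a multiple
    of [D]. *)
Lemma lead_const_dvd (k : fieldType) n (D al ga de : {poly iterpoly k n}) : lead_const D ->
  al != 0 -> (size al <= 1)%N -> al * ga = D * de -> exists ta, ga = D * ta.
Proof.
move=> lcD al0 sal E; have [q [r [gE sr]]] := lead_const_div ga lcD.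
exists q; suff r0 : r = 0 by rewrite gE r0 addr0.
have D0 : D != 0 by have [c [c0 lc]] := lcD; rewrite -lead_coef_eq0 lc fmorph_eq0.
have Er : al * r = D * (de - al * q) by rewrite mulrBr -E gE; ring.
apply/eqP; apply: contraT => r0.
have x0 : de - al * q != 0.
  by apply: contraNneq (mulf_neq0 al0 r0) => x0; rewrite Er x0 mulr0.
have := congr1 (fun p : {poly iterpoly k n} => size p) Er; rewrite !size_mul// => e.
have s1 : size al = 1%N by apply/eqP; rewrite eqn_leq sal size_poly_gt0.
move: sr; rewrite ltnNge; case/negP; move: e; rewrite s1 add1n /= => ->.
by rewrite -subn1 -addnBA ?leq_addr// size_poly_gt0.
Qed.

(* A form of Krull's principal ideal theorem.  After a change of variables there is [f] in [p]
   which is monic in the last variable of the Noether normalization [k[y]].  If [al r = f s] modulo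
   [q0], with [al] nonzero and free of that variable, then [f ^ m] divides [C * r ^ m] for all
   [m], so [r] is in [p], because the ring is Noetherian.  Hence some prime between [(f) + q0]
   and [p] meets [k[y]], with the last variable omitted, trivially. *)
Section PrimeStep.
Context (k : fieldType) (N : nat) (q0 p : iterpoly k N -> Prop).
Hypothesis (q0P : is_prime q0) (pP : is_prime p) (q0p : forall x, q0 x -> p x).
Let P := iterpoly k N.
Let ev' := ev (iterpolyC k N).

(** Since [f0] is outside the prime [q0], powers of the last variable can be removed from [F] until
    its constant term [c] in that variable is nonzero. Then [c] at [y] is a multiple of [f0] modulo
    [q0], hence lies in [p]. *)
Let relation d (y : nat -> P) f0 (F : iterpoly k d.+1) : p f0 -> ~ q0 f0 -> F != 0 ->
  q0 (ev' (fun i => if (i < d)%N then y i else f0) d.+1 F) ->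
  exists a : iterpoly k d, a != 0 /\ p (ev' y d a).
Proof.
move=> pf nqf; have [[p0 pD pM] _ _] := pP; have [_ _ qprime] := q0P.
set x' := fun i => _.
have evx (c : iterpoly k d) : ev' x' d.+1 (c%:P : {poly iterpoly k d}) = ev' y d c.
  by rewrite /ev' ev_polyC; apply: eq_ev => i lt; rewrite /x' lt.
elim/(@poly_ind (iterpoly k d)): F => [|F c IH]; first by rewrite eqxx.
have evX : ev' x' d.+1 ('X : {poly iterpoly k d}) = f0 by rewrite /ev' ev_polyX /x' ltnn.
rewrite rmorphD rmorphM evx evX => nz qF.
have [c0|c0] := eqVneq c 0; last first.
  exists c; split=> //.
  have -> : ev' y d c = (ev' x' d.+1 F * f0 + ev' y d c) + (- ev' x' d.+1 F) * f0 by ring.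
  by apply: pD; [apply: q0p|apply: pM].
apply: IH; first by apply: contraNneq nz => ->; rewrite c0 mul0r addr0.
by move: qF; rewrite c0 rmorph0 addr0 => /qprime[].
Qed.

Lemma prime_step f0 n (x : nat -> P) : p f0 -> ~ q0 f0 -> indep (iterpolyC k N) q0 x n.+1 ->
  exists q, [/\ is_prime q, forall x, q0 x -> q x, forall x, q x -> p x,
    exists f, q f /\ ~ q0 f & exists y, indep (iterpolyC k N) q y n].
Proof.
move=> pf0 nqf0 indx.
have [E [g gq]] := prime_residue_field q0P.
have [d [y0 [J [b nn]]]] := noether_normalization g.
have [pid p1 pprime] := pP; have [p0 pD pM] := pid.
have fr (z : P) : exists a w, g w != 0 /\ g z * g w = g a.
  by exists z, 1; rewrite rmorph1 oner_neq0 mulr1.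
have evg (z : nat -> P) m Q : ev (g \o iterpolyC k N : {rmorphism _ -> _}) (g \o z) m Q = g (ev' z m Q).
  by rewrite (ev_comp (h := (g \o iterpolyC k N : {rmorphism _ -> _})) (y := g \o z)).
have nd : (n.+1 <= d)%N.
  apply: (indep_size_le nn (u := g \o x)) => [i _|Q]; first exact: fr.
  by rewrite evg => /gq /indx.
have [a0 [a00 pa0]] : exists a : iterpoly k d, a != 0 /\ p (ev' y0 d a).
  pose x' i := if (i < d)%N then y0 i else f0.
  have [F [qF F0]] : exists F : iterpoly k d.+1, g (ev' x' d.+1 F) = 0 /\ F != 0.
    apply: contrapT => H; have : (d.+1 <= d)%N; last by rewrite ltnn.
    apply: (indep_size_le nn (u := g \o x')) => [i _|Q]; first exact: fr.
    rewrite evg => gQ; apply/eqP; apply: contrapT => /negP Q0.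
    by apply: H; exists Q.
  by apply: (@relation d y0 f0 F) => //; apply/gq.
case: d nn nd a0 a00 pa0 => // e nn nd a0 a00 pa0.
have [D da0] := dle_exists a0.
pose sg := nagata k e D.+1.
pose a : {poly iterpoly k e} := sg false a0.
have lca : lead_const a by apply: nagata_lead.
pose y i := ev' y0 e.+1 (sg true (iterpolyX k e.+1 i)).
have yE (c : iterpoly k e.+1) : ev' y e.+1 c = ev' y0 e.+1 (sg true c).
  rewrite -{2}[c]ev_id; apply/esym; pose h : {rmorphism _ -> _} := (ev' y0 e.+1 \o sg true : {rmorphism iterpoly k e.+1 -> P}).
  apply: (ev_comp (g := h)) => // c'.
  by rewrite /h /= /sg /nagata (evC _ _ e.+1) /ev' (evC _ _ e.+1).
have indy c : g (ev' y e.+1 c) = 0 -> c = 0.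
  rewrite yE => /nn.1 sc; rewrite -[c](nagataK D.+1 true) -/(sg true) sc; exact: rmorph0.
have spany z : exists al : J -> iterpoly k e.+1, g z = \sum_j g (ev' y e.+1 (al j) * b j).
  have [al Hal] := nn.2 z; exists (fun j => sg false (al j)); rewrite Hal.
  by apply: eq_bigr => j _; rewrite yE /sg (nagataK D.+1 false).
pose f := ev' y e.+1 a.
have pf : p f by rewrite /f yE /a /sg (nagataK D.+1 false).
have a_neq0 : a != 0 by have [c [c0 lc]] := lca; rewrite -lead_coef_eq0 lc fmorph_eq0.
have gf0 : g f != 0.
  by apply/eqP => /indy a0'; move: a_neq0; rewrite a0' eqxx.
clear nn yE pa0.
pose comb (al : J -> iterpoly k e.+1) := \sum_j g (ev' y e.+1 (al j) * b j).
(* [S] will be a maximal subfamily of [b] free over the polynomials in [y]. A common denominator [C]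
   brings every element into the free module on [S], where divisibility can be tested
   coordinatewise. *)
pose free (S : {set J}) := `[< forall al, (forall j, j \notin S -> al j = 0) -> comb al = 0 -> forall j, al j = 0 >].
have [S /maxsetP[/asboolP freeS maxS]] : {S | maxset free S}.
  by apply: ex_maxset; exists finset.set0; apply/asboolP => al H _ j; apply: H; rewrite inE.
have cden j : exists c be, [/\ c != 0, (forall i, i \notin S -> be i = 0) &
    g (ev' y e.+1 c * b j) = comb be].
  have [jS|jS] := boolP (j \in S).
    exists 1, (fun i => if i == j then 1 else 0); split; first exact: oner_neq0.
      by move=> i; case: eqP => // ->; rewrite jS.
    rewrite /comb (bigD1 j) //= eqxx big1 ?addr0// => i /negPf ->.
    by rewrite rmorph0 mul0r rmorph0.
  have nf : ~ free (j |: S).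
    by move=> /maxS /(_ (finset.subsetUr _ _)) E'; rewrite -E' inE finset.set11 in jS.
  have [al [supp c0 [i ali]]] : exists al, [/\ forall i, i \notin j |: S -> al i = 0, comb al = 0 & exists i, al i <> 0].
    apply: contrapT => H; apply: nf; apply/asboolP => al supp c0 i.
    by apply: contrapT => ali; apply: H; exists al; split=> //; exists i.
  exists (al j), (fun i => if i == j then 0 else - al i); split.
  - apply/eqP => alj; apply: ali; apply: freeS c0 _ => l lS.
    by have [->//|lj] := eqVneq l j; apply: supp; rewrite !inE negb_or lj.
  - by move=> l lS; case: eqP => // /eqP lj; rewrite supp ?oppr0// !inE negb_or lj.
  rewrite /comb (bigD1 j) //= eqxx rmorph0 mul0r rmorph0 add0r.
  move: c0; rewrite /comb (bigD1 j) //= => /eqP; rewrite addr_eq0 => /eqP ->.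
  rewrite -sumrN; apply: eq_bigr => l /negPf ->.
  by rewrite rmorphN mulNr rmorphN.
have [c Hc] := choice cden; have {Hc} [be Hc] := choice Hc.
pose C := \prod_j c j.
have C0 : C != 0 by apply/prodf_neq0 => j _; have [] := Hc j.
have gC0 : g (ev' y e.+1 C) != 0 by apply/eqP => /indy C0'; move: C0; rewrite C0' eqxx.
have combC z : exists ga, (forall i, i \notin S -> ga i = 0) /\ g (ev' y e.+1 C * z) = comb ga.
  have [al Hal] := spany z.
  exists (fun i => \sum_j (\prod_(l | l != j) c l) * al j * be j i); split.
    by move=> i iS; rewrite big1// => j _; have [_ -> //] := Hc j; rewrite mulr0.
  rewrite rmorphM Hal mulr_sumr /comb.
  under [RHS]eq_bigr do rewrite rmorph_sum mulr_suml rmorph_sum.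
  rewrite exchange_big; apply: eq_bigr => j _.
  have [_ _] := Hc j; rewrite (rmorphM g) => Hj.
  rewrite /C (bigD1 j) //= !rmorphM /=.
  have -> : forall u v w z : E, u * v * (w * z) = v * w * (u * z) by move=> *; ring.
  rewrite Hj /comb mulr_sumr; apply: eq_bigr => i _.
  by rewrite !rmorphM; ring.
have key al r s : al != 0 -> g (ev' y e.+1 (al%:P : {poly iterpoly k e}) * r) = g (f * s) -> p r.
  move=> al0 ars.
  (* Raise the relation to the power [m], multiply by [C] and compare coordinates on [S]: as [al] is
     free of the last variable, [a ^+ m] divides each coordinate of [C * r ^+ m] by
     [lead_const_dvd]. *)
  have tauP m : exists ta, g (ev' y e.+1 C * r ^+ m) = g (f ^+ m * ta).
    have [ga [gaS Hga]] := combC (r ^+ m); have [de [deS Hde]] := combC (s ^+ m).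
    have E1 : forall j, (al%:P ^+ m * ga j - a ^+ m * de j) = 0 :> {poly iterpoly k e}.
      apply: freeS => [j jS|]; first by rewrite gaS// deS// !mulr0 subr0.
      have -> : comb (fun j => al%:P ^+ m * ga j - a ^+ m * de j) =
          g (ev' y e.+1 (al%:P ^+ m : {poly iterpoly k e})) * comb ga - g (ev' y e.+1 (a ^+ m)) * comb de.
        rewrite /comb !mulr_sumr -sumrB; apply: eq_bigr => j _.
        by rewrite !rmorphM rmorphB !rmorphM rmorphB !rmorphM /= ; ring.
      rewrite -Hga -Hde !rmorphXn /= !rmorphM !rmorphXn /=.
      have := congr1 (fun u => u ^+ m) ars; rewrite !rmorphM !exprMn => H.
      by rewrite mulrCA H /f; ring.
    have dvd j : exists ta, ga j = a ^+ m * ta :> {poly iterpoly k e}.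
      apply: (@lead_const_dvd _ _ (a ^+ m) (al%:P ^+ m) (ga j) (de j)).
      - exact: lead_const_exp.
      - by rewrite expf_neq0// polyC_eq0.
      - by rewrite -polyC_exp size_polyC_leq1.
      by apply/eqP; rewrite -subr_eq0 E1.
    have [ta Hta] := choice dvd.
    exists (\sum_j ev' y e.+1 (ta j) * b j).
    rewrite Hga /comb rmorphM rmorph_sum mulr_sumr; apply: eq_bigr => j _.
    by rewrite Hta !rmorphM !rmorphXn /= -!rmorphXn mulrA.
  have [ta Hta] := choice tauP.
  (* If [ta m] is the sum of the [rho i * ta i] with [i < m], then modulo [q0] one has [C * r ^+ m =
     C * \sum_i rho i * f ^+ (m - i) * r ^+ i]. Cancelling [C] puts [r ^+ m] in [p], since every
     [m - i] is positive. *)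
  have [m [rho Hm]] := noeth_chain ta (@noeth_ip k N (@noeth_field k)).
  have gr : g (r ^+ m) = g (\sum_i rho i * (f ^+ (m - i) * r ^+ i)).
    apply: (mulfI gC0); rewrite -rmorphM Hta Hm rmorphM !rmorph_sum !mulr_sumr.
    apply: eq_bigr => i _; rewrite !rmorphM /=.
    have -> : forall u v w z : E, u * (v * (w * z)) = v * w * (u * z) by move=> *; ring.
    have := Hta i; rewrite (rmorphM g (ev' y e.+1 C)) => ->; have -> : f ^+ m = f ^+ (m - i) * f ^+ i by rewrite -exprD subnK// ltnW.
    rewrite !rmorphM.
    by ring.
  have : q0 (r ^+ m - \sum_i rho i * (f ^+ (m - i) * r ^+ i)).
    by apply/gq; rewrite rmorphB gr subrr.
  move/q0p => H; apply: (@prime_exp _ p _ m) => //.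
  rewrite -[r ^+ m](subrK (\sum_i rho i * (f ^+ (m - i) * r ^+ i))); apply: pD => //.
  apply: ideal_sum => // i _; apply: (pM); rewrite mulrC; apply: (pM).
  case: (m - i)%N (subn_gt0 i m) => [|l _]; first by rewrite ltn_ord.
  by rewrite exprSr; apply: pM.
pose I0 z := exists s, q0 (z - f * s).
(* The case [al = 1] keeps a prime disjoint from [M] inside [p]; the case [r = 1] keeps the first
   [e] of the [y i] independent modulo it. *)
pose M z := exists al r, [/\ al != 0, ~ p r & z = ev' y e.+1 (al%:P : {poly iterpoly k e}) * r].
have [[q00 q0D q0M] q01 _] := q0P.
have [||||q [qP qI qM]] := @exists_prime _ I0 M.
- split=> [|u v [s Hs] [t Ht]|u v [s Hs]].
  + by exists 0; rewrite mulr0 subr0.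
  + exists (s + t).
    have -> : u + v - f * (s + t) = (u - f * s) + (v - f * t) by ring.
    exact: q0D.
  + exists (u * s).
    have -> : u * v - f * (u * s) = u * (v - f * s) by ring.
    exact: q0M.
- by exists 1, 1; rewrite oner_neq0 polyC1 rmorph1 mulr1.
- move=> _ _ [al [r [al0 pr ->]]] [al' [r' [al'0 pr' ->]]].
  exists (al * al'), (r * r'); split; [exact: mulf_neq0|by move/pprime => []|].
  by rewrite polyCM rmorphM; ring.
- move=> z [s Hs] [al [r [al0 pr zE]]]; apply: pr; apply: (key al r s) => //.
  by apply/eqP; rewrite -subr_eq0 -rmorphB -zE; apply/eqP/gq.
exists q; split=> //.
- by move=> z qz; apply: qI; exists 0; rewrite mulr0 subr0.
- move=> z qz; apply: contrapT => npz; apply: (qM z qz).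
  by exists 1, z; rewrite oner_neq0 polyC1 rmorph1 mul1r.
- exists f; split; first by apply: qI; exists 1; rewrite mulr1 subrr.
  by move/gq/eqP; rewrite (negPf gf0).
- exists y; apply: (@indep_le _ _ _ _ _ e) => // al qal.
  apply/eqP; apply: contraT => al0; case: (qM _ qal).
  by exists al, 1; rewrite mulr1 /ev' ev_polyC.
Qed.

End PrimeStep.

(** Each [prime_step] costs one independent element. As long as more than [t] remain, the current
    prime differs from [p], modulo which there are at most [t], and a further step is possible. *)
Lemma prime_chain (k : fieldType) N t m (q0 p : iterpoly k N -> Prop) :
  is_prime q0 -> is_prime p -> (forall x, q0 x -> p x) ->
  (exists x, indep (iterpolyC k N) q0 x (t + m)) -> ~ (exists x, indep (iterpolyC k N) p x t.+1) ->
  exists c : nat -> iterpoly k N -> Prop, [/\ forall i, is_prime (c i),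
    forall x, q0 x -> c 0%N x, c m = p &
    forall i, (i < m)%N -> (forall x, c i x -> c i.+1 x) /\ exists x, c i.+1 x /\ ~ c i x].
Proof.
elim: m q0 => [|m IH] q0 q0P pP q0p [x ix] np; first by exists (fun _ => p).
have [f [pf nqf]] : exists f, p f /\ ~ q0 f.
  apply: contrapT => H; apply: np; exists x.
  have pq z : p z -> q0 z by move=> pz; apply: contrapT => nq; apply: H; exists z.
  move=> Q /pq; apply: (indep_le _ ix); by rewrite addnS ltnS leq_addr.
rewrite addnS in ix.
have [q [qP q0q qp [h [qh nqh]] iq]] := prime_step q0P pP q0p pf nqf ix.
have [c [cP c0 cm cS]] := IH q qP pP qp iq np.
exists (fun i => if i is j.+1 then c j else q0); split=> // [[|i]//|[|i]] lt; last exact: cS.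
by split=> [z /q0q /c0//|]; exists h; split=> //; apply: c0.
Qed.

(** * Height and transcendence degree *)

Section Mpoly.
Import -(notations) mpoly.

(** Carries independence from the polynomials of the definition to [iterpoly]: [th] has the left
    inverse [chi], hence is injective. *)
Lemma mpoly_indep (F E : fieldType) (f : {rmorphism F -> E}) n (x : 'I_n -> E) (x0 : nat -> E) :
  algebraically_independent f x -> (forall i : 'I_n, x0 i = x i) ->
  indep f (fun y => y = 0) x0 n.
Proof.
move=> ai x0x Q evQ.
pose M := mpoly n F.
pose X i : M := if insub i is Some j then mpolyX F (mnm1 j) else 0.
pose th : {rmorphism iterpoly F n -> M} := ev (@mpolyC n F : {rmorphism F -> M}) X n.
pose chi : {rmorphism M -> iterpoly F n} :=
  (mmap (iterpolyC F n) (fun i : 'I_n => iterpolyX F n i) : {rmorphism M -> iterpoly F n}).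
have XE (i : 'I_n) : X i = mpolyX F (mnm1 i).
  by rewrite /X insubT ?ltn_ord//= => H; congr (mpolyX _ (mnm1 _)); apply: val_inj.
have chith q : chi (th q) = q.
  rewrite -[RHS]ev_id; apply: ev_comp => [a|i lt]; first exact: mmapC.
  by rewrite (XE (Ordinal lt)) /chi /= mmapX mmap1U.
have mth q : mmap f x (th q) = ev f x0 n q.
  apply: (ev_comp (g := (mmap f x : {rmorphism M -> E}))) => [a|i lt]; first exact: mmapC.
  by rewrite (XE (Ordinal lt)) /= mmapX mmap1U -x0x.
have : th Q = 0 by apply: ai; rewrite mth evQ mmap0.
by move/(congr1 chi); rewrite chith rmorph0.
Qed.

End Mpoly.

Section HeightTrdeg.
Context (Rr : realType).

Lemma height_ge (R : idomainType) (p : prime_idealr R) m (c : nat -> R -> Prop) :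
  (forall i, (i <= m)%N -> is_prime (c i)) -> (forall x, c m x <-> x \in p) ->
  (forall i, (i < m)%N -> (forall x, c i x -> c i.+1 x) /\ exists x, c i.+1 x /\ ~ c i x) ->
  (m%:R%:E <= height Rr p)%E.
Proof.
move=> cP cm cS; apply: ereal_sup_ubound; exists m => //=.
(* [height] wants a sequence over all naturals, whereas [c i] is prime only up to [m]; the chain is
   continued constantly. *)
have ex i : exists q : prime_idealr R, forall x, x \in q <-> c (minn i m) x.
  exact: pack_prime (cP _ (geq_minr _ _)).
have [q Hq] := choice ex; exists q; split.
  move=> x; apply/idP/idP => [/Hq H|H]; last by apply/Hq; rewrite minnn; apply/cm.
  by apply/cm; move: H; rewrite minnn.
move=> i lt; have [sub [x [cx ncx]]] := cS i lt.
have e1 : minn i m = i by apply/minn_idPl; apply: ltnW.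
have e2 : minn i.+1 m = i.+1 by apply/minn_idPl.
split=> [z /Hq Hz|H].
  by apply/Hq; rewrite e2; apply: sub; rewrite -e1.
by apply: ncx; rewrite -e1; apply/Hq/H/Hq; rewrite e2.
Qed.

Lemma height_zero (R : idomainType) (p : prime_idealr R) :
  (forall x, x \in p -> x = 0) -> height Rr p = 0%E.
Proof.
move=> p0; apply/eqP; rewrite eq_le; apply/andP; split.
  apply: ge_ereal_sup => _ [n [c [cn cS]] <-]; case: n cn cS => // n cn cS.
  have [_ []] := cS n (leqnn _) => x; rewrite cn => /p0 ->; exact: idealr0.
apply: ereal_sup_ubound; exists 0%N => //=.
by exists (fun _ => p); split=> // i.
Qed.

(** A zero center has height 0 and would force transcendence degree -1. But a supremum of naturals
    is nonnegative, or [-oo] when there are none. *)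
Lemma divisorial_center_neq0 (R : idomainType) (v : valuation_on Rr R) :
  divisorial v -> exists f : R, f != 0 /\ (0 < v f%:F)%E.
Proof.
move=> dv; apply: contrapT => H.
have h0 : height Rr (center v) = 0%E.
  apply: height_zero => x; rewrite inE => vx; apply/eqP; apply: contrapT => /negP x0.
  by apply: H; exists x.
move: dv; rewrite /divisorial h0 => tr.
have [[n Hn]|no] := pselect (exists n, exists x : 'I_n -> vresidue v, algebraically_independent (residue_map v) x).
  have : (n%:R%:E <= trdeg Rr (residue_map v))%E by apply: ereal_sup_ubound; exists n.
  rewrite tr sub0e -EFinN lee_fin leNgt.
  by rewrite (lt_le_trans (ltrN10 _) (ler0n _ _)).
have : (trdeg Rr (residue_map v) <= (-2)%:E)%E.
  by apply: ge_ereal_sup => z [n Hn _]; case: no; exists n.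
by rewrite tr sub0e -EFinN lee_fin lerN2; lra.
Qed.

(** If all independent families had fewer than [m.-1] members, the transcendence degree would be at
    most [m - 2]. Arguing with suprema also covers an infinite height. *)
Lemma divisorial_indep (R : idomainType) (v : valuation_on Rr R) m :
  divisorial v -> (m%:R%:E <= height Rr (center v))%E ->
  exists n, (m.-1 <= n)%N /\
    exists x : 'I_n -> vresidue v, algebraically_independent (residue_map v) x.
Proof.
move=> dv hm; apply: contrapT => H.
have H' n : (exists x : 'I_n -> vresidue v, algebraically_independent (residue_map v) x) ->
    (n < m.-1)%N.
  by move=> Hn; rewrite ltnNge; apply/negP => le; apply: H; exists n.
have : (trdeg Rr (residue_map v) <= (m%:R - 2)%:E)%E.
  apply: ge_ereal_sup => _ [n /H' lt <-]; rewrite lee_fin lerBrDr -natrD ler_nat.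
  by move: lt; clear; lia.
rewrite dv => H1.
have : (m%:R%:E - 1 <= (m%:R - 2)%:E :> \bar Rr)%E by apply: le_trans H1; rewrite leeB.
by rewrite -EFinB lee_fin lerD2l lerN2 => Hc; clear -Hc; lra.
Qed.

End HeightTrdeg.

(** * Presentations of [R] and contraction of primes *)

Section Presentation.
Context (k : fieldType) (R : idomainType).

Definition localizes N (psi : {rmorphism iterpoly k N -> R}) :=
  forall r, exists a w, psi w \is a GRing.unit /\ r * psi w = psi a.

Lemma eft_presentation : essentially_of_finite_type k R ->
  exists N (psi : {rmorphism iterpoly k N -> R}), localizes psi.
Proof.
move=> [R0 [W [phi [[s Hs] [_ _] [phiW phiS _]]]]].
pose io : {rmorphism k -> R0} := (in_alg R0 : {rmorphism k -> R0}).
pose e : {rmorphism iterpoly k (size s) -> R0} := ev io (fun i => s`_i) (size s).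
have esurj x : exists p, e p = x.
  pose S : {pred R0} := [pred x | `[< exists p, e p = x >]].
  suff : x \in S by move/asboolP.
  apply: Hs => [|y ys]; last first.
    apply/asboolP; exists (iterpolyX k (size s) (index y s)).
    by rewrite /e evX ?index_mem// nth_index.
  split=> [|a u w /asboolP[p <-] /asboolP[q <-]|u w /asboolP[p <-] /asboolP[q <-]].
  - by apply/asboolP; exists 1; rewrite rmorph1.
  - apply/asboolP; exists (iterpolyC k (size s) a * p + q).
    by rewrite rmorphD rmorphM /e evC /io /= mulr_algl.
  - by apply/asboolP; exists (p * q); rewrite rmorphM.
exists (size s), (phi \o e : {rmorphism _ -> _}) => r.
have [a [w [wW ->]]] := phiS r; have [pa <-] := esurj a; have [pw ew] := esurj w.
by exists pa, pw; rewrite /= ew divrK ?phiW.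
Qed.

Context (N : nat) (psi : {rmorphism iterpoly k N -> R}) (lpsi : localizes psi).

Definition to_frac : {rmorphism iterpoly k N -> {fraction R}} :=
  (@FracField.tofrac R \o psi : {rmorphism iterpoly k N -> {fraction R}}).

Lemma to_frac_rep x : exists a w, to_frac w != 0 /\ x * to_frac w = to_frac a.
Proof.
have [r [s [s0 E]]] := frac_rep x.
have [a [w [wu Ea]]] := lpsi r; have [a' [w' [wu' Ea']]] := lpsi s.
have nz u : u \is a GRing.unit -> u != 0 :> R by apply: contraTneq => ->; rewrite unitr0.
exists (a * w'), (a' * w); rewrite /to_frac /= !rmorphM -Ea -Ea' !rmorphM /=; split.
  by rewrite -!tofracM tofrac_eq0; apply: mulf_neq0 (nz _ wu); apply: mulf_neq0 (nz _ wu').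
by rewrite -E; ring.
Qed.

Definition contract (q : R -> Prop) : iterpoly k N -> Prop := fun x => q (psi x).

Lemma contract_prime q : is_prime q -> is_prime (contract q).
Proof.
move=> [[q0 qD qM] q1 qp]; rewrite /contract; split.
- by split=> [|x y|a x]; rewrite ?rmorph0 ?rmorphD ?rmorphM//; [apply: qD|apply: qM].
- by rewrite rmorph1.
- by move=> x y; rewrite rmorphM; apply: qp.
Qed.

Lemma zero_prime : is_prime (fun x : R => x = 0).
Proof.
split=> [||x y]; first by split=> [//|x y -> ->|a x ->]; rewrite ?addr0 ?mulr0.
  by move/eqP; rewrite oner_eq0.
by move/eqP; rewrite mulf_eq0 => /orP[] /eqP; [left|right].
Qed.

Definition extend (c : iterpoly k N -> Prop) (r : R) :=
  exists a w, [/\ psi w \is a GRing.unit, r * psi w = psi a & c a].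

Section Extend.
Context (c : iterpoly k N -> Prop) (cP : is_prime c).
Hypothesis (kerc : forall x, psi x = 0 -> c x) (cu : forall x, c x -> psi x \isn't a GRing.unit).

Lemma extend_contract a : extend c (psi a) <-> c a.
Proof.
have [[c0 cD cM] c1 cp] := cP.
split=> [[b [w [wu E cb]]]|ca]; last by exists a, 1; rewrite rmorph1 unitr1 mulr1.
have : c (a * w).
  rewrite -[a * w](subrK b); apply: cD => //; apply: kerc.
  by rewrite rmorphB rmorphM E subrr.
by case/cp => // /cu; rewrite wu.
Qed.

Lemma extend_prime : is_prime (extend c).
Proof.
have [[c0 cD cM] c1 cp] := cP; split.
- split=> [|x y [a [w [wu E ca]]] [b [t [tu F cb]]]|x y [b [t [tu F cb]]]].
  + by exists 0, 1; rewrite rmorph0 rmorph1 mul0r unitr1.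
  + exists (t * a + w * b), (w * t); rewrite rmorphD !rmorphM unitrM wu tu; split=> //.
      by rewrite -E -F; ring.
    by apply: cD; apply: cM.
  + have [a [w [wu E]]] := lpsi x.
    exists (a * b), (w * t); rewrite !rmorphM unitrM wu tu; split=> //.
      by rewrite -E -F; ring.
    exact: cM.
- by rewrite -(rmorph1 psi) => /extend_contract.
move=> x y [b [t [tu F cb]]].
have [a [w [wu E]]] := lpsi x; have [a' [w' [wu' E']]] := lpsi y.
have : c (a * a').
  apply/extend_contract; exists (w * w' * b), t; split=> //; last exact: cM.
  by rewrite !rmorphM -F -E -E'; ring.
by case/cp => H; [left; exists a, w|right; exists a', w'].
Qed.

End Extend.

(** The primes of the chain contain the kernel of [psi] and lie below the contraction of [p], so
    none contains an element with invertible image. They therefore survive in the localization and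
    stay distinct there. *)
Lemma height_contract (Rr : realType) (p : prime_idealr R) t m :
  (exists x, indep (iterpolyC k N) (contract (fun x => x = 0)) x (t + m)) ->
  ~ (exists x, indep (iterpolyC k N) (contract (fun x => x \in p)) x t.+1) ->
  (m%:R%:E <= height Rr p)%E.
Proof.
move=> ind nind.
have pP : is_prime (fun x => x \in p).
  split; last by move=> x y; rewrite prime_idealrM => /orP.
    by split=> [|x y|a x]; [exact: idealr0|exact: rpredD|exact: idealMr].
  by rewrite idealr1.
have zp : forall x, contract (fun x : R => x = 0) x -> contract (fun x : R => x \in p) x.
  by move=> x; rewrite /contract => ->; exact: idealr0.
have [c [cP c0 cm cS]] := prime_chain (contract_prime zero_prime) (contract_prime pP) zp ind nind.
have cle' j i : (i + j)%N = m -> forall x, c i x -> psi x \in p.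
  elim: j i => [|j IH] i e x cx; first by move: cx; rewrite -[i]addn0 e cm.
  apply: (IH i.+1); first by rewrite addSnnS.
  by apply: (cS i _).1 => //; rewrite -e addnS ltnS leq_addr.
have cle i : (i <= m)%N -> forall x, c i x -> psi x \in p.
  by move=> le; apply: (cle' (m - i)%N); rewrite subnKC.
have ker i : forall x, psi x = 0 -> (i <= m)%N -> c i x.
  elim: i => [|i IH] x px le; first exact: c0.
  by apply: (cS i le).1; apply: IH => //; apply: ltnW.
have cu i : (i <= m)%N -> forall x, c i x -> psi x \isn't a GRing.unit.
  move=> le x /(cle i le) px; apply/negP => u; have := idealMr (psi x)^-1 px.
  by rewrite mulVr// idealr1.
apply: (@height_ge _ _ _ _ (fun i => extend (c i))).
- by move=> i le; apply: extend_prime => //; [move=> x /ker; apply|apply: cu].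
- move=> x; split=> [[a [w [wu E]]]|px].
    rewrite cm /contract -E prime_idealrM => /orP[//|pw].
    by have := idealMr (psi w)^-1 pw; rewrite mulVr// idealr1.
  have [a [w [wu E]]] := lpsi x; exists a, w; split=> //.
  by rewrite cm /contract -E mulrC; exact: idealMr.
move=> i lt; have [sub [x [cx ncx]]] := cS i lt; split.
  by move=> r [a [w [wu E ca]]]; exists a, w; split=> //; apply: sub.
exists (psi x); split; first by exists x, 1; rewrite rmorph1 unitr1 mulr1.
move/extend_contract => H; apply/ncx/H => //; first by move=> z /ker; apply; apply: ltnW.
by apply: cu; apply: ltnW.
Qed.

End Presentation.

(** * Transcendence degree of the residue field of a divisorial valuation *)

Section ResidueIndep.
Context (Rr : realType) (k : fieldType) (R : idomainType) (N : nat).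
Context (psi : {rmorphism iterpoly k N -> R}) (lpsi : localizes psi).
Context (v : valuation_on Rr R).
Let K := {fraction R}.
Let g := to_frac psi.
Let ka : {rmorphism k -> K} := (g \o iterpolyC k N : {rmorphism k -> K}).

Definition resid : {rmorphism vring v -> vresidue v} :=
  (\pi_(vresidue v) \o idfun : {rmorphism vring v -> vresidue v}).

Lemma resid_eq0 x : resid x = 0 <-> (0 < v (val x))%E.
Proof.
rewrite /resid -(rmorph0 \pi_(vresidue v)); split=> [/eqP|H].
  by rewrite -Quotient.idealrBE subr0 inE.
by apply/eqP; rewrite -Quotient.idealrBE subr0 inE.
Qed.

Fact in_vring (r : R) : r%:F \in vring_pred v.
Proof. exact: val_of_ge0. Qed.

Definition to_vring (r : R) : vring v := VRing (in_vring r).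
Fact to_vring_zmod : zmod_morphism to_vring.
Proof. by move=> x y; apply: val_inj; rewrite /= rmorphB. Qed.
Fact to_vring_monoid : monoid_morphism to_vring.
Proof. by split=> [|x y]; apply: val_inj; rewrite /= ?rmorph1 ?rmorphM. Qed.
HB.instance Definition _ := GRing.isZmodMorphism.Build R (vring v) to_vring to_vring_zmod.
HB.instance Definition _ := GRing.isMonoidMorphism.Build R (vring v) to_vring to_vring_monoid.

Lemma residue_to_kappa r : residue_map v (to_kappa (center v) r) = resid (to_vring r).
Proof.
rewrite /to_kappa /= residue_mapE /resid; congr (\pi _); exact: val_inj.
Qed.

Section Tower.
Context (t : nat) (F : fieldType) (h0 : {rmorphism iterpoly k t -> F}).
(* The identification of [k[X_0..X_(t-1)][X_t..X_(m+t-1)]] with a polynomial ring over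
   [k[X_0..X_(t-1)]], followed by [h0] on coefficients. *)
Fixpoint tower_map m : {rmorphism iterpoly k (m + t) -> iterpoly F m} :=
  if m is m'.+1 then (map_poly (tower_map m') : {rmorphism {poly iterpoly k (m' + t)} -> {poly iterpoly F m'}})
  else h0.

Lemma tower_inj m Q : (forall Q, h0 Q = 0 -> Q = 0) -> tower_map m Q = 0 -> Q = 0.
Proof.
move=> h0i; elim: m Q => [|m IH] Q; first exact: h0i.
move=> /polyP H; apply/polyP => i; have := H i.
by rewrite /= coef_map !coef0 => /IH.
Qed.
End Tower.

(** Independence is transitive in the tower formed by [k], the residue field of the center and that
    of [v]: a relation reduces to one among the residues of the [w i], whose coefficients, being
    polynomials in the [et i], vanish and so are zero polynomials. *)
Lemma residual_tower t (et : nat -> iterpoly k N) m (w : nat -> vring v) (Q : iterpoly k (m + t)) :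
  indep (iterpolyC k N) (contract psi (fun x => x \in center v)) et t ->
  indep (residue_map v) (fun y => y = 0) (resid \o w) m ->
  (0 < v (ev ka (fun i => if (i < t)%N then g (et i) else val (w (i - t)%N)) (m + t) Q))%E ->
  Q = 0.
Proof.
move=> iet iw.
pose kv : {rmorphism k -> vring v} := (to_vring \o psi \o iterpolyC k N : {rmorphism k -> vring v}).
pose Y i : vring v := if (i < t)%N then to_vring (psi (et i)) else w (i - t)%N.
have -> : ev ka (fun i => if (i < t)%N then g (et i) else val (w (i - t)%N)) (m + t) Q =
    val (ev kv Y (m + t) Q).
  rewrite (ev_comp (g := (val : {rmorphism vring v -> K})) (h := ka)
     (y := fun i => if (i < t)%N then g (et i) else val (w (i - t)%N)))//.
  by move=> i _; rewrite /Y; case: ifP.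
move/resid_eq0.
pose h0 : {rmorphism iterpoly k t -> kappa (center v)} :=
  (to_kappa (center v) \o psi \o ev (iterpolyC k N) et t : {rmorphism iterpoly k t -> kappa (center v)}).
have E n (q : iterpoly k (n + t)) : resid (ev kv Y (n + t) q) =
    ev (residue_map v) (resid \o w) n (tower_map h0 n q).
  elim: n q => [|n IH] q.
    transitivity (residue_map v (h0 q)) => //.
    rewrite /h0 /= residue_to_kappa; congr (resid _).
    have -> : to_vring (psi (ev (iterpolyC k N) et t q)) =
      (to_vring \o psi : {rmorphism iterpoly k N -> vring v}) (ev (iterpolyC k N) et t q) by [].
    apply/esym; apply: ev_comp => // i lt.
    by rewrite /Y lt.
  have sq : (size (tower_map h0 n.+1 q : {poly iterpoly (kappa (center v)) n}) <= size (q : {poly iterpoly k (n + t)}))%N.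
    exact: size_poly.
  rewrite (evS _ _ sq) (@evS _ _ kv Y (n + t) q _ (leqnn _)) rmorph_sum.
  apply: eq_bigr => i _; rewrite rmorphM rmorphXn IH /= coef_map; congr (_ * _ ^+ _).
  by rewrite /Y ltnNge leq_addl /= addnK.
rewrite E => /iw /tower_inj; apply => q; rewrite /h0 /= => /to_kappa_eq0.
exact: iet.
Qed.

(** Let [t] be the largest number of elements independent modulo the contracted center. The center
    has height at least [d - t], so divisoriality yields [(d - t).-1] residues independent over its
    residue field; together with the [t] elements these are enough. *)
Lemma divisorial_transcendence d y (J : finType) (b : J -> iterpoly k N) :
  normalizes g d y b -> divisorial v ->
  exists u : nat -> K, (forall i, (i < d.-1)%N -> (0 <= v (u i))%E) /\
    indep ka (fun x => (0 < v x)%E) u d.-1.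
Proof.
move=> nn dv.
have fr (z : iterpoly k N) : exists a w, g w != 0 /\ g z * g w = g a.
  by exists z, 1; rewrite rmorph1 oner_neq0 mulr1.
pose pc := contract psi (fun x => x \in center v).
pose T n := `[< exists x, indep (iterpolyC k N) pc x n >].
have evg (z : nat -> iterpoly k N) m Q : ev ka (g \o z) m Q = g (ev (iterpolyC k N) z m Q).
  by rewrite (ev_comp (h := ka) (y := g \o z)).
have g0 x : g x = 0 <-> psi x = 0.
  by rewrite /g /to_frac /=; split=> [/eqP|->]; [rewrite tofrac_eq0 => /eqP|rewrite rmorph0].
have Td n : T n -> (n <= d)%N.
  move=> /asboolP[x ix]; apply: (indep_size_le nn (u := g \o x)) => [i _|Q]; first exact: fr.
  by rewrite evg => /g0 e; apply: ix; rewrite /pc /contract e; exact: idealr0.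
have T0 : exists n, T n.
  exists 0%N; apply/asboolP; exists (fun _ => 0) => Q /= H.
  apply/eqP; apply: contraT => Q0; have := idealMr (psi (iterpolyC k N Q^-1)) H.
  by rewrite -rmorphM -rmorphM mulVf// !rmorph1 idealr1.
case: (ex_maxnP T0 Td) => t Tt tmax.
have td := Td t Tt; move/asboolP: Tt => [et iet].
have h1 : exists x, indep (iterpolyC k N) (contract psi (fun x => x = 0)) x (t + (d - t)).
  rewrite subnKC//; exists y => Q H; apply: nn.1; exact/g0.
have h2 : ~ exists x, indep (iterpolyC k N) pc x t.+1.
  by move/asboolP => /tmax; rewrite ltnn.
have hm := height_contract lpsi Rr h1 h2.
have [n [le [xi ai]]] := divisorial_indep dv hm.
pose w i : vring v := if insub i is Some j then repr (xi j) else 0.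
have iw : indep (residue_map v) (fun y => y = 0) (resid \o w) (d - t).-1.
  apply: (indep_le le); apply: (mpoly_indep ai) => i.
  by rewrite /w /= insubT ?ltn_ord//= => H; rewrite /resid reprK; congr xi; apply: val_inj.
exists (fun i => if (i < t)%N then g (et i) else val (w (i - t)%N)); split.
  move=> i _; case: ifP => _; first exact: val_of_ge0.
  exact: (valP (w (i - t)%N)).
apply: (@indep_le _ _ _ _ _ ((d - t).-1 + t)); first by move: td; clear; lia.
by move=> Q; apply: residual_tower.
Qed.

End ResidueIndep.

(** * Elementary properties of valuations *)

Section ValuationTheory.
Context (Rr : realType) (K : fieldType) (v : valuation Rr K).
Implicit Types x y : K.

Lemma val_ge0D x y : (0 <= v x)%E -> (0 <= v y)%E -> (0 <= v (x + y)%R)%E.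
Proof. by move=> vx vy; apply: le_trans (valD v x y); rewrite le_min vx. Qed.

Lemma val_gt0D x y : (0 < v x)%E -> (0 < v y)%E -> (0 < v (x + y)%R)%E.
Proof. by move=> vx vy; apply: lt_le_trans (valD v x y); rewrite lt_min vx. Qed.

Lemma val_ge0M x y : (0 <= v x)%E -> (0 <= v y)%E -> (0 <= v (x * y)%R)%E.
Proof. by move=> vx vy; rewrite valM; apply: adde_ge0. Qed.

Lemma val_gt0Mr x y : (0 <= v x)%E -> (0 < v y)%E -> (0 < v (x * y)%R)%E.
Proof. by move=> vx vy; rewrite valM; apply: lt_le_trans vy (leeDr _ vx). Qed.

Lemma val_gt0Ml x y : (0 < v x)%E -> (0 <= v y)%E -> (0 < v (x * y)%R)%E.
Proof. by move=> vx vy; rewrite mulrC; apply: val_gt0Mr. Qed.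

Lemma val_eq0M x y : v x = 0%E -> v y = 0%E -> v (x * y) = 0%E.
Proof. by rewrite valM => -> ->; rewrite adde0. Qed.

Lemma val_eq0D x y : v x = 0%E -> (0 < v y)%E -> v (x + y) = 0%E.
Proof.
move=> vx vy; apply/eqP; rewrite eq_le; apply/andP; split; last first.
  by apply: val_ge0D; [rewrite vx | apply: ltW].
rewrite leNgt; apply/negP => H.
have : (0 < v (x + y - y)%R)%E by apply: val_gt0D; rewrite ?valN.
by rewrite addrK vx ltxx.
Qed.

Lemma val_eq0_neq0 x : v x = 0%E -> x != 0.
Proof. by move=> vx; apply/eqP => x0; rewrite x0 val0 in vx. Qed.

Lemma val_eq0V x : v x = 0%E -> v x^-1 = 0%E.
Proof.
move=> vx; have := valM v x x^-1.
by rewrite mulfV ?val_eq0_neq0// val1 vx add0e.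
Qed.

Lemma val_gt0_sum (I : Type) (r : seq I) (P : pred I) F :
  (forall i, P i -> (0 < v (F i))%E) -> (0 < v (\sum_(i <- r | P i) F i)%R)%E.
Proof. by move=> H; apply: (big_ind (fun x => (0 < v x)%E)) => //; [rewrite val0|apply: val_gt0D]. Qed.

Lemma val_ge0X x n : (0 <= v x)%E -> (0 <= v (x ^+ n)%R)%E.
Proof. by move=> vx; elim: n => [|n IH]; rewrite ?expr0 ?val1// exprS; apply: val_ge0M. Qed.

Lemma val_integral (A : nzRingType) (f : {rmorphism A -> K}) x :
  (forall a, (0 <= v (f a))%E) -> integralOver f x -> (0 <= v x)%E.
Proof.
move=> fV [p pm /rootP px]; rewrite leNgt; apply/negP => vx.
have x0 : x != 0 by apply/eqP => x0; rewrite x0 val0 in vx.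
have vV : (0 < v x^-1%R)%E.
  have := valM v x x^-1; rewrite mulfV// val1.
  move: vx; have := val_fin v x0; have : x^-1 != 0 by rewrite invr_eq0.
  move=> /(val_fin v); case: (v x) => // a; case: (v x^-1) => // b _ _.
  by rewrite !lte_fin -EFinD => a0 [] ab; lra.
have sp : size p = (size p).-1.+1 by rewrite prednK// size_poly_gt0 monic_neq0.
have := px; rewrite (@horner_coef_wide _ (size p).-1.+1); last first.
  by rewrite -sp size_poly.
rewrite big_ord_recr /= coef_map /= -lead_coefE (monicP pm) rmorph1 mul1r.
move/(congr1 (fun y => y * x^-1 ^+ (size p).-1)).
rewrite mul0r mulrDl -exprMn mulfV// expr1n mulr_suml => /eqP; rewrite addr_eq0 => /eqP e.
have pw i m : (i < m)%N -> x ^+ i * x^-1 ^+ m = x^-1 ^+ (m - i).-1 * x^-1.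
  move=> lt; rewrite -exprSr prednK ?subn_gt0// -[in LHS](subnKC (ltnW lt)) exprD mulrA.
  by rewrite -exprMn mulfV// expr1n mul1r.
have : (0 < v (-1)%R)%E.
  rewrite -e; apply: val_gt0_sum => i _; rewrite coef_map /=.
  have lt := ltn_ord i.
  rewrite -mulrA; apply: val_gt0Mr => //.
  rewrite pw//.
  by apply: val_gt0Mr => //; apply: val_ge0X; apply: ltW.
by rewrite valN1 ltxx.
Qed.

End ValuationTheory.

(** For [p] of degree [r + 1] with leading coefficient [a], the element [a * x] is a root of the
    monic polynomial $a^r p(X/a)$, whose lower coefficients are $p_i a^{r-i}$. *)
Lemma lead_coef_integral (A : comNzRingType) (K : fieldType) (f : {rmorphism A -> K}) (p : {poly K}) x :
  (forall i, integralOver f p`_i) -> p != 0 -> root p x -> integralOver f (lead_coef p * x).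
Proof.
move=> pint p0 /rootP px; set a := lead_coef p.
have ia : integralOver f a by rewrite /a lead_coefE.
have iX n : integralOver f (a ^+ n).
  by elim: n => [|n IH]; rewrite ?expr0 ?exprS; [apply: integral1|apply: integral_mul].
have a0 : a != 0 by rewrite lead_coef_eq0.
case sp : (size p) => [|r]; first by move: p0; rewrite -size_poly_eq0 sp.
case: r sp => [|r] sp.
  have := px; rewrite (size1_polyC (eq_leq sp)) hornerC => e.
  by move: a0; rewrite /a lead_coefE sp /= e eqxx.
pose Q : {poly K} := \poly_(i < r.+1) (p`_i * a ^+ (r - i)).
pose P := 'X^(r.+1) + Q.
have sP : (size Q < size ('X^(r.+1) : {poly K}))%N.
  by rewrite size_polyXn ltnS size_poly.
apply: (@integral_root_monic _ _ f _ P).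
- by rewrite monicE lead_coefDl// lead_coefXn.
- apply/rootP; rewrite hornerD hornerXn (@horner_coef_wide _ r.+1) ?size_poly//.
  apply: (mulfI a0); rewrite mulr0.
  transitivity (a ^+ r.+1 * p.[x]); last by rewrite px mulr0.
  rewrite [in RHS](@horner_coef_wide _ r.+2) ?sp// [in RHS]big_ord_recr /= [RHS]mulrDr.
  rewrite mulrDr [LHS]addrC; congr (_ + _).
    rewrite !mulr_sumr; apply: eq_bigr => i _; rewrite coef_poly ltn_ord.
    have -> : a ^+ r.+1 = a * (a ^+ (r - i) * a ^+ i).
      by rewrite -exprD subnK -1?ltnS// exprS.
    by rewrite exprMn; ring.
  have -> : p`_r.+1 = a by rewrite /a lead_coefE sp.
  by rewrite exprMn; ring.
apply/integral_poly => i; rewrite coefD coefXn coef_poly; apply: integral_add.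
  exact: integral_nat.
by case: ifP => _; [apply: integral_mul | apply: integral0].
Qed.

(** * Integral closure in function fields of one variable *)

Section FiniteNormalization.
Context (L K : fieldType) (zeta : {rmorphism {poly L} -> K}).
Hypothesis zeta_inj : forall p, zeta p = 0 -> p = 0.
Context (B0 : nat).
Hypothesis bounded : forall n (bs : 'I_n -> K),
  (forall Q : 'I_n -> {poly L}, \sum_i zeta (Q i) * bs i = 0 -> forall i, Q i = 0) -> (n <= B0)%N.

Let zeta0 p : p != 0 -> zeta p != 0.
Proof. by apply: contraNneq => /zeta_inj ->. Qed.

Let alg_int x : exists c, c != 0 /\ integralOver zeta (zeta c * x).
Proof.
have [Q [Q0 [i Qi]]] : exists Q : 'I_B0.+1 -> {poly L}, \sum_i zeta (Q i) * x ^+ i = 0 /\ exists i, Q i != 0.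
  apply: contrapT => H; have : (B0.+1 <= B0)%N; last by rewrite ltnn.
  apply: (@bounded _ (fun i => x ^+ i)) => Q Q0 i; apply/eqP; apply: contrapT => /negP Qi.
  by apply: H; exists Q; split=> //; exists i.
pose p : {poly {poly L}} := \poly_(j < B0.+1) Q (inord j).
have p0 : p != 0.
  by apply: contraNneq Qi => /polyP/(_ i); rewrite coef_poly ltn_ord coef0 inord_val => ->.
exists (lead_coef p); split; first by rewrite lead_coef_eq0.
have z0 : map_poly zeta p != 0.
  apply: contraNneq p0 => /polyP H; apply/eqP/polyP => j; rewrite coef0.
  by apply: zeta_inj; have := H j; rewrite coef_map coef0.
have -> : zeta (lead_coef p) = lead_coef (map_poly zeta p).
  rewrite lead_coef_map_eq//.
  by apply: zeta0; rewrite lead_coef_eq0.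
apply: lead_coef_integral => // [j|]; first by rewrite coef_map; apply: integral_id.
apply/rootP; rewrite (@horner_coef_wide _ B0.+1).
  by rewrite -[RHS]Q0; apply: eq_bigr => j _; rewrite coef_map coef_poly ltn_ord /= inord_val.
by rewrite (leq_trans (size_poly _ _))// size_poly.
Qed.

Definition zfree n (bs : 'I_n -> K) :=
  forall Q : 'I_n -> {poly L}, \sum_i zeta (Q i) * bs i = 0 -> forall i, Q i = 0.

Lemma integral_basis : exists n (b : 'I_n -> K),
  [/\ zfree b, forall i, integralOver zeta (b i) &
      forall x, exists D (a : 'I_n -> {poly L}), D != 0 /\ zeta D * x = \sum_i zeta (a i) * b i].
Proof.
pose T n := `[< exists b : 'I_n -> K, zfree b >].
have T0 : exists n, T n by exists 0%N; apply/asboolP; exists (fun _ => 0) => Q _ [].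
have TB n : T n -> (n <= B0)%N by move=> /asboolP[b /bounded].
case: (ex_maxnP T0 TB) => n /asboolP[b0 b0f] nmax.
have [c Hc] := choice (fun i => alg_int (b0 i)).
pose b i := zeta (c i) * b0 i.
have bf : zfree b.
  move=> Q Q0 i; have : Q i * c i = 0.
    apply: (b0f (fun i => Q i * c i)); rewrite -[RHS]Q0; apply: eq_bigr => j _.
    by rewrite rmorphM mulrA.
  by move/eqP; rewrite mulf_eq0 (negPf (Hc i).1) orbF => /eqP.
exists n, b; split=> // [i|x]; first exact: (Hc i).2.
pose b' (i : 'I_n.+1) := if unlift ord0 i is Some j then b j else x.
have [Q [Q0 [i Qi]]] : exists Q : 'I_n.+1 -> {poly L}, \sum_i zeta (Q i) * b' i = 0 /\ exists i, Q i != 0.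
  apply: contrapT => H; have : (n.+1 <= n)%N; last by rewrite ltnn.
  apply: nmax; apply/asboolP; exists b' => Q Q0 i; apply/eqP; apply: contrapT => /negP Qi.
  by apply: H; exists Q; split=> //; exists i.
move: Q0; rewrite big_ord_recl {1}/b' unlift_none.
under eq_bigr do rewrite /b' liftK.
move=> /eqP; rewrite addr_eq0 -sumrN => /eqP Q0.
exists (Q ord0), (fun j => - Q (lift ord0 j)); split.
  apply: contraNneq Qi => Qz.
  have H : forall j, Q (lift ord0 j) = 0.
    apply: bf; apply/eqP; rewrite -oppr_eq0 -sumrN -Q0 Qz rmorph0 mul0r//.
  by case: (unliftP ord0 i) => [j ->|->]; rewrite ?H ?Qz.
by rewrite Q0; apply: eq_bigr => j _; rewrite rmorphN mulNr.
Qed.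

Section Lattice.
Context (n : nat) (b : 'I_n -> K).
Hypothesis bf : zfree b.
Hypothesis bint : forall i, integralOver zeta (b i).
Hypothesis bspan : forall x, exists D (a : 'I_n -> {poly L}),
  D != 0 /\ zeta D * x = \sum_i zeta (a i) * b i.

Definition coords D (a : 'I_n -> {poly L}) x :=
  D != 0 /\ zeta D * x = \sum_i zeta (a i) * b i.

Lemma common_coords (I : finType) (x : I -> K) : exists D a, D != 0 /\ forall i, coords D (a i) (x i).
Proof.
have [D HD] := choice (fun i => bspan (x i)); have {HD} [a Ha] := choice HD.
have P0 : \prod_i D i != 0 by apply/prodf_neq0 => i _; have [] := Ha i.
exists (\prod_i D i), (fun i j => \prod_(l | l != i) D l * a i j); split=> // i; split=> //.
have [_ Hi] := Ha i; rewrite (bigD1 i) //= mulrC rmorphM.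
have -> : x i * (zeta (D i) * zeta (\prod_(l | l != i) D l)) =
  zeta (\prod_(l | l != i) D l) * (zeta (D i) * x i) by ring.
rewrite Hi mulr_sumr; apply: eq_bigr => j _.
by rewrite rmorphM; ring.
Qed.

Lemma coords_eq D a D' a' x : coords D a x -> coords D' a' x -> forall i, D' * a i = D * a' i.
Proof.
move=> [_ H] [_ H'] i; apply/eqP; rewrite -subr_eq0; apply/eqP.
move: i; apply: bf.
transitivity (\sum_i (zeta D' * (zeta (a i) * b i) - zeta D * (zeta (a' i) * b i))).
  by apply: eq_bigr => i _; rewrite rmorphB !rmorphM; ring.
by rewrite sumrB -!mulr_sumr -H -H' mulrCA subrr.
Qed.

(* The degree of [x] with respect to the basis [b] is at most [- e]. *)
Definition deg_le_opp e x := exists D a, coords D a x /\ forall i, (size (a i) + e <= size D)%N.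

(** The products of two basis elements have fixed coordinates, of bounded size; up to this constant,
    degree bounds add. *)
Lemma deg_le_oppM : exists c, forall e f h x y,
  deg_le_opp e x -> deg_le_opp f y -> (h + c <= e + f)%N -> deg_le_opp h (x * y).
Proof.
have [De [ga [De0 Hga]]] := common_coords (fun ij : 'I_n * 'I_n => b ij.1 * b ij.2).
pose c := (\max_ij \max_l size (ga ij l))%N.
exists c.+1 => e f h x y [D [a [[D0 Dx] aD]]] [D' [a' [[D'0 Dy] aD']]] hc.
exists (D * D' * De), (fun l => \sum_i \sum_j a i * a' j * ga (i, j) l); split.
  split; first by rewrite !mulf_neq0.
  rewrite !rmorphM.
  have -> : zeta D * zeta D' * zeta De * (x * y) = zeta De * ((zeta D * x) * (zeta D' * y)) by ring.
  rewrite Dx Dy mulr_suml mulr_sumr.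
  under [RHS]eq_bigr do rewrite rmorph_sum mulr_suml.
  rewrite [RHS]exchange_big; apply: eq_bigr => i _.
  under [RHS]eq_bigr do rewrite rmorph_sum mulr_suml.
  rewrite [RHS]exchange_big !mulr_sumr; apply: eq_bigr => j _.
  have [_ Hij] := Hga (i, j).
  have -> : zeta De * (zeta (a i) * b i * (zeta (a' j) * b j)) =
      zeta (a i) * zeta (a' j) * (zeta De * (b i * b j)) by ring.
  rewrite Hij mulr_sumr; apply: eq_bigr => l _.
  by rewrite !rmorphM mulrA.
have D1 : (0 < size D)%N by rewrite size_poly_gt0.
have D'1 : (0 < size D')%N by rewrite size_poly_gt0.
have De1 : (0 < size De)%N by rewrite size_poly_gt0.
move=> l; rewrite !size_mul ?mulf_neq0//.
have hle : (h <= ((size D + size D').-1 + size De).-1)%N.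
  by have := aD l; have := aD' l; lia.
rewrite -(subnK hle) leq_add2r.
apply: (leq_trans (size_sum _ _ _)); apply/bigmax_leqP => i _.
apply: (leq_trans (size_sum _ _ _)); apply/bigmax_leqP => j _.
have [->|ai0] := eqVneq (a i) 0; first by rewrite !mul0r size_poly0.
have [->|aj0] := eqVneq (a' j) 0; first by rewrite mulr0 mul0r size_poly0.
have [->|g0] := eqVneq (ga (i, j) l) 0; first by rewrite mulr0 size_poly0.
rewrite !size_mul ?mulf_neq0//.
have cg : (size (ga (i, j) l) <= c)%N.
  apply: leq_trans (leq_bigmax (i, j)); exact: (leq_bigmax l).
have s1 : (0 < size (a i))%N by rewrite size_poly_gt0.
have s2 : (0 < size (a' j))%N by rewrite size_poly_gt0.
have := aD i; have := aD' j; clearbody c; move: hc cg D1 D'1 De1 s1 s2 hle; clear.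
move: (size D) (size D') (size De) (size (a i)) (size (a' j)) (size (ga (i, j) l)) => *; lia.
Qed.

Lemma integral_powers x : integralOver zeta x ->
  exists D, D != 0 /\ forall j, exists a, coords D a (x ^+ j).
Proof.
move=> [p pm /rootP px].
have [D [a [D0 Ha]]] := common_coords (fun i : 'I_(size p) => x ^+ i).
exists D; split=> // j.
pose r := 'X^j %% p.
have sr : (size r < size p)%N by rewrite ltn_modp monic_neq0.
have xE : x ^+ j = \sum_(i < size p) zeta r`_i * x ^+ i.
  have := congr1 (fun q => (map_poly zeta q).[x]) (Pdiv.IdomainMonic.divp_eq pm 'X^j).
  rewrite /= map_polyXn hornerXn rmorphD rmorphM hornerD hornerM px mulr0 add0r => ->.
  rewrite (@horner_coef_wide _ (size p)) ?(leq_trans (size_poly _ _)) 1?ltnW//.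
  by apply: eq_bigr => i _; rewrite coef_map.
exists (fun l => \sum_(i < size p) r`_i * a i l); split=> //.
rewrite xE mulr_sumr.
under [RHS]eq_bigr do rewrite rmorph_sum mulr_suml.
rewrite exchange_big; apply: eq_bigr => i _; rewrite mulrCA (Ha i).2 mulr_sumr.
by apply: eq_bigr => l _; rewrite rmorphM mulrA.
Qed.

(* The powers of an integral element have a common denominator, but those of an element of
   very negative degree have degrees tending to [-oo]. *)
Lemma integral_deg : exists c, forall x, integralOver zeta x -> deg_le_opp c x -> x = 0.
Proof.
have [c Hc] := deg_le_oppM; exists c.+1 => x xi xc.
have xp j : deg_le_opp (c + j.+1) (x ^+ j.+1).
  elim: j => [|j IH]; first by rewrite addn1.
  by rewrite exprS; apply: (Hc _ _ _ _ _ xc IH); rewrite addSn addnS !addnA addnAC; lia.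
have [D1 [D10 HD1]] := integral_powers xi.
(* At the exponent [size D1] the degree is so negative that the denominator [D1] cannot compensate
   it by polynomial coordinates, unless these are 0. *)
have [D [a [[D0 Da] aD]]] := xp (size D1).-1.
rewrite prednK ?size_poly_gt0// in Da aD.
have [a' Ha'] := HD1 (size D1).
have a'0 i : a' i = 0.
  apply/eqP; apply: contraT => a'i0.
  have E := coords_eq (conj D0 Da : coords D a _) Ha' i.
  have s1 : (0 < size D)%N by rewrite size_poly_gt0.
  have s2 : (0 < size (a' i))%N by rewrite size_poly_gt0.
  have ai0 : a i != 0.
    by apply: contraNneq (mulf_neq0 D0 a'i0) => ai0; rewrite -E ai0 mulr0.
  have := congr1 (fun q : {poly L} => size q) E; rewrite !size_mul//.
  move: (aD i) s1 s2; clear; move: (size D) (size D1) (size (a i)) (size (a' i)) => *; lia.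
have [_] := Ha'; rewrite big1 => [/eqP|i _]; last by rewrite a'0 rmorph0 mul0r.
by rewrite mulf_eq0 (negPf (zeta0 D10)) /= expf_eq0 => /andP[_ /eqP].
Qed.

Lemma integral_zsum (I : finType) (c : I -> {poly L}) (x : I -> K) :
  (forall i, integralOver zeta (x i)) -> integralOver zeta (\sum_i zeta (c i) * x i).
Proof.
move=> xi; apply: (big_ind (integralOver zeta)) => [|u w|i _].
- exact: integral0.
- exact: integral_add.
- by apply: integral_mul => //; apply: integral_id.
Qed.

(* Modulo the lattice spanned by [b], coordinates may be taken of negative degree, and killing
   the [n * C] leading coefficients produces an integral element of degree at most [- C]. *)
Lemma integral_dep : exists M, forall de (x : 'I_de -> K),
  (forall i, integralOver zeta (x i)) -> (M < de)%N ->
  exists cc : 'I_de -> L, (exists i, cc i != 0) /\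
    exists a : 'I_n -> {poly L}, \sum_i zeta (cc i)%:P * x i = \sum_l zeta (a l) * b l.
Proof.
have [C HC] := integral_deg; exists (n * C)%N => de x xi lt.
have [D0 [P [D00 HP]]] := common_coords x.
(* The factor ['X^C] ensures [C <= size D], so that the [C] positions [size D - C + i] to be killed
   exist. *)
pose D := D0 * 'X^C.
have Dn0 : D != 0 by rewrite mulf_neq0// -size_poly_eq0 size_polyXn.
have sD : (C <= size D)%N.
  by rewrite size_mul// -?size_poly_eq0 ?size_polyXn// addnS /= leq_addl.
pose R i l := (P i l * 'X^C) %% D; pose Q i l := (P i l * 'X^C) %/ D.
pose x' i := x i - \sum_l zeta (Q i l) * b l.
have Hx' i : zeta D * x' i = \sum_l zeta (R i l) * b l.
  rewrite mulrBr /D rmorphM mulrAC (HP i).2 -/D mulr_suml mulr_sumr -sumrB.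
  apply: eq_bigr => l _.
  have := divp_eq (P i l * 'X^C) D; rewrite -/(Q i l) -/(R i l) => e.
  have -> : R i l = P i l * 'X^C - Q i l * D by rewrite e addrC addKr.
  by rewrite rmorphB !rmorphM; ring.
have x'int i : integralOver zeta (x' i) by apply: integral_sub => //; apply: integral_zsum.
have [cc [ccn0 Hcc]] := @lin_dep L 'I_de ('I_n * 'I_C)%type
  (fun i lt => (R i lt.1)`_(size D - C + lt.2)) (ltac:(by rewrite card_prod !card_ord)).
exists cc; split=> //.
have y0 : \sum_i zeta (cc i)%:P * x' i = 0.
  apply: HC; first exact: integral_zsum.
  exists D, (fun l => \sum_i (cc i)%:P * R i l); split; first split=> //.
    under [RHS]eq_bigr do rewrite rmorph_sum mulr_suml.
    rewrite exchange_big mulr_sumr; apply: eq_bigr => i _; rewrite mulrCA Hx' mulr_sumr.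
    by apply: eq_bigr => l _; rewrite rmorphM mulrA.
  move=> l; rewrite -[X in (_ <= X)%N](subnK sD) leq_add2r; apply/leq_sizeP => j le.
  rewrite coef_sum; have [ltj|gej] := ltnP j (size D).
    have lt' : (j - (size D - C) < C)%N by rewrite ltn_subLR// subnK.
    apply: etrans (Hcc (l, Ordinal lt')).
    by apply: eq_bigr => i _; rewrite coefCM /= subnKC.
  rewrite big1// => i _; rewrite coefCM [(R i l)`_j]nth_default ?mulr0//.
  by rewrite (leq_trans _ gej)// ltnW// ltn_modp.
exists (fun l => \sum_i (cc i)%:P * Q i l).
transitivity (\sum_i zeta (cc i)%:P * (\sum_l zeta (Q i l) * b l)).
  move: y0; under eq_bigr do rewrite mulrBr.
  by rewrite sumrB => /eqP; rewrite subr_eq0 => /eqP.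
under [RHS]eq_bigr do rewrite rmorph_sum mulr_suml.
rewrite [RHS]exchange_big; apply: eq_bigr => i _; rewrite mulr_sumr.
by apply: eq_bigr => l _; rewrite rmorphM mulrA.
Qed.

End Lattice.

(** By [integral_dep] the lattice spanned by an integral basis has finite codimension over [L] in
    the integral closure; the basis and a maximal family independent modulo the lattice generate.
    The conclusion is phrased as an induction principle, to be used with a [P] chosen later. *)
Theorem integral_closure_fg : exists s : seq K, (forall x, x \in s -> integralOver zeta x) /\
  forall x, integralOver zeta x -> forall P : K -> Prop, P 0 ->
    (forall x y, P x -> P y -> P (x + y)) -> (forall p x, x \in s -> P (zeta p * x)) -> P x.
Proof.
have [n [b [bf bint bspan]]] := integral_basis.
have [M HM] := integral_dep bf bint bspan.
pose T de := `[< exists x : 'I_de -> K, (forall i, integralOver zeta (x i)) /\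
  forall cc : 'I_de -> L, (exists a : 'I_n -> {poly L},
    \sum_i zeta (cc i)%:P * x i = \sum_l zeta (a l) * b l) -> forall i, cc i = 0 >].
have T0 : exists de, T de.
  by exists 0%N; apply/asboolP; exists (fun _ => 0); split=> [[]|cc _ []].
have TB de : T de -> (de <= M)%N.
  move=> /asboolP[x [xi ind]]; rewrite leqNgt; apply/negP => lt.
  by have [cc [[i /eqP cci] /ind H]] := HM de x xi lt; apply: cci.
case: (ex_maxnP T0 TB) => de /asboolP[x [xi ind]] demax.
exists (codom b ++ codom x); split.
  by move=> y; rewrite mem_cat => /orP[] /codomP[i ->].
move=> w wi P P0 PD PM.
have Pb (a : 'I_n -> {poly L}) : P (\sum_l zeta (a l) * b l).
  by apply: big_ind => // l _; apply: PM; rewrite mem_cat codom_f.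
have Px (a : 'I_de -> {poly L}) : P (\sum_l zeta (a l) * x l).
  by apply: big_ind => // l _; apply: PM; rewrite mem_cat codom_f orbT.
pose x' (i : 'I_de.+1) := if unlift ord0 i is Some j then x j else w.
have [cc [[i cci] [a Ha]]] : exists cc : 'I_de.+1 -> L, (exists i, cc i != 0) /\
    exists a : 'I_n -> {poly L}, \sum_i zeta (cc i)%:P * x' i = \sum_l zeta (a l) * b l.
  apply: contrapT => H; have : (de.+1 <= de)%N; last by rewrite ltnn.
  apply: demax; apply/asboolP; exists x'; split.
    by move=> i; rewrite /x'; case: (unliftP ord0 i).
  move=> cc ex i; apply/eqP; apply: contrapT => /negP ci; apply: H.
  by exists cc; split=> //; exists i.
move: Ha; rewrite big_ord_recl {1}/x' unlift_none.
under eq_bigr do rewrite /x' liftK.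
move=> Ha; have c0 : cc ord0 != 0.
  apply: contraNneq cci => c0.
  have H : forall j, cc (lift ord0 j) = 0.
    by apply: ind; exists a; rewrite -Ha c0 polyC0 rmorph0 mul0r add0r.
  by case: (unliftP ord0 i) => [j ->|->]; rewrite ?H ?c0.
have -> : w = zeta ((cc ord0)^-1)%:P * (\sum_l zeta (a l) * b l - \sum_j zeta (cc (lift ord0 j))%:P * x j).
  by rewrite -Ha addrK mulrA -rmorphM -polyCM mulVf// polyC1 rmorph1 mul1r.
rewrite mulrBr -mulrN -sumrN !mulr_sumr; apply: PD.
  by under eq_bigr do rewrite mulrA -rmorphM; apply: Pb.
by under eq_bigr do rewrite -mulNr -rmorphN mulrA -rmorphM; apply: Px.
Qed.

End FiniteNormalization.

Lemma poly_XD (A : nzRingType) (p : {poly A}) :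
  exists q, p = q * 'X + (p`_0)%:P /\ (size q <= (size p).-1)%N.
Proof.
elim/poly_ind: p => [|q c _].
  by exists 0; rewrite coef0 polyC0 mul0r addr0 size_poly0.
exists q; rewrite coefD coefMX coefC /= add0r size_MXaddC; split=> //.
by case: ifP => // /andP[/eqP -> _]; rewrite size_poly0.
Qed.

(** * The valuation ring as a localization of an integral closure *)

Section ValuationRingGenerators.
Context (Rr : realType) (L K : fieldType) (v : valuation Rr K) (lam : {rmorphism L -> K}) (z : K).
Hypothesis vlam : forall c, c != 0 -> v (lam c) = 0%E.
Hypothesis vz : (0 < v z)%E.
Let zeta : {rmorphism {poly L} -> K} :=
  (horner_morph (horner_comm lam z) : {rmorphism {poly L} -> K}).
Context (B0 : nat).
Hypothesis bounded : forall n (bs : 'I_n -> K),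
  (forall Q : 'I_n -> {poly L}, \sum_i zeta (Q i) * bs i = 0 -> forall i, Q i = 0) -> (n <= B0)%N.
Hypothesis z0 : z != 0.

Let vzeta p : (0 <= v (zeta p))%E.
Proof.
elim/poly_ind: p => [|p c IH]; first by rewrite rmorph0 val0.
rewrite rmorphD rmorphM /zeta/= horner_morphX horner_morphC; apply: val_ge0D.
  by apply: val_ge0M => //; apply: ltW.
by have [->|/vlam ->//] := eqVneq c 0; rewrite rmorph0 val0.
Qed.

Let zetaS p c : zeta (p * 'X + c%:P) = zeta p * z + lam c.
Proof. by rewrite rmorphD rmorphM /zeta/= horner_morphX horner_morphC. Qed.

Let vzeta_unit p c : c != 0 -> v (zeta (p * 'X + c%:P)) = 0%E.
Proof. by move=> c0; rewrite zetaS addrC; apply: val_eq0D; [exact: vlam|exact: val_gt0Mr]. Qed.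

(** A polynomial in [z] with nonzero constant term has value 0, hence is not 0; so [z] is
    transcendental over [L]. *)
Lemma poly_eval_inj p : zeta p = 0 -> p = 0.
Proof.
elim/poly_ind: p => [//|p c IH] H.
have [c0|c0] := eqVneq c 0; last by have := vzeta_unit p c0; rewrite H val0.
move: H; rewrite zetaS c0 rmorph0 addr0 => /eqP.
by rewrite mulf_eq0 (negPf z0) orbF => /eqP/IH ->; rewrite mul0r addr0.
Qed.

(** Start from a relation among powers of [x] and divide it by [z] as long as all coefficients
    vanish at 0. A coefficient with nonzero constant term has value 0. *)
Let unit_relation x : exists p : {poly K}, [/\ forall i, integralOver zeta p`_i,
  root p x & exists i, v p`_i = 0%E].
Proof.
have [Q [Q0 [i Qi]]] : exists Q : 'I_B0.+1 -> {poly L}, \sum_i zeta (Q i) * x ^+ i = 0 /\ exists i, Q i != 0.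
  apply: contrapT => H; have : (B0.+1 <= B0)%N; last by rewrite ltnn.
  apply: (@bounded _ (fun i => x ^+ i)) => Q Q0 i; apply/eqP; apply: contrapT => /negP Qi.
  by apply: H; exists Q; split=> //; exists i.
have step m (F : 'I_B0.+1 -> {poly L}) : (size (F i) <= m)%N -> F i != 0 ->
    \sum_i zeta (F i) * x ^+ i = 0 ->
    exists F : 'I_B0.+1 -> {poly L}, \sum_i zeta (F i) * x ^+ i = 0 /\ exists i, (F i)`_0 != 0.
  elim: m F => [|m IH] F sF Fi F0.
    by move: sF; rewrite leqn0 size_poly_eq0 (negPf Fi).
  have [[j Hj]|no] := pselect (exists j, (F j)`_0 != 0); first by exists F; split=> //; exists j.
  have [G HG] := choice (fun j => poly_XD (F j)).
  have FE j : F j = G j * 'X.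
    rewrite {1}(HG j).1; set c := (F j)`_0.
    have -> : c = 0 by apply/eqP; apply: contrapT => /negP c0; apply: no; exists j.
    by rewrite polyC0 addr0.
  apply: (IH G).
  - by rewrite (leq_trans (HG i).2)// -subn1 leq_subLR add1n.
  - by apply: contraNneq Fi => e; rewrite FE e mul0r.
  apply: (mulIf z0); rewrite mul0r -[RHS]F0 mulr_suml; apply: eq_bigr => j _.
  rewrite [in RHS]FE rmorphM; have -> : zeta 'X = z by rewrite /zeta/= horner_morphX.
  by rewrite mulrAC.
have [F [F0 [j Fj]]] := step _ Q (leqnn _) Qi Q0.
exists (\poly_(l < B0.+1) zeta (F (inord l))); split.
- move=> l; rewrite coef_poly; case: ifP => _; [exact: integral_id|exact: integral0].
- apply/rootP; rewrite horner_poly -[RHS]F0; apply: eq_bigr => l _.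
  by rewrite inord_val.
exists j; rewrite coef_poly ltn_ord inord_val.
by have [q [-> _]] := poly_XD (F j); exact: vzeta_unit.
Qed.

(* With [a] the leading coefficient of [p], the element [a * x] is integral.  If [v a > 0], absorb
   [a * x] into the next coefficient. *)
Let local_rep m (p : {poly K}) x : (0 <= v x)%E -> (size p <= m)%N ->
  (forall i, integralOver zeta p`_i) -> root p x -> (exists i, v p`_i = 0%E) ->
  exists a b, [/\ integralOver zeta a, integralOver zeta b, v b = 0%E & x * b = a].
Proof.
move=> vx; elim: m p => [|m IH] p sp pint rp [i vi].
  by move: sp vi; rewrite leqn0 size_poly_eq0 => /eqP ->; rewrite coef0 val0.
have p0 : p != 0 by apply: contraTneq (val_eq0_neq0 vi) => ->; rewrite coef0 eqxx.
have vint y : integralOver zeta y -> (0 <= v y)%E by move=> iy; exact: (val_integral vzeta iy).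
pose a := lead_coef p.
have ia : integralOver zeta a by rewrite /a lead_coefE; apply: pint.
have iax : integralOver zeta (a * x) by apply: lead_coef_integral.
have [va|va] := eqVneq (v a) 0%E; first by exists (a * x), a; split=> //; rewrite mulrC.
have {}va : (0 < v a)%E by rewrite lt_neqAle eq_sym va vint.
case sr : (size p) => [|[|r]]; first by move: p0; rewrite -size_poly_eq0 sr.
  move: rp => /rootP; rewrite (size1_polyC (eq_leq sr)) hornerC => e.
  by move: p0; rewrite (size1_polyC (eq_leq sr)) e polyC0 eqxx.
have aE : p`_r.+1 = a by rewrite /a lead_coefE sr.
pose q := p - a%:P * 'X^r * ('X - x%:P).
have qE : q = p - a *: 'X^(r.+1) + (a * x) *: 'X^r.
  by rewrite /q -!mul_polyC polyCM exprSr; ring.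
have qc j : q`_j = p`_j - a *+ (j == r.+1) + (a * x) *+ (j == r).
  by rewrite qE !coefE; do 2 case: eqP => _ /=; rewrite ?mulr1 ?mulr0.
apply: (IH q).
- rewrite -ltnS (leq_trans _ sp)// sr ltnS; apply/leq_sizeP => j.
  rewrite leq_eqVlt => /orP[/eqP <-|lt].
    by rewrite qc eqxx aE subrr add0r gtn_eqF.
  by rewrite qc nth_default ?sr// !gtn_eqF ?subr0 ?addr0// ltnW.
- move=> j; rewrite qc; apply: integral_add; [apply: integral_sub => //|].
    by case: (_ == _); [|exact: integral0].
  by case: (_ == _); [|exact: integral0].
- by rewrite /root /q hornerD hornerN hornerM hornerXsubC (rootP rp) subrr mulr0 subr0.
have vax : (0 < v (a * x)%R)%E by apply: val_gt0Ml.
exists i; rewrite qc; have [ir|ir] := eqVneq i r.+1.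
  by move: vi; rewrite ir aE => e; rewrite e ltxx in va.
rewrite subr0; have [_|_] := eqVneq i r; first exact: val_eq0D.
by rewrite addr0.
Qed.

(** Every element of the valuation ring is a quotient of integral elements with denominator of value
    0. [P] is left open because the coefficients in [L] still have to be cleared of denominators. *)
Theorem vring_fractions : exists s : seq K, (forall x, x \in s -> (0 <= v x)%E) /\
  forall P : K -> Prop, P 0 -> (forall x y, P x -> P y -> P (x + y)) ->
    (forall p x, x \in s -> P (zeta p * x)) ->
    forall x, (0 <= v x)%E -> exists a b, [/\ P a, P b, v b = 0%E & x * b = a].
Proof.
have [s [si sP]] := integral_closure_fg poly_eval_inj bounded.
exists s; split=> [x /si xi|P P0 PD PM x vx]; first exact: (val_integral vzeta xi).
have [p [pint rp vp]] := unit_relation x.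
have [a [b [ia ib vb e]]] := local_rep vx (leqnn _) pint rp vp.
by exists a, b; split=> //; apply: sP.
Qed.

End ValuationRingGenerators.

(** * Filtration by word length *)

Section Words.
Context (P K : idomainType) (g : {rmorphism P -> K}) (et : seq K).

(* [words j x]: [x] is a [P]-linear combination of products of [j] elements of [1 :: et]. *)
Inductive words : nat -> K -> Prop :=
| wordsC a : words 0 (g a)
| wordsW j x of words j x : words j.+1 x
| wordsM j e x of e \in et & words j x : words j.+1 (e * x)
| wordsD j x y of words j x & words j y : words j (x + y).

Lemma words_le i j x : (i <= j)%N -> words i x -> words j x.
Proof.
move=> /subnK <-; elim: (j - i)%N => // n IH wx; rewrite addSn; exact: wordsW (IH wx).
Qed.

Lemma words_base j a : words j (g a).
Proof. exact: words_le (leq0n j) (wordsC a). Qed.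

Lemma words0 j : words j 0.
Proof. by rewrite -(rmorph0 g); apply: words_base. Qed.

Lemma words_mulC j a x : words j x -> words j (g a * x).
Proof.
elim=> [b|i u _ IH|i e u eet _ IH|i u w _ IHu _ IHw].
- by rewrite -rmorphM; apply: wordsC.
- exact: wordsW.
- by rewrite mulrCA; apply: wordsM.
- by rewrite mulrDr; apply: wordsD.
Qed.

Lemma wordsMM i j x y : words i x -> words j y -> words (i + j) (x * y).
Proof.
move=> wx wy; elim: wx => [a|i' u _ IH|i' e u eet _ IH|i' u w _ IHu _ IHw].
- exact: words_mulC.
- by rewrite addSn; apply: wordsW.
- by rewrite addSn -mulrA; apply: wordsM.
- by rewrite mulrDl; apply: wordsD.
Qed.

Lemma words_sum j (I : Type) (r : seq I) (Q : pred I) F :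
  (forall i, Q i -> words j (F i)) -> words j (\sum_(i <- r | Q i) F i).
Proof. by move=> H; apply: big_ind => //; [apply: words0|apply: wordsD]. Qed.

Definition alg x := exists j, words j x.

Lemma algD x y : alg x -> alg y -> alg (x + y).
Proof.
move=> [i wx] [j wy]; exists (maxn i j).
by apply: wordsD; [apply: words_le wx; apply: leq_maxl|apply: words_le wy; apply: leq_maxr].
Qed.

Lemma algM x y : alg x -> alg y -> alg (x * y).
Proof. by move=> [i wx] [j wy]; exists (i + j)%N; apply: wordsMM. Qed.

Lemma algC a : alg (g a).
Proof. by exists 0%N; apply: wordsC. Qed.

Lemma alg_mem e : e \in et -> alg e.
Proof. by move=> h; exists 1%N; rewrite -[e]mulr1 -(rmorph1 g); apply: wordsM => //; apply: wordsC. Qed.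

Lemma alg_prod (I : Type) (r : seq I) (Q : pred I) F :
  (forall i, Q i -> alg (F i)) -> alg (\prod_(i <- r | Q i) F i).
Proof.
move=> H; apply: big_ind => //; [|exact: algM].
by rewrite -(rmorph1 g); apply: algC.
Qed.

Lemma alg_ev (k : idomainType) (f : {rmorphism k -> K}) u n (p : iterpoly k n) :
  (forall c, alg (f c)) -> (forall i, (i < n)%N -> alg (u i)) -> alg (ev f u n p).
Proof.
move=> fa; elim: n p => [|n IH] p ua; first exact: fa.
rewrite (evS f u (leqnn (size (p : {poly iterpoly k n})))).
apply: big_ind => [||i _]; [by rewrite -(rmorph0 g); apply: algC|exact: algD|].
apply: algM; first by apply: IH => j /ltnW; apply: ua.
elim: (nat_of_ord i) => [|j IHj]; first by rewrite expr0 -(rmorph1 g); apply: algC.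
by rewrite exprS; apply: algM => //; apply: ua.
Qed.

Lemma alg_common (I : finType) (x : I -> K) : (forall i, alg (x i)) ->
  exists j, forall i, words j (x i).
Proof.
move=> /choice[j Hj]; exists (\max_i j i)%N => i.
by apply: words_le (Hj i); apply: leq_bigmax.
Qed.

(* The Rees algebra of the filtration [words], as a quotient of a polynomial ring over [P]. *)
Let r := size et.
(** The entry 1 makes the variable of index 0 act as ['X], which realizes the inclusion of words of
    length [j] among those of length [j.+1]. *)
Let eta i := nth 1 (1 :: et) i.
Definition rees : {rmorphism iterpoly P r.+1 -> {poly K}} :=
  ev (polyC \o g : {rmorphism P -> {poly K}}) (fun i => (eta i)%:P * 'X) r.+1.

Lemma rees_surj j x : words j x -> exists F, rees F = x%:P * 'X^j.
Proof.
elim=> [a|i u _ [F HF]|i e u eet _ [F HF]|i u w _ [F HF] _ [G HG]].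
- by exists (iterpolyC P r.+1 a); rewrite /rees evC mulr1.
- exists (iterpolyX P r.+1 0 * F); rewrite rmorphM HF /rees evX//= polyC1 mul1r exprS.
  by rewrite mulrCA.
- exists (iterpolyX P r.+1 (index e et).+1 * F).
  rewrite rmorphM HF /rees evX ?ltnS ?index_mem// /eta /= nth_index// polyCM exprS; ring.
- by exists (F + G); rewrite rmorphD HF HG polyCD mulrDl.
Qed.

Lemma rees_coef F i : words i (rees F)`_i.
Proof.
pose graded (h : {poly K}) := forall i, words i h`_i.
have gD h h' : graded h -> graded h' -> graded (h + h').
  by move=> gh gh' j; rewrite coefD; apply: wordsD.
have gM h h' : graded h -> graded h' -> graded (h * h').
  move=> gh gh' j; rewrite coefM; apply: words_sum => l _.
  by have := wordsMM (gh l) (gh' (j - l)%N); rewrite subnKC// -ltnS ltn_ord.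
have gC a : graded (g a)%:P.
  by move=> j; rewrite coefC; case: eqP => _; [apply: words_base|apply: words0].
have gX n : graded ((eta n)%:P * 'X).
  move=> j; rewrite coefMX; case: j => [|j]; first exact: words0.
  rewrite coefC /=; case: eqP => [->|_]; last exact: words0.
  have [lt|ge] := ltnP n r.+1; last first.
    by rewrite /eta nth_default// -(rmorph1 g); apply: words_base.
  case: n lt => [_|n lt]; first by rewrite /eta /= -(rmorph1 g); apply: words_base.
  by rewrite /eta /= -[nth 1 et n]mulr1 -(rmorph1 g); apply: wordsM; [apply: mem_nth|apply: wordsC].
move: i; rewrite -/(graded _) /rees; elim: r.+1 F => [|n IH] F; first exact: gC.
rewrite (evS _ _ (leqnn (size (F : {poly iterpoly P n})))); apply: big_ind => [||l _].
- by move=> j; rewrite coef0; apply: words0.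
- exact: gD.
apply: (gM); first exact: IH.
elim: (nat_of_ord l) => [|m IHm]; first by rewrite expr0 -polyC1 -(rmorph1 g); apply: gC.
by rewrite exprS; apply: gM.
Qed.

End Words.

Section WordsValuation.
Context (Rr : realType) (P : idomainType) (K : fieldType) (v : valuation Rr K).
Context (g : {rmorphism P -> K}) (et : seq K).
Hypothesis vg : forall a, (0 <= v (g a))%E.
Hypothesis vet : forall e, e \in et -> (0 <= v e)%E.
Hypothesis nP : noeth P.
Let wd := words g et.

Lemma words_val j x : wd j x -> (0 <= v x)%E.
Proof.
elim=> [a|i u _ //|i e u eet _ IH|i u w _ IHu _ IHw]; first exact: vg.
- by apply: val_ge0M => //; apply: vet.
- exact: val_ge0D.
Qed.

(** Noetherianity is applied to the polynomial ring over the Rees algebra, on the ideal of all [F]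
    whose image has coefficients of positive value. Reading off degree [j] then bounds the word
    length of the cofactors, with one [Phi] for all [j]. *)
Lemma center_generators : exists Phi : seq K,
  (forall x, x \in Phi -> (0 < v x)%E /\ alg g et x) /\
  forall j f, wd j f -> (0 < v f)%E ->
    exists c : 'I_(size Phi) -> K, (forall i, wd j (c i)) /\ f = \sum_i c i * Phi`_i.
Proof.
have vrees F i : (0 <= v (rees g et F)`_i)%E by apply: (@words_val i); apply: rees_coef.
pose I F := forall i, (0 < v (rees g et F)`_i)%E.
have Iid : is_ideal I.
  split=> [i|F G IF IG i|F G IG i].
  - by rewrite rmorph0 coef0 val0.
  - by rewrite rmorphD coefD; apply: val_gt0D.
  - by rewrite rmorphM coefM; apply: val_gt0_sum => l _; apply: val_gt0Mr.
have [s [sI sS]] := noeth_ip nP Iid.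
pose Phi := flatten [seq (rees g et F : seq K) | F <- s].
exists Phi; split.
  move=> x /flattenP[_ /mapP[F Fs ->]] /(nthP 0)[i lt <-].
  by split; [apply: sI|exists i; apply: rees_coef].
pose Q j x := exists c : 'I_(size Phi) -> K, (forall i, wd j (c i)) /\ x = \sum_i c i * Phi`_i.
have Q0 j : Q j 0.
  exists (fun _ => 0); split=> [i|]; first exact: words0.
  by rewrite big1// => i _; rewrite mul0r.
have QD j x y : Q j x -> Q j y -> Q j (x + y).
  move=> [c [Hc ->]] [c' [Hc' ->]]; exists (fun i => c i + c' i); split.
    by move=> i; apply: wordsD; [exact: Hc|exact: Hc'].
  by rewrite -big_split; apply: eq_bigr => i _; rewrite mulrDl.
have QM j c x : wd j c -> x \in Phi -> Q j (c * x).
  move=> wc /(nthP 0)[i lt <-]; exists (fun l => if l == Ordinal lt then c else 0); split.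
    by move=> l; case: eqP => _ //; apply: words0.
  by rewrite (bigD1 (Ordinal lt)) //= eqxx big1 ?addr0// => l /negPf ->; rewrite mul0r.
move=> j f wf vf; have [F HF] := rees_surj wf.
have IF : I F.
  move=> i; rewrite HF coefMXn; case: ifP => _; first by rewrite val0.
  by rewrite coefC; case: ifP => _ //; rewrite val0.
have -> : f = (rees g et F)`_j by rewrite HF coefMXn ltnn subnn coefC eqxx.
elim: (sS F IF) => [|c u w us _ IH]; first by rewrite rmorph0 coef0; apply: Q0.
rewrite rmorphD (_ : c *: (u : (iterpoly P (size et).+1)^o) = c * u)// rmorphM coefD.
apply: (QD) => //; rewrite coefM; apply: big_ind => [||l _]; [exact: Q0|exact: QD|].
have [lt|ge] := ltnP (j - l)%N (size (rees g et u)); last first.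
  by rewrite [X in _ * X]nth_default// mulr0; apply: Q0.
apply: QM; first by apply: (@words_le _ _ _ _ l); [rewrite -ltnS ltn_ord|apply: rees_coef].
apply/flattenP; exists (rees g et u : seq K); last exact: mem_nth.
exact: (map_f (fun F => (rees g et F : seq K)) us).
Qed.

Hypothesis frac : forall x, (0 <= v x)%E ->
  exists a b, [/\ alg g et a, alg g et b, v b = 0%E & x * b = a].

Lemma val_div_ge0 x y : y != 0 -> (v y <= v x)%E -> (0 <= v (x / y)%R)%E.
Proof.
move=> y0; have := valM v (x / y) y; rewrite divfK// => ->.
have := val_fin v y0; case: (v y) => // b _.
case: (v (x / y)) (val_neqNy v (x / y)) => [a| |] //= _.
by rewrite -EFinD !lee_fin lerDr.
Qed.

(* [u] has least value among finitely many generators of the center, and [h] is a common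
   denominator of the quotients of these generators by [u]. *)
Lemma uniformizer z : alg g et z -> z != 0 -> (0 < v z)%E -> exists c u h,
  [/\ wd c u, wd c h, v h = 0%E, u != 0 /\ (0 < v u)%E &
      forall j f, wd j f -> (0 < v f)%E -> exists f', wd (j + c) f' /\ h * f = u * f'].
Proof.
move=> [jz wz] z0 vz.
have [Phi [PhiP PhiS]] := center_generators.
have [u [uPhi umin]] : exists u, u \in Phi /\ forall x, x \in Phi -> (v u <= v x)%E.
  have : Phi != [::].
    apply: contraNneq z0 => Phi0; have [c [_ ->]] := PhiS _ _ wz vz.
    rewrite big1// => i _; exfalso; have := leq_ltn_trans (leq0n i) (ltn_ord i).
    by clear -Phi0; rewrite Phi0.
  elim: (Phi) => // x l IH _; have [->|l0] := eqVneq l [::].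
    by exists x; rewrite mem_head; split=> // y; rewrite mem_seq1 => /eqP->.
  have [w [wl wmin]] := IH l0; have [le|le] := leP (v x) (v w).
    exists x; rewrite mem_head; split=> // y; rewrite inE => /orP[/eqP->//|/wmin].
    exact: le_trans.
  exists w; rewrite inE wl orbT; split=> // y; rewrite inE => /orP[/eqP->|/wmin//].
  exact: ltW.
have u0 : u != 0.
  apply: contraNneq z0 => u0; have [c [_ ->]] := PhiS _ _ wz vz.
  rewrite big1// => i _; have := umin Phi`_i (mem_nth 0 (ltn_ord i)).
  by rewrite u0 val0 leye_eq => /eqP/val_eqyP ->; rewrite mulr0.
have vu : (0 < v u)%E by have [] := PhiP u uPhi.
have /choice[a /choice[b Hab]] (i : 'I_(size Phi)) : exists a b,
    [/\ alg g et a, alg g et b, v b = 0%E & Phi`_i / u * b = a].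
  by apply: frac; apply: val_div_ge0 => //; apply: umin; apply: mem_nth.
pose h := \prod_i b i; pose q i := a i * \prod_(l | l != i) b l.
have qE (i : 'I_(size Phi)) : h * Phi`_i = u * q i.
  have [_ _ _ e] := Hab i; rewrite /h /q (bigD1 i) //= -e; field.
  by rewrite u0.
have vh : v h = 0%E.
  by apply: (big_ind (fun x => v x = 0%E)) => [||i _]; [exact: val1|exact: val_eq0M|have [] := Hab i].
have [c Hc] : exists c, forall o : option (option 'I_(size Phi)),
    wd c (if o is Some o' then (if o' is Some i then q i else h) else u).
  apply: alg_common => -[[i|]|].
  - by apply: algM; [have [] := Hab i|apply: alg_prod => l _; have [] := Hab l].
  - by apply: alg_prod => l _; have [] := Hab l.
  - by have [] := PhiP u uPhi.
exists c, u, h; split=> //; [exact: (Hc None)|exact: (Hc (Some None))|].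
move=> j f wf vf; have [co [wco ->]] := PhiS j f wf vf.
exists (\sum_i co i * q i); split.
  by apply: words_sum => i _; apply: wordsMM; [exact: wco|exact: (Hc (Some (Some i)))].
rewrite !mulr_sumr; apply: eq_bigr => i _.
by rewrite mulrCA qE mulrCA.
Qed.

(** As [v h = 0], each division lowers the value by exactly [v u], and positivity is needed only
    before each of the [m] divisions. This allows a real threshold to be rounded up to a multiple of
    [v u]. *)
Lemma uniformizer_iter c u h m j f :
  v h = 0%E -> u != 0 -> (0 < v u)%E ->
  (forall j f, wd j f -> (0 < v f)%E -> exists f', wd (j + c) f' /\ h * f = u * f') ->
  wd j f -> ((0 < m)%N -> ((m.-1)%:R%:E * v u < v f)%E) ->
  exists f', wd (j + c * m) f' /\ h ^+ m * f = u ^+ m * f'.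
Proof.
move=> vh u0 vu H; have := val_fin v u0; case vuE : (v u) vu => [e| |] // e0 _.
rewrite lte_fin in e0.
elim: m j f => [|m IH] j f wf vf; first by exists f; rewrite muln0 addn0 !mul1r.
have vf0 : (0 < v f)%E.
  by apply: le_lt_trans (vf isT); rewrite -EFinM lee_fin mulr_ge0// ltW.
have [f1 [wf1 E1]] := H j f wf vf0.
have [|f2 [wf2 E2]] := IH _ _ wf1.
  move=> m0; have := vf isT; have := congr1 v E1; rewrite !valM vh add0e vuE => ->.
  rewrite /= -!EFinM; case: (v f1) (val_neqNy v f1) => [b _|_ _|//]; last by rewrite ltry.
  by rewrite -EFinD !lte_fin -{1}(prednK m0) -natr1 mulrDl mul1r addrC ltrD2l.
exists f2; rewrite mulnS addnA; split=> //.
by rewrite exprSr -mulrA E1 mulrCA E2 exprS mulrA.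
Qed.

End WordsValuation.

(** * Uniformizers of divisorial valuations *)

Lemma frac_extend (A : idomainType) (K : fieldType) (f : {rmorphism A -> K}) :
  (forall a, f a = 0 -> a = 0) ->
  exists lam : {rmorphism {fraction A} -> K}, forall x a b, b != 0 -> x * b%:F = a%:F -> lam x = f a / f b.
Proof.
move=> fi.
have f0 b : b != 0 -> f b != 0 by apply: contraNneq => /fi ->.
have /choice[nm /choice[dn H]] (x : {fraction A}) := frac_rep x.
pose lam x := f (nm x) / f (dn x).
have lamE x a b : b != 0 -> x * b%:F = a%:F -> lam x = f a / f b.
  move=> b0 E; have [d0 Ex] := H x.
  apply/eqP; rewrite eqr_div ?f0// -!rmorphM; apply/eqP; congr (f _).
  by apply/eqP; rewrite -tofrac_eq !tofracM -Ex -E; apply/eqP; ring.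
have lamz : zmod_morphism lam.
  move=> x y; have [dx Ex] := H x; have [dy Ey] := H y.
  rewrite (lamE (x - y) (nm x * dn y - nm y * dn x) (dn x * dn y)) ?mulf_neq0//.
    rewrite /lam rmorphB !rmorphM; field.
    by rewrite !f0.
  by rewrite tofracB !tofracM -Ex -Ey; ring.
have lamm : monoid_morphism lam.
  split; first by rewrite (lamE 1 1 1) ?oner_neq0 ?rmorph1 ?divr1 ?mul1r.
  move=> x y; have [dx Ex] := H x; have [dy Ey] := H y.
  rewrite (lamE (x * y) (nm x * nm y) (dn x * dn y)) ?mulf_neq0//.
    by rewrite /lam !rmorphM; field; rewrite !f0.
  by rewrite !tofracM -Ex -Ey; ring.
pose l1 := GRing.isZmodMorphism.Build _ _ lam lamz.
pose l2 := GRing.isMonoidMorphism.Build _ _ lam lamm.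
pose L : {rmorphism {fraction A} -> K} := HB.pack lam l1 l2.
by exists L.
Qed.

Lemma clear_fraction (F : fieldType) (a a' b x y : F) : a' != 0 ->
  a * a' * (x * y + b / a') = a' * y * (a * x) + a * b.
Proof. by move=> ?; field. Qed.

Section ValuationData.
Context (Rr : realType) (k : fieldType) (R : idomainType) (N : nat).
Context (psi : {rmorphism iterpoly k N -> R}) (lpsi : localizes psi).
Context (v : valuation_on Rr R) (dv : divisorial v).
Let K := {fraction R} : fieldType.
Let g := to_frac psi.
Let ka : {rmorphism k -> K} := (g \o iterpolyC k N : {rmorphism k -> K}).

Let vg a : (0 <= v (g a))%E.
Proof. exact: val_of_ge0. Qed.

Let ka_unit c : c != 0 -> v (ka c) = 0%E.
Proof.
move=> c0; apply/eqP; rewrite eq_le vg andbT.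
have /eqP := valM v (ka c) (ka c^-1); rewrite -rmorphM mulfV// rmorph1 val1 => /eqP e.
by rewrite e leeDl// vg.
Qed.

(** The residues of the [d.-1] elements [w] are independent over [k], so [v] is trivial on the field
    [L] they generate. For a nonzero [z] in the center, [K] has finite degree over [L(z)], and the
    theory in one variable applies over [L]. *)
Theorem divisorial_uniformizer : exists (et : seq K) c u h,
  [/\ forall e, e \in et -> (0 <= v e)%E, v h = 0%E, u != 0 /\ (0 < v u)%E &
    forall m F, ((0 < m)%N -> ((m.-1)%:R%:E * v u < v (g F))%E) ->
      exists f', words g et (c * m) f' /\ h ^+ m * g F = u ^+ m * f'].
Proof.
have [d [y [J [b nn]]]] := noether_normalization g.
have [w [vw iw]] := divisorial_transcendence lpsi nn dv.
have [z [z0 vz]] := divisorial_center_neq0 dv.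
have d_gt0 : (0 < d)%N.
  apply: (indep_size_le nn (u := fun _ => z%:F)) => [i _|Q]; first exact: to_frac_rep.
  have zF0 : z%:F != 0 :> K by rewrite tofrac_eq0.
  exact: (poly_eval_inj ka_unit vz zF0).
case: d nn w vw iw d_gt0 => // e nn w vw iw _.
pose B := iterpoly k e.
have [ew_ge0 ew_unit] : (forall be : B, (0 <= v (ev ka w e be))%E) /\
    forall be : B, be != 0 -> v (ev ka w e be) = 0%E.
  have ge0 (be : B) : (0 <= v (ev ka w e be))%E.
    have vw' x : x \in [seq w i | i <- iota 0 e] -> (0 <= v x)%E.
      by move=> /mapP[i]; rewrite mem_iota add0n => /andP[_ lt] ->; apply: vw.
    have [j wj] : alg g [seq w i | i <- iota 0 e] (ev ka w e be).
      apply: alg_ev => [c|i lt]; first exact: (algC g _ (iterpolyC k N c)).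
      by apply: alg_mem; apply: map_f; rewrite mem_iota.
    exact: (words_val vg vw' wj).
  split=> // be be0; apply/eqP; rewrite eq_le ge0 andbT leNgt.
  by apply: contra be0 => /iw ->.
have ew_inj (be : B) : ev ka w e be = 0 -> be = 0.
  by move=> H; apply: iw; rewrite H val0.
have [lam lamE] := frac_extend ew_inj.
have lamF (be : B) : lam be%:F = ev ka w e be.
  by rewrite (lamE _ be 1) ?oner_neq0 ?rmorph1 ?mulr1 ?divr1.
have lam_unit c : c != 0 -> v (lam c) = 0%E.
  move=> c0; have [a [a' [a'0 E]]] := frac_rep c.
  rewrite (lamE _ _ _ a'0 E); apply: val_eq0M; last by apply/val_eq0V/ew_unit.
  apply: ew_unit; rewrite -tofrac_eq0 -E mulf_neq0// tofrac_eq0//.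
have zF0 : z%:F != 0 :> K by rewrite tofrac_eq0.
pose u' i : K := if (i < e)%N then w i else z%:F.
have u'e : u' e = z%:F by rewrite /u' ltnn.
(* [w] and [z] together are as many as the parameters of the normalization, which bounds the rank of
   [K] over the polynomials in them. *)
have [B0 HB0] := jindep_bounded nn (fun i _ => to_frac_rep lpsi (u' i)).
pose zeta : {rmorphism {poly {fraction B}} -> K} :=
  (horner_morph (horner_comm lam z%:F) : {rmorphism {poly {fraction B}} -> K}).
have zetaE (Q : iterpoly k e.+1) : zeta (map_poly (@FracField.tofrac B) (Q : {poly B})) = ev ka u' e.+1 Q.
  elim/(@poly_ind B): Q => [|p c IH]; first by rewrite !rmorph0.
  rewrite !rmorphD !rmorphM /= map_polyX map_polyC IH ev_polyX ev_polyC u'e.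
  rewrite /zeta /= horner_morphX horner_morphC /= lamF; congr (_ + _).
    by rewrite -u'e.
  by apply: (@eq_ev k K ka w u' e c) => i lt; rewrite /u' lt.
have bounded n (bs : 'I_n -> K) : (forall Q : 'I_n -> {poly {fraction B}},
    \sum_i zeta (Q i) * bs i = 0 -> forall i, Q i = 0) -> (n <= B0)%N.
  move=> free; apply: (HB0 n bs) => [i|Q Q0 i]; first exact: to_frac_rep.
  have /polyP H : map_poly (@FracField.tofrac B) (Q i : {poly B}) = 0.
    apply: (free (fun i => map_poly (@FracField.tofrac B) (Q i : {poly B}))).
    by rewrite -[RHS]Q0; apply: eq_bigr => l _; rewrite zetaE.
  apply/(@polyP B) => l; have /eqP := H l.
  by rewrite coef_map !coef0 tofrac_eq0 => /eqP ->.
have [s [vs sP]] := vring_fractions lam_unit vz bounded zF0.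
pose et := z%:F :: [seq w i | i <- iota 0 e] ++ s.
have vet x : x \in et -> (0 <= v x)%E.
  rewrite inE mem_cat => /or3P[/eqP->|/mapP[i]|/vs//]; first exact: ltW.
  by rewrite mem_iota add0n => /andP[_ lt] ->; apply: vw.
have alg_w (be : B) : alg g et (ev ka w e be).
  apply: alg_ev => [c|i lt]; first exact: (algC g _ (iterpolyC k N c)).
  by apply: alg_mem; rewrite inE mem_cat (map_f w) ?mem_iota ?orbT.
have alg_z : alg g et z%:F by apply: alg_mem; rewrite mem_head.
(* Coefficients in [{fraction B}] bring denominators into the generators. These are nonzero
   polynomials in [w], of value 0, and can be multiplied into both numerator and denominator. *)
pose Pr x := exists be : B, be != 0 /\ alg g et (ev ka w e be * x).
have Pr0 : Pr 0.
  by exists 1; rewrite oner_neq0 mulr0; split=> //; rewrite -(rmorph0 g); apply: algC.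
have PrD x1 x2 : Pr x1 -> Pr x2 -> Pr (x1 + x2).
  move=> [be [be0 H]] [be' [be'0 H']].
  exists (be * be'); rewrite mulf_neq0// rmorphM mulrDr; split=> //; apply: algD.
    by rewrite mulrAC mulrC; apply: algM.
  by rewrite -mulrA; apply: algM.
have Prz p : Pr (zeta p).
  elim/poly_ind: p => [|p c [be [be0 H]]]; first by rewrite rmorph0.
  have [a [a' [a'0 E]]] := frac_rep c.
  exists (be * a'); rewrite mulf_neq0//; split=> //.
  have -> : zeta (p * 'X + c%:P) = zeta p * z%:F + lam c.
    by rewrite rmorphD rmorphM /zeta /= horner_morphX horner_morphC.
  rewrite (lamE _ _ _ a'0 E) rmorphM.
  have -> : ev ka w e be * ev ka w e a' * (zeta p * z%:F + ev ka w e a / ev ka w e a') =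
      ev ka w e a' * z%:F * (ev ka w e be * zeta p) + ev ka w e be * ev ka w e a.
    by apply: clear_fraction; apply: contraNneq a'0 => /ew_inj ->.
  by apply: algD; apply: algM => //; apply: algM.
have PrM p x : x \in s -> Pr (zeta p * x).
  move=> xs; have [be [be0 H]] := Prz p.
  exists be; split=> //; rewrite mulrA; apply: algM => //.
  by apply: alg_mem; rewrite inE mem_cat xs !orbT.
have frac x : (0 <= v x)%E -> exists a b, [/\ alg g et a, alg g et b, v b = 0%E & x * b = a].
  move=> vx; have [a [b' [[be [be0 H]] [be' [be'0 H']] vb E]]] := sP Pr Pr0 PrD PrM x vx.
  exists (ev ka w e (be * be') * a), (ev ka w e (be * be') * b'); split.
  - by rewrite rmorphM mulrAC mulrC; apply: algM.
  - by rewrite rmorphM -mulrA; apply: algM.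
  - by apply: val_eq0M => //; apply: ew_unit; rewrite mulf_neq0.
  - by rewrite mulrCA E.
have nP : noeth (iterpoly k N) := @noeth_ip k N (@noeth_field k).
have [c [u [h [wu wh vh [u0 vu] H]]]] := uniformizer vg vet nP frac alg_z zF0 vz.
exists et, c, u, h; split=> // m F vF.
exact: (uniformizer_iter vh u0 vu H (wordsC g et F) vF).
Qed.

End ValuationData.

(** * Valuation ideals as colon ideals *)

Section ValuationColon.
Context (Rr : realType) (k K : fieldType) (N : nat) (g : {rmorphism iterpoly k N -> K}).
Context (v : valuation Rr K).
Hypothesis vg : forall a, (0 <= v (g a))%E.
Hypothesis frac_g : forall x, exists a w, g w != 0 /\ x * g w = g a.
Let P := iterpoly k N.

Definition monomials (xs : seq P) j (x : P) :=
  exists l : seq P, [/\ size l = j, {subset l <= xs} & x = \prod_(y <- l) y].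

(** [w] is itself among [xs]: it pads shorter words, so that after multiplication by [g w ^+ j]
    every product has exactly [j] factors. *)
Let words_monomials et w (xs : seq P) j f : g w != 0 -> w \in xs ->
  (forall e, e \in et -> exists2 x, x \in xs & e * g w = g x) ->
  words g et j f -> exists a, ispan (monomials xs j) a /\ g w ^+ j * f = g a.
Proof.
move=> w0 wxs Het.
have step x i a : x \in xs -> ispan (monomials xs i) a -> ispan (monomials xs i.+1) (x * a).
  move=> xx; elim=> [|c u u' [l [sl sub uE]] _ IH]; first by rewrite mulr0; apply: lspan0.
  have -> : x * (c *: (u : P^o) + u') = c *: (x * u : P^o) + x * u'.
    by rewrite /GRing.scale /=; ring.
  apply: lspanS => //; exists (x :: l); split; [by rewrite /= sl| |by rewrite big_cons uE].
  by move=> y; rewrite inE => /orP[/eqP->|/sub].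
elim=> [a|i u _ [a [Ha E]]|i e u /Het[x xx ex] _ [a [Ha E]]|i u u' _ [a [Ha E]] _ [a' [Ha' E']]].
- exists a; split; last by rewrite mul1r.
  have := @lspan_in _ P^o (monomials xs 0) 1 _; move=> /(_ _)/(lspanZ a); rewrite /GRing.scale /= mulr1.
  by apply; exists [::]; rewrite big_nil.
- by exists (w * a); split; [apply: step|rewrite rmorphM -E exprS mulrA].
- by exists (x * a); split; [apply: step|rewrite rmorphM -E -ex exprS; ring].
- by exists (a + a'); split; [apply: lspanD|rewrite rmorphD -E -E' mulrDr].
Qed.

Let monomials_words et w (xs : seq P) j a : g w != 0 ->
  (forall x, x \in xs -> words g et 1 (g x / g w)) ->
  ispan (monomials xs j) a -> words g et j (g a / g w ^+ j).
Proof.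
move=> w0 Hxs; elim=> [|c u u' [l [sl sub ->]] _ IH].
  by rewrite rmorph0 mul0r; apply: words0.
rewrite (_ : c *: (_ : P^o) + u' = c * \prod_(y <- l) y + u')//.
rewrite rmorphD rmorphM mulrDl -mulrA; apply: wordsD => //; apply: words_mulC.
elim: l j sl sub {IH} => [|x l IH] j <- sub /=.
  by rewrite big_nil expr0 divr1; apply: wordsC.
have -> : g (\prod_(y <- x :: l) y) / g w ^+ (size l).+1 =
    (g x / g w) * (g (\prod_(y <- l) y) / g w ^+ size l).
  by rewrite mulf_div big_cons rmorphM exprS.
apply: (@wordsMM _ _ g et 1%N); first by apply: Hxs; apply: sub; rewrite mem_head.
by apply: IH => // y yl; apply: sub; rewrite inE yl orbT.
Qed.

(** Multiplied by [g w ^+ (m + c * m)], the equation [h ^+ m * g F = u ^+ m * f'] lifts to the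
    polynomial ring modulo the kernel of [g]. Conversely it forces a value of at least [m * v u],
    since words have nonnegative value. *)
Theorem valuation_colon et c u h (la : Rr) :
  (forall e, e \in et -> (0 <= v e)%E) -> v h = 0%E -> u != 0 -> (0 < v u)%E ->
  (forall m F, ((0 < m)%N -> ((m.-1)%:R%:E * v u < v (g F))%E) ->
     exists f', words g et (c * m) f' /\ h ^+ m * g F = u ^+ m * f') ->
  0 < la -> exists A : nat, forall n, exists (al : P) (X : P -> Prop),
  [/\ dle (A * n.+1) al, forall x, X x -> dle (A * n.+1) x &
      forall F, ((n%:R * la)%:E <= v (g F))%E <-> ispan X (F * al)].
Proof.
move=> vet vh u0 vu H la0.
pose T := option (option 'I_(size et)).
pose tx (o : T) : K := if o is Some o' then (if o' is Some i then et`_i else h) else u.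
have [w [x [w0 Hx]]] := @clear_denom P K g T tx (rmorph0 _) (rmorph1 _) (rmorphM _)
  (fun i => frac_g (tx i)).
pose u' := x None; pose h' := x (Some None).
have uE : u * g w = g u' by exact: (Hx None).
have hE : h * g w = g h' by exact: (Hx (Some None)).
pose xs := w :: [seq x (Some (Some i)) | i <- enum 'I_(size et)].
have kid : is_ideal (fun y => g y = 0).
  by split=> [|a b ea eb|a b eb]; rewrite ?rmorph0 ?rmorphD ?rmorphM ?eb ?ea ?addr0 ?mulr0.
have [ks [ksk ksS]] := @noeth_ip k N (@noeth_field k) _ kid.
have [de Hde] := dle_exists_seq ([:: u', h' & xs] ++ ks).
have := val_fin v u0; case ve : (v u) vu => [e| |] // e0 _; rewrite lte_fin in e0.
(* [la <= M * e] makes the least [m] with [n * la <= m * e] at most [n * M], so all exponents are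
   linear in [n]. *)
pose M := (Num.truncn (la / e)).+1.
have HM : la <= M%:R * e.
  rewrite -ler_pdivrMr//; apply: ltW; exact: truncnS_gt.
exists ((M + c * M) * de + de)%N => n.
have exm : exists m : nat, n%:R * la <= m%:R * e.
  by exists (n * M)%N; rewrite natrM -mulrA ler_wpM2l.
case: (ex_minnP exm) => m mP mmin.
have mle : (m <= n * M)%N by apply: mmin; rewrite natrM -mulrA ler_wpM2l.
(* The equation holds only after applying [g]; hence the generators [ks] of its kernel, which do not
   depend on [n]. *)
pose X y := (exists2 a, monomials xs (c * m) a & y = u' ^+ m * a) \/ y \in ks.
exists (h' ^+ m * w ^+ (c * m)), X.
have bound : (m * de + c * m * de <= ((M + c * M) * de + de) * n.+1)%N.
  rewrite -mulnDl (@leq_trans ((M + c * M) * de * n.+1))//; last by rewrite leq_mul2r leq_addr orbT.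
  rewrite mulnAC leq_mul2r; apply/orP; right; rewrite mulnDl leq_add//.
    by rewrite (leq_trans mle)// mulnC leq_mul2l leqnSn orbT.
  by rewrite -mulnA leq_mul2l (leq_trans mle) ?orbT// mulnC leq_mul2l leqnSn orbT.
split.
- apply: (dle_le bound); apply: dleM; apply: dle_exp; apply: Hde; rewrite !inE eqxx ?orbT//.
- move=> y [[a [l [sl sub ->]] ->]|yk]; last first.
    apply: (@dle_le _ _ de); last by apply: Hde; rewrite mem_cat yk orbT.
    by rewrite mulnDl; apply: leq_trans (leq_addl _ _); apply: leq_pmulr.
  apply: (dle_le bound); apply: dleM; first by apply: dle_exp; apply: Hde; rewrite !inE eqxx.
  rewrite -sl; have : forall y, y \in l -> dle de y.
    by move=> z /sub zx; apply: Hde; rewrite mem_cat !inE in zx *; rewrite zx !orbT.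
  elim: l {sl sub} => [|z l IH] Hl; first by rewrite big_nil; apply: dle1.
  rewrite big_cons mulSn; apply: dleM; first by apply: Hl; rewrite mem_head.
  by apply: IH => y' yl; apply: Hl; rewrite inE yl orbT.
move=> F; split=> [vF|].
  (* Minimality of [m] gives [(m - 1) * e < n * la], the strict inequality required by [H]. *)
  have [|f' [wf' E]] := H m F.
    move=> m0; apply: lt_le_trans vF; rewrite ve -EFinM lte_fin ltNge; apply/negP => /mmin.
    by rewrite -{1}(prednK m0) ltnn.
  have [||a [Ha Ea]] := @words_monomials et w xs (c * m) f' w0 _ _ wf'; first exact: mem_head.
    move=> y yet; have lt : (index y et < size et)%N by rewrite index_mem.
    exists (x (Some (Some (Ordinal lt)))); last first.
      by have := Hx (Some (Some (Ordinal lt))); rewrite /= nth_index.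
    by rewrite inE map_f ?mem_enum ?orbT.
  have k0 : g (F * (h' ^+ m * w ^+ (c * m)) - u' ^+ m * a) = 0.
    rewrite rmorphB !rmorphM !rmorphXn -Ea -uE -hE !exprMn.
    have -> : g F * (h ^+ m * g w ^+ m * g w ^+ (c * m)) = (h ^+ m * g F) * (g w ^+ m * g w ^+ (c * m)) by ring.
    by rewrite E; ring.
  rewrite -(subrK (u' ^+ m * a) (F * _)); apply: lspanD.
    by apply: lspan_trans (ksS _ k0) => y yk; apply: lspan_in; right.
  elim: Ha {Ea k0} => [|b y y' Hy _ IH]; first by rewrite mulr0; apply: lspan0.
  have -> : u' ^+ m * (b *: (y : P^o) + y') = b *: (u' ^+ m * y : P^o) + u' ^+ m * y'.
    by rewrite /GRing.scale /=; ring.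
  by apply: lspanS => //; left; exists y.
move=> HF.
have [a [Ha Ea]] : exists a, ispan (monomials xs (c * m)) a /\ g (F * (h' ^+ m * w ^+ (c * m))) = g (u' ^+ m * a).
  elim: HF => [|b y y' Hy _ [a [Ha Ea]]]; first by exists 0; rewrite mulr0; split=> //; apply: lspan0.
  rewrite (_ : b *: (y : P^o) + y' = b * y + y')//.
  case: Hy => [[a' Ha' ->]|/ksk yk].
    exists (b * a' + a); split; first exact: lspanS.
    by rewrite [LHS]rmorphD Ea mulrDr [RHS]rmorphD mulrCA.
  exists a; split=> //.
  by rewrite rmorphD Ea (rmorphM g b) yk mulr0 add0r.
have wa : words g et (c * m) (g a / g w ^+ (c * m)).
  apply: (@monomials_words et w xs) => // y; rewrite inE => /orP[/eqP->|/mapP[i _ ->]].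
    by rewrite divff// -(rmorph1 g); apply: words_base.
  have -> : g (x (Some (Some i))) / g w = et`_i by rewrite -Hx /= mulfK.
  by rewrite -[et`_i]mulr1 -(rmorph1 g); apply: wordsM; [apply: mem_nth|apply: wordsC].
have va := words_val vg vet wa.
have E : h ^+ m * g F = u ^+ m * (g a / g w ^+ (c * m)).
  have W0 : g w ^+ m * g w ^+ (c * m) != 0 by rewrite mulf_neq0 ?expf_neq0.
  apply: (mulIf W0); transitivity (g (F * (h' ^+ m * w ^+ (c * m)))).
    by rewrite !rmorphM !rmorphXn -hE !exprMn; ring.
  rewrite Ea rmorphM rmorphXn -uE exprMn.
  rewrite -[in RHS]mulrA [g w ^+ m * _]mulrC.
  have -> : g a / g w ^+ (c * m) * (g w ^+ (c * m) * g w ^+ m) = g a * g w ^+ m.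
    by rewrite mulrA divfK// expf_neq0.
  by ring.
have vX y q : v y = 0%E -> v (y ^+ q) = 0%E.
  by move=> vy; elim: q => [|q IH]; rewrite ?expr0 ?val1// exprS val_eq0M.
have vuX q : v (u ^+ q) = (q%:R * e)%:E.
  elim: q => [|q IH]; first by rewrite expr0 val1 mul0r.
  by rewrite exprS valM IH ve -EFinD -natr1 mulrDl mul1r addrC.
have := congr1 v E; rewrite !valM vX// add0e vuX -valM => ->.
apply: (@le_trans _ _ (m%:R * e)%:E); first by rewrite lee_fin.
exact: leeDl.
Qed.

End ValuationColon.

(** * Counting generators *)

(** The monomials of the box need not belong to [X], so a maximal linearly independent family inside
    [X] is taken; the number of monomials bounds its size. *)
Lemma box_generators (k : fieldType) N B (X : iterpoly k N -> Prop) : (forall x, X x -> dle B x) ->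
  exists r (f : 'I_r -> iterpoly k N), [/\ (r <= B.+1 ^ N)%N, forall i, X (f i) &
    forall x, X x -> exists c : 'I_r -> k, x = \sum_i iterpolyC k N (c i) * f i].
Proof.
move=> XB.
pose T r := `[< exists f : 'I_r -> iterpoly k N, (forall i, X (f i)) /\
  forall c : 'I_r -> k, \sum_i iterpolyC k N (c i) * f i = 0 -> forall i, c i = 0 >].
have T0 : exists r, T r by exists 0%N; apply/asboolP; exists (fun _ => 0); split=> [[]|c _ []].
have TB r : T r -> (r <= B.+1 ^ N)%N.
  move=> /asboolP[f [Xf free]]; rewrite leqNgt; apply/negP => lt.
  have [c Hc] := choice (fun i => dle_span (XB _ (Xf i))).
  have [|z [[i zi] Hz]] := @lin_dep k 'I_r {ffun 'I_N -> 'I_B.+1} (fun i h => c i h).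
    by rewrite mon_basis card_ord.
  move/eqP: zi; apply; apply: free.
  under eq_bigr do rewrite Hc mulr_sumr.
  rewrite exchange_big big1// => h _.
  under eq_bigr do rewrite mulrA -rmorphM.
  by rewrite -mulr_suml -rmorph_sum Hz rmorph0 mul0r.
case: (ex_maxnP T0 TB) => r Tr rmax; have rB := TB r Tr.
move/asboolP: Tr => [f [Xf free]]; exists r, f; split=> // x Xx.
pose f' (i : 'I_r.+1) := if unlift ord0 i is Some j then f j else x.
have [c [[i ci] c0]] : exists c : 'I_r.+1 -> k, (exists i, c i != 0) /\ \sum_i iterpolyC k N (c i) * f' i = 0.
  apply: contrapT => H; have : (r.+1 <= r)%N; last by rewrite ltnn.
  apply: rmax; apply/asboolP; exists f'; split.
    by move=> i; rewrite /f'; case: (unliftP ord0 i).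
  move=> c c0 i; apply/eqP; apply: contrapT => /negP ci; apply: H.
  by exists c; split=> //; exists i.
move: c0; rewrite big_ord_recl {1}/f' unlift_none.
under eq_bigr do rewrite /f' liftK.
move=> /eqP; rewrite addr_eq0 => /eqP E.
have cn0 : c ord0 != 0.
  apply: contraNneq ci => cz.
  have H : forall j, c (lift ord0 j) = 0.
    by apply: free; apply/eqP; rewrite -oppr_eq0 -E cz rmorph0 mul0r.
  by case: (unliftP ord0 i) => [j ->|->]; rewrite ?H ?cz.
exists (fun j => - ((c ord0)^-1 * c (lift ord0 j))).
have -> : x = iterpolyC k N (c ord0)^-1 * (iterpolyC k N (c ord0) * x).
  by rewrite mulrA -rmorphM mulVf// rmorph1 mul1r.
rewrite E mulrN mulr_sumr -sumrN; apply: eq_bigr => j _.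
by rewrite mulrA -rmorphM rmorphN mulNr.
Qed.

(** The [s] conditions form one colon condition for the vector of the [al i], with the module
    spanned by the vectors [x *: delta_mx i 0] for [x] in [X i]. Intersections of valuation ideals
    are thus treated at once. *)
Lemma colon_generators (k : fieldType) N s : exists E, forall a (al : 'I_s -> iterpoly k N)
    (X : 'I_s -> iterpoly k N -> Prop), (2 <= a)%N -> (s <= a)%N ->
  (forall i, dle a (al i)) -> (forall i x, X i x -> dle a x) ->
  forall F, (forall i, ispan (X i) (F * al i)) ->
    ispan (fun G => dle (a ^ E) G /\ forall i, ispan (X i) (G * al i)) F.
Proof.
have [E HE] := hermann_colon k N; exists E => a al X a2 sa dal dX F HF.
pose av : 'cV[iterpoly k N]_s := \col_i al i.
pose C (c : 'cV[iterpoly k N]_s) := exists i, exists2 x, X i x & c = x *: delta_mx i 0.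
have CP (c : 'cV[iterpoly k N]_s) : lspan C c -> forall i, ispan (X i) (c i 0).
  elim=> [|b x y [j [z Xz ->]] _ IH] i; first by rewrite mxE; apply: lspan0.
  rewrite !mxE; have [->|ne] := eqVneq i j; last first.
    by rewrite mulr0n mulr0 mulr0 add0r; apply: IH.
  by rewrite mulr1; apply: lspanS => //; apply: IH.
have PC (c : 'cV[iterpoly k N]_s) : (forall i, ispan (X i) (c i 0)) -> lspan C c.
  move=> H; have -> : c = \sum_i c i 0 *: delta_mx i 0.
    apply/matrixP => i j; rewrite (ord1 j) summxE (bigD1 i) //= !mxE !eqxx mulr1 big1 ?addr0// => l ne.
    by rewrite !mxE eq_sym (negPf ne) mulr0.
  apply: lspan_sum => i _; elim: (H i) => [|b x y Xx _ IH]; first by rewrite scale0r; apply: lspan0.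
  rewrite scalerDl -scalerA; apply: lspanS => //.
  by exists i, x.
have := HE a s av C F a2 sa _ _ _.
move=> H; apply: (lspan_trans _ (H _ _ _)).
- move=> G [dG /CP HG]; apply: lspan_in; split=> // i.
  by have := HG i; rewrite !mxE.
- by move=> i; rewrite mxE.
- move=> c [i [x Xx ->]] j; rewrite !mxE; case: (_ == _) => /=.
    by rewrite mulr1; apply: (dX i).
  by rewrite mulr0; apply: dle0.
- by apply: PC => i; rewrite !mxE.
Qed.

Section PolynomialBound.
Context (Rr : realType) (k : fieldType) (R : idomainType).

Lemma mu_polynomial_bound (hR : essentially_of_finite_type k R)
    (I : nat -> {pred R}) (hI : filtration I) (hdiv : R_divisorial Rr I) :
  exists A e : nat, forall n, exists r (f : 'I_r -> R^o),
    (r <= (A * n.+1) ^ e)%N /\ generates (I n : {pred R^o}) f.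
Proof.
have [N [psi lpsi]] := eft_presentation hR.
have [s [v [la [s0 dv la0 HI]]]] := hdiv.
pose g := to_frac psi.
have colon i : exists A : nat, forall n, exists (al : iterpoly k N) (X : iterpoly k N -> Prop),
  [/\ dle (A * n.+1) al, forall x, X x -> dle (A * n.+1) x &
      forall F, ((n%:R * la i)%:E <= v i (g F))%E <-> ispan X (F * al)].
  have [et [c [u [h [vet vh [u0 vu] H]]]]] := divisorial_uniformizer lpsi (dv i).
  apply: (valuation_colon _ (to_frac_rep lpsi) vet vh u0 vu H (la0 i)).
  by move=> a; exact: val_of_ge0.
have [A0 HA] := choice colon.
have [E HE] := colon_generators k N s.
(* The summands [s] and 2 provide [s <= a] and [2 <= a] for every [n]. *)
pose A := (\max_i A0 i + s + 2)%N.
exists A, (E.+1 * N)%N => n.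
have /choice[al /choice[X HX]] i := HA i n.
pose a := (A * n.+1)%N.
have A0a i : (A0 i * n.+1 <= a)%N.
  by rewrite leq_mul2r orbC /A -addnA (leq_trans (leq_bigmax i)) ?leq_addr.
have a2 : (2 <= a)%N by rewrite /a (@leq_trans A) ?leq_pmulr// /A leq_addl.
have sa : (s <= a)%N.
  by rewrite /a (@leq_trans A) ?leq_pmulr// /A addnAC leq_addl.
pose cond G := forall i, ((n%:R * la i)%:E <= v i (g G))%E.
have condP G : cond G <-> forall i, ispan (X i) (G * al i).
  by split=> H i; have [_ _ h] := HX i; apply/h.
have [|r [f [rB Xf fS]]] := @box_generators k N (a ^ E) (fun G => dle (a ^ E) G /\ cond G).
  by move=> x [].
have memI F : psi F \in I n <-> cond F by rewrite HI.
exists r, (fun i => psi (f i)); split.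
  rewrite (leq_trans rB)// expnM leq_expn2r// expnS -/a.
  have : (1 <= a ^ E)%N by rewrite expn_gt0 (leq_trans _ a2).
  by move: (a ^ E)%N a2; clear; nia.
have [clI _ _ _] := hI.
have [I0 ISD] := clI n.
have IM b x : x \in I n -> b * x \in I n.
  by move=> xI; have := ISD b x 0 xI I0; rewrite addr0.
have ID x y : x \in I n -> y \in I n -> x + y \in I n.
  by move=> xI yI; have := ISD 1 x y xI yI; rewrite scale1r.
move=> x; split=> [xI|[c ->]]; last first.
  apply: (big_ind (fun y : R => y \in I n)) => // i _; apply: IM.
  by apply/memI; have [] := Xf i.
(* [psi w] is a unit, so [x] and the polynomial image [psi F] generate the same ideal, and it
   suffices to generate [psi F]. *)
have [F [w [wu Ex]]] := lpsi x.
have cF : cond F by apply/memI; rewrite -Ex mulrC; apply: IM.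
have : ispan (fun G => dle (a ^ E) G /\ forall i, ispan (X i) (G * al i)) F.
  apply: HE => // [i|i y Xy|]; last exact/condP.
    by have [H _ _] := HX i; apply: dle_le H.
  by have [_ H _] := HX i; apply: dle_le (H _ Xy).
move=> HF; have [c Hc] : exists c : 'I_r -> R, psi F = \sum_i c i * psi (f i).
  elim: HF => [|b y y' [dy /condP cy] _ [c Hc]].
    by exists (fun _ => 0); rewrite rmorph0 big1// => i _; rewrite mul0r.
  have [d Hd] := fS y (conj dy cy).
  exists (fun i => psi b * psi (iterpolyC k N (d i)) + c i).
  rewrite (_ : b *: (y : (iterpoly k N)^o) + y' = b * y + y')//.
  rewrite rmorphD rmorphM Hd Hc rmorph_sum mulr_sumr -big_split; apply: eq_bigr => i _.
  by rewrite rmorphM mulrDl mulrA.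
exists (fun i => (psi w)^-1 * c i).
have -> : x = (psi w)^-1 * psi F by rewrite -Ex mulrCA mulVr ?mulr1.
rewrite Hc mulr_sumr; apply: eq_bigr => i _.
by rewrite mulrA.
Qed.

End PolynomialBound.

Theorem theorem2 (Rr : realType) (k : fieldType) (R : idomainType)
    (hR : essentially_of_finite_type k R)
    (I : nat -> {pred R}) (hI : filtration I) (hdiv : R_divisorial Rr I) :
  (divisorial_analytic_spread Rr I < +oo)%E.
Proof.
have [A [e H]] := mu_polynomial_bound hR hI hdiv.
apply: (@le_lt_trans _ _ (e.+1%:R)%:E); last exact: ltry.
apply: ereal_inf_lbound; exists e.+1%:R => //=.
(* For [n >= 1] one has [A * n.+1 <= 2 * A * n]; with [t = e.+1] the real power of exponent [t - 1]
   is the ordinary power [n ^ e]. *)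
exists ((2 * A)%:R ^+ e); exists 1%N => // n /= n1.
have [r [f [rle fgen]]] := H n.
apply: (@le_trans _ _ (r%:R)%:E).
  by apply: ereal_inf_lbound; exists r => //; exists f.
rewrite lee_fin -natr1 addrK powR_mulrn// -exprMn -natrM -natrX ler_nat.
rewrite (leq_trans rle)// leq_expn2r// [(2 * A)%N]mulnC -mulnA leq_mul2l.
by rewrite mul2n -addnn -addn1 leq_add2l n1 orbT.
Qed.
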